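(* Let $\alpha,\theta>0$. For each $\kappa\in\{0,1,2,\ldots\}$ let $(v_i^{(\kappa)})_{i\ge1}$ be a Beta chain with parameters $(\kappa,\alpha,\theta)$, and define $w_1^{(\kappa)}=v_1^{(\kappa)}$ and $w_j^{(\kappa)}=v_j^{(\kappa)}\prod_{i=1}^{j-1}\bigl(1-v_i^{(\kappa)}\bigr)$ for $j\ge2$. Then: (i) For $\alpha=1$, $\kappa=0$, and any choice of $\theta$, the sequence $(w_j^{(\kappa)})_{j\ge1}$ is size-biased ordered. (ii) For any choices of $\alpha$ and $\theta$, and for every $j\ge1$, $$\lim_{\kappa\to\infty}\mathbb{P}\bigl[w_{j+1}^{(\kappa)}<w_j^{(\kappa)}\bigr]=1.$$
   Context: $\mathrm{Be}(a,b)$ denotes the Beta distribution on $[0,1]$ and $\mathrm{Bin}(\kappa,p)$ the Binomial distribution, with $\mathrm{Bin}(0,p)=\delta_0$. Given $\kappa\in\{0,1,\ldots\}$ and $\alpha,\theta>0$, a Beta chain with parameters $(\kappa,\alpha,\theta)$ is a Markov chain $(v_i)_{i\ge1}$ on $[0,1]$ with $v_1\sim \mathrm{Be}(\alpha,\theta)$ and transition probabilities $$\mathbb{P}[v_{i+1}\in A\mid v_i]=\int_A\sum_{x=0}^{\kappa}\mathrm{Be}(s\mid\alpha+x,\theta+\kappa-x)\,\mathrm{Bin}(x\mid\kappa,v_i)\,ds,$$ where $\mathrm{Be}(s\mid a,b)$ and $\mathrm{Bin}(x\mid\kappa,p)$ denote the corresponding density and mass function. Size-biased permutation: for a random sequence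 of weights $W=(w_j)_{j\ge1}$ with $w_j\geq 0$ and $\sum_{j}w_j=1$ a.s., its size-biased permutation $\tilde W=(\tilde w_j)_{j\ge1}$ is the random reordering of $W$ satisfying $\mathbb{P}[\tilde w_1=w_j\mid W]=w_j$ and, for $n\ge2$, $$\mathbb{P}[\tilde w_n=w_j\mid W,\tilde w_1,\ldots,\tilde w_{n-1}]=\frac{w_j}{1-\sum_{i=1}^{n-1}\tilde w_i}\mathbf{1}_{\{w_j\notin\{\tilde w_1,\ldots,\tilde w_{n-1}\}\}}$$ (the weights being a.s. distinct). The sequence $W$ is said to be size-biased ordered if it is equal in distribution to its size-biased permutation $\tilde W$. *)

(* Defs.v *)
From HB Require Import structures.
From mathcomp Require Import all_boot all_order all_algebra.
From mathcomp Require Import all_classical all_reals all_analysis.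
From mathcomp Require Import measurable_realfun.
Import Order.TTheory GRing.Theory Num.Theory.
Import numFieldNormedType.Exports.

Set Implicit Arguments.
Unset Strict Implicit.
Unset Printing Implicit Defensive.

Local Open Scope classical_set_scope.
Local Open Scope ring_scope.

(* All sequences are indexed from 0: index j here is index j + 1 in the usual
   notation v_1, v_2, ... *)

Section beta_chain.
Context {R : realType}.
Local Notation mu := (@lebesgue_measure R).

(* The library's beta_fun and beta_pdf only allow natural number parameters. *)
Definition be_fun (a b : R) : R :=
  \int[mu]_(s in `]0, 1[) (s `^ (a - 1) * (1 - s) `^ (b - 1)).

(* The endpoints, where the density may be infinite, are dropped. *)
Definition be_pdf (a b s : R) : R :=
  ((fun u => u `^ (a - 1) * (1 - u) `^ (b - 1)) \_ `]0, 1[) s / be_fun a b.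

Definition beta_kernel (kappa : nat) (alpha theta p : R) (A : set R) : \bar R :=
  (\int[mu]_(s in A)
    (\sum_(x < kappa.+1)
       be_pdf (alpha + x%:R) (theta + kappa%:R - x%:R) s
       * binomial_pmf kappa p x)%:E)%E.

Section conditional_probability.
Context {d} {T : measurableType d} (P : probability T R).

(* Y is a version of the conditional probability P[E | G]; G is a
   sub-sigma-algebra of the events. *)
Definition is_cond_prob (G : set (set T)) (E : set T) (Y : T -> \bar R) : Prop :=
  (forall B : set (\bar R), measurable B -> G (Y @^-1` B)) /\
  (forall F, G F -> (\int[P]_(t in F) Y t)%E = P (E `&` F)).

End conditional_probability.

(* The smallest sigma-algebra containing  coord_events D X  is the one generated
   by the X i for i in D. *)
Definition coord_events {T : Type} (D : set nat) (X : nat -> T -> R) :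
    set (set T) :=
  \bigcup_(i in D) preimage_set_system setT (X i) measurable.

Definition beta_chain {d} {T : measurableType d} (P : probability T R)
    (kappa : nat) (alpha theta : R) (v : nat -> {RV P >-> R}) : Prop :=
  [/\ (forall i t, 0 <= v i t <= 1),
      (forall A, measurable A ->
         distribution P (v 0%N) A =
         (\int[mu]_(s in A) (be_pdf alpha theta s)%:E)%E)
    & (forall n A, measurable A ->
         is_cond_prob P <<s coord_events `I_n.+1 v >> (v n.+1 @^-1` A)
           (fun t => beta_kernel kappa alpha theta (v n t) A))].

End beta_chain.

Section stick_breaking.
Context {R : realType} {d} {T : measurableType d} {P : probability T R}.

Definition stick_fun (v : nat -> {RV P >-> R}) (j : nat) : T -> R :=
  fun t => v j t * \prod_(i < j) (1 - v i t).

Lemma measurable_stick_fun v j : measurable_fun setT (stick_fun v j).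
Proof.
apply: measurable_funM => //.
apply: measurable_prod => i _.
exact: measurable_funB.
Qed.

HB.instance Definition _ v j :=
  isMeasurableFun.Build _ _ _ _ (stick_fun v j) (measurable_stick_fun v j).

Definition stick_breaking (v : nat -> {RV P >-> R}) : nat -> {RV P >-> R} :=
  fun j => stick_fun v j.

End stick_breaking.

Section size_biased.
Context {R : realType}.

Definition random_weights {d} {T : measurableType d} (P : probability T R)
    (W : nat -> {RV P >-> R}) : Prop :=
  {ae P, forall t, [/\ (forall j, 0 <= W j t),
                       series (fun j => W j t) @ \oo --> (1 : R)
                     & injective (fun j => W j t)]}.

(* Equality of laws on R^nat with its product sigma-algebra; the two sequences
   may live on different probability spaces. *)
Definition eq_in_law {d d'} {T : measurableType d} {T' : measurableType d'}
    (P : probability T R) (P' : probability T' R)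
    (X : nat -> {RV P >-> R}) (X' : nat -> {RV P' >-> R}) : Prop :=
  forall A : set (nat -> R),
    <<s coord_events setT (fun i (x : nat -> R) => x i) >> A ->
    P [set t | A (fun i => X i t)] = P' [set t | A (fun i => X' i t)].

(* Wt lists the weights of W, each at most once; a weight equal to 0 is never
   selected, so only positive weights are required to appear. *)
Definition reordering {d} {T : measurableType d} (P : probability T R)
    (W Wt : nat -> {RV P >-> R}) : Prop :=
  {ae P, forall t, exists s : nat -> nat,
    [/\ injective s, (forall n, Wt n t = W (s n) t)
      & forall j, 0 < W j t -> exists n, s n = j]}.

Definition size_biased_permutation {d} {T : measurableType d}
    (P : probability T R) (W Wt : nat -> {RV P >-> R}) : Prop :=
  reordering W Wt /\
  forall n j,
    is_cond_prob P <<s coord_events setT W `|` coord_events `I_n Wt >>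
      [set t | Wt n t = W j t]
      (fun t => (W j t / (1 - \sum_(i < n) Wt i t)
                 * \1_(~` [set Wt i t | i in `I_n]) (W j t))%:E).

(* A size-biased permutation uses extra randomness, so it lives on a space
   carrying a copy W' of W; its law is determined by that of W. We ask that such
   a permutation exists, and that all of them have the law of W. *)
Definition size_biased_ordered {d} {T : measurableType d} (P : probability T R)
    (W : nat -> {RV P >-> R}) : Prop :=
  [/\ random_weights W,
      (exists d' (T' : measurableType d') (P' : probability T' R)
              (W' Wt : nat -> {RV P' >-> R}),
         eq_in_law W' W /\ size_biased_permutation W' Wt)
    & (forall d' (T' : measurableType d') (P' : probability T' R)
              (W' Wt : nat -> {RV P' >-> R}),
         eq_in_law W' W -> size_biased_permutation W' Wt -> eq_in_law W Wt)].

End size_biased.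

(* Main.v *)
From HB Require Import structures.
Require Import Defs.
From mathcomp Require Import all_boot all_order all_algebra.
From mathcomp Require Import all_classical all_reals all_analysis.
From mathcomp Require Import measurable_realfun.
From mathcomp Require Import ring lra zify.
Import Order.TTheory GRing.Theory Num.Theory.
Import numFieldNormedType.Exports.
Set Implicit Arguments.
Unset Strict Implicit.
Unset Printing Implicit Defensive.
Local Open Scope classical_set_scope.
Local Open Scope ring_scope.

(** Why the theorem holds.

    Part (i).  For kappa = 0 the transition kernel does not depend on the
    current state, so the chain is a sequence of independent Be(1, theta)
    variables (lemma [chain_iid]).  Be(1, theta) has density proportional to
    (1 - s)^(theta - 1), and (1 - a) (1 - b) = 1 - (a + y) when
    y = (1 - a) b.  Hence the joint density of two consecutive sticks, measured
    relatively to what was left before them and multiplied by what is left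
    after the first one, depends on their total length only; the weighted law
    is unchanged when the two sticks are exchanged ([adjacent_swap]).

    Size-biased picks are exchanges in disguise.  Let r_l be the mass left
    after l sticks.  Keep the first n sticks in place and move to place n the
    stick l >= n, chosen with probability
    w_l / r_n = (r_l - r_(l+1)) / r_n.  Let F be a test function and J_k the
    expectation of r_(n+k) / r_n times F of the sticks with stick n + k moved
    to place n.  By the exchange of the sticks n + k and n + k + 1, the negative
    part of the term l = n + k is J_(k+1), so that the sum over l telescopes to
    J_0, the expectation of F of the sticks ([pick_invariant]): a size-biased
    pick does not change the law.

    A size-biased permutation is a sequence of such picks.  Its conditional
    probabilities determine its law: conditioning on the picks one after the
    other, from the last to the first, writes the law of its first N terms as
    an iteration of picks applied to the weights, so this law is the law of the
    weights ([size_biased_law]).  As for existence, the variables of even index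
    already provide sticks with the right law; the distribution function of
    Be(1, theta) turns the variables of odd index into independent uniform
    variables, with which the picks are made by inversion
    ([pick_probability], [sampled_cond_prob]).  The picked sticks have the law
    of the sticks, hence their total mass is 1, hence no stick is forgotten
    ([sampled_size_biased]).

    Part (ii).  Be(alpha, theta) is stationary for the chain: v_(n+1) arises
    from v_n by drawing X from Bin(kappa, v_n) and then v_(n+1) from the law of
    a Be(alpha, theta) variable given that its own binomial count is X (Bayes'
    formula, [posterior_count_mass]).  Therefore v_n and v_(n+1) are both close to
    X / kappa when kappa is large: by Chebyshev's inequality, the chain jumps
    from below a to above b with probability at most 4 / (kappa (b - a)^2)
    ([chain_jump]).  On the other hand w_(n+1) >= w_n means
    v_n <= v_(n+1) (1 - v_n), which forces v_(n+1) >= v_n + v_n^2.  This is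
    either a jump of size at least eta^2, or v_n <= eta; the first is unlikely
    as kappa grows, and the second is unlikely, uniformly in kappa, for eta
    small ([chain_fail], [stick_breaking_decreases]). *)

(** * Measures given by a density *)

Lemma measurable_preimage d1 d2 (T1 : measurableType d1) (T2 : measurableType d2)
    (f : T1 -> T2) (B : set T2) :
  measurable_fun setT f -> measurable B -> measurable (f @^-1` B).
Proof. by move=> mf mB; rewrite -[X in measurable X]setTI; exact: mf. Qed.

Section density.
Local Open Scope ereal_scope.
Context d (S : measurableType d) (R : realType).
Variables m mu : {measure set S -> \bar R}.
Variable f : S -> R.
Hypothesis mf : measurable_fun setT f.
Hypothesis f0 : forall x, (0 <= f x)%R.
Hypothesis mE : forall A, measurable A -> m A = \int[mu]_(x in A) (f x)%:E.

Import HBNNSimple.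

Let density_nnsfun (g : {nnsfun S >-> R}) :
  \int[m]_x (g x)%:E = \int[mu]_x ((g x)%:E * (f x)%:E).
Proof.
have mi r : measurable_fun [set: S] (\1_(g @^-1` [set r]) : S -> R).
  exact: measurable_indic.
under eq_integral do rewrite fimfunE -fsumEFin//.
rewrite ge0_integral_fsum//; last 2 first.
- by move=> y; exact/measurable_EFinP/measurable_funM.
- by move=> y x _; rewrite nnfun_muleindic_ge0.
transitivity (\int[mu]_x (\sum_(y \in range g)
    ((y * \1_(g @^-1` [set y]) x)%:E * (f x)%:E))); last first.
  apply: eq_integral => x _.
  rewrite -ge0_mule_fsuml; last by move=> i; rewrite nnfun_muleindic_ge0.
  by rewrite fsumEFin// -fimfunE.
rewrite ge0_integral_fsum//; last 2 first.
- move=> y; apply: emeasurable_funM; apply/measurable_EFinP => //.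
  exact: measurable_funM.
- by move=> y x _; rewrite mule_ge0 ?nnfun_muleindic_ge0 ?lee_fin.
apply: eq_fsbigr => r; rewrite inE => -[x0 _ rE].
have r0 : (0 <= r)%R by rewrite -rE.
rewrite integralZl_indic_nnsfun// integral_indic// setIT mE//.
rewrite integral_mkcond -ge0_integralZl_EFin//; last 2 first.
- by move=> x _; rewrite erestrict_ge0// => ? _; rewrite lee_fin.
- apply/(measurable_restrictT _ _).1 => //.
  by apply/measurable_funTS/measurable_EFinP.
apply: eq_integral => x _; rewrite patchE indicE -!EFinM.
by case: ifPn => _; rewrite ?mulr1 ?mulr0 ?mul0r ?mule0.
Qed.

(** Both sides agree on simple functions; monotone convergence extends this. *)
Lemma ge0_integral_density (h : S -> \bar R) : measurable_fun setT h ->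
  (forall x, 0 <= h x) -> \int[m]_x h x = \int[mu]_x (h x * (f x)%:E).
Proof.
move=> mh h0; pose g := nnsfun_approx measurableT mh.
transitivity (limn (fun n => \int[m]_x (g n x)%:E)).
  rewrite -monotone_convergence//.
  - apply: eq_integral => y _; apply/esym/cvg_lim => //.
    exact: cvg_nnsfun_approx.
  - by move=> n; exact/measurable_EFinP/measurable_funP.
  - by move=> n y _; rewrite lee_fin.
  - by move=> y _ n p np; rewrite lee_fin; exact/lefP/nd_nnsfun_approx.
transitivity (limn (fun n => \int[mu]_x ((g n x)%:E * (f x)%:E))).
  by congr (limn _); apply/funext => n; exact: density_nnsfun.
rewrite -monotone_convergence//.
- apply: eq_integral => y _; apply/cvg_lim => //.
  by apply: cvgeZr => //; exact: cvg_nnsfun_approx.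
- by move=> n; apply: emeasurable_funM; apply/measurable_EFinP.
- by move=> n y _; rewrite mule_ge0// lee_fin.
- move=> y _ n p np; rewrite lee_wpmul2r ?lee_fin//.
  exact/lefP/nd_nnsfun_approx.
Qed.

End density.

(** * The space of real sequences *)
Section sequence_space.
Context {R : realType}.

Definition cylinder_events : set (set (nat -> R)) :=
  coord_events setT (fun i (x : nat -> R) => x i).

Definition seqR := g_sigma_algebraType cylinder_events.

Lemma measurable_coord i : measurable_fun setT (fun x : seqR => x i).
Proof.
by move=> _ B mB; apply: sub_sigma_algebra; exists i => //; exists B.
Qed.

Lemma measurable_seqP d (T : measurableType d) (X : T -> seqR) :
  (forall i, measurable_fun setT (fun t => X t i)) -> measurable_fun setT X.
Proof.
move=> mX; apply: (@measurability _ _ T seqR setT X cylinder_events) => //.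
move=> _ [_ [i _ [B mB <-]] <-]; rewrite setTI setTI.
by have := mX i measurableT B mB; rewrite setTI.
Qed.

Definition box (n : nat) (B : nat -> set R) : set seqR :=
  [set x | forall i, (i < n)%N -> B i (x i)].

Lemma boxE n B : box n B = \bigcap_(i in `I_n) ((fun x : seqR => x i) @^-1` B i).
Proof. by []. Qed.

Lemma measurable_box n B : (forall i, measurable (B i)) -> measurable (box n B).
Proof.
move=> mB; rewrite boxE; apply: fin_bigcap_measurable => // i _.
by have := measurable_coord i measurableT (mB i); rewrite setTI.
Qed.

Definition boxes : set (set seqR) :=
  [set A | exists n B, (forall i, measurable (B i)) /\ A = box n B].

Lemma boxes_gen : (@measurable _ seqR) = <<s boxes >>.
Proof.
apply/seteqP; split.
  apply: smallest_sub; first exact: smallest_sigma_algebra.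
  move=> _ [i _ [B mB <-]]; apply: sub_sigma_algebra.
  exists i.+1, (fun j => if j == i then B else setT); split.
    by move=> j; case: ifP.
  rewrite setTI; apply/seteqP; split => x /=.
    by move=> xB j _; case: eqP => // ->.
  by move=> /(_ i (ltnSn i)); rewrite eqxx.
apply: smallest_sub; first exact: sigma_algebra_measurable.
by move=> _ [n [B [mB ->]]]; exact: measurable_box.
Qed.

Lemma setI_closed_boxes : setI_closed boxes.
Proof.
move=> _ _ [n [B [mB ->]]] [p [C [mC ->]]].
exists (maxn n p), (fun i => (if (i < n)%N then B i else setT) `&`
                             (if (i < p)%N then C i else setT)); split.
  by move=> i; apply: measurableI; case: ifP.
apply/seteqP; split=> [x [xB xC] i _|x xBC].
  by split; case: ifPn => // ?; [exact: xB|exact: xC].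
split=> i ip; have [] := xBC i; rewrite ?leq_max ?ip ?orbT//.
Qed.

(** The boxes generate the product sigma-algebra and are stable under
    intersection, so this is the uniqueness of measures on a pi-system. *)
Lemma seqR_measure_unique (m1 m2 : {measure set seqR -> \bar R}) :
  (m1 setT < +oo)%E ->
  (forall n B, (forall i, measurable (B i)) -> m1 (box n B) = m2 (box n B)) ->
  forall A, measurable A -> m1 A = m2 A.
Proof.
move=> m1T m12; apply: (measure_unique boxes (fun=> setT)) => //.
- exact: boxes_gen.
- exact: setI_closed_boxes.
- by move=> _; exists 0%N, (fun=> setT); split => //; apply/seteqP; split.
- by rewrite bigcup_const//; exists 0%N.
- by move=> _ [n [B [mB ->]]]; exact: m12.
Qed.

End sequence_space.
Arguments seqR : clear implicits.


(** * Random sequences and their laws *)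

Section equality_of_laws.
Context {R : realType} d1 d2 (T1 : measurableType d1) (T2 : measurableType d2).
Variables (P1 : {measure set T1 -> \bar R}) (P2 : {measure set T2 -> \bar R}).

Lemma ge0_integral_eq_law d (S : measurableType d) (X1 : T1 -> S)
    (X2 : T2 -> S) (g : S -> \bar R) :
  measurable_fun setT X1 -> measurable_fun setT X2 ->
  (forall A, measurable A -> P1 (X1 @^-1` A) = P2 (X2 @^-1` A)) ->
  measurable_fun setT g -> (forall x, 0 <= g x)%E ->
  (\int[P1]_t g (X1 t) = \int[P2]_t g (X2 t))%E.
Proof.
move=> mX1 mX2 P12 mg g0.
have := ge0_integral_pushforward mX1 P1 measurableT mg (fun y _ => g0 y).
have := ge0_integral_pushforward mX2 P2 measurableT mg (fun y _ => g0 y).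
rewrite !preimage_setT /= => <- <-.
pose Y1 : {mfun T1 >-> S} := HB.pack X1 (isMeasurableFun.Build _ _ _ _ _ mX1).
pose Y2 : {mfun T2 >-> S} := HB.pack X2 (isMeasurableFun.Build _ _ _ _ _ mX2).
rewrite -[pushforward P1 X1]/(pushforward P1 Y1).
rewrite -[pushforward P2 X2]/(pushforward P2 Y2).
by apply: eq_measure_integral => A mA _; exact: P12.
Qed.

Lemma eq_law_boxes (X1 : T1 -> seqR R) (X2 : T2 -> seqR R) :
  measurable_fun setT X1 -> measurable_fun setT X2 -> (P1 setT < +oo)%E ->
  (forall n B, (forall i, measurable (B i)) ->
     P1 (X1 @^-1` box n B) = P2 (X2 @^-1` box n B)) ->
  forall A, measurable A -> P1 (X1 @^-1` A) = P2 (X2 @^-1` A).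
Proof.
move=> mX1 mX2 P1oo P12 A mA.
pose Y1 : {mfun T1 >-> seqR R} :=
  HB.pack X1 (isMeasurableFun.Build _ _ _ _ _ mX1).
pose Y2 : {mfun T2 >-> seqR R} :=
  HB.pack X2 (isMeasurableFun.Build _ _ _ _ _ mX2).
exact: (@seqR_measure_unique R (pushforward P1 Y1) (pushforward P2 Y2)).
Qed.

End equality_of_laws.

Section independence.
Local Open Scope ereal_scope.
Context {R : realType} d (T : measurableType d) (P : probability T R).
Implicit Types v : nat -> {RV P >-> R}.

Definition iid v (beta : probability R R) : Prop :=
  forall n (B : nat -> set R), (forall i, measurable (B i)) ->
  P [set t | forall i, (i < n)%N -> B i (v i t)] = \prod_(i < n) beta (B i).

Definition seq_of v : T -> seqR R := fun t i => v i t.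

Lemma measurable_seq_of v : measurable_fun setT (seq_of v).
Proof. exact: measurable_seqP. Qed.

Definition update (n : nat) (x : nat -> R) (s : R) : nat -> R :=
  fun i => if i == n then s else x i.

Lemma measurable_upd n :
  measurable_fun setT (fun z : seqR R * R => update n z.1 z.2 : seqR R).
Proof.
apply: measurable_seqP => i; rewrite /update; case: eqP => _.
  exact: measurable_snd.
exact: (measurableT_comp (@measurable_coord R i) (@measurable_fst _ _ (seqR R) R)).
Qed.

(** Refreshing one coordinate of an independent sequence: the expectation may
    first be taken over a fresh copy [s] of the coordinate [n].  This is the form
    in which independence is used, since it exposes a one-dimensional integral
    without splitting the sequence space into a product. *)
Lemma ge0_integral_upd v beta n (g : seqR R -> \bar R) :
  iid v beta -> measurable_fun setT g -> (forall x, 0 <= g x) ->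
  \int[P]_t g (seq_of v t) =
  \int[P]_t \int[beta]_s g (update n (seq_of v t) s).
Proof.
move=> vb mg g0.
have mU : measurable_fun setT
    (fun z : T * R => update n (seq_of v z.1) z.2 : seqR R).
  apply: (measurableT_comp (measurable_upd n)
    (_ : measurable_fun setT (fun z : T * R => (seq_of v z.1, z.2)))).
  apply: measurable_fun_pair => //.
  exact: (measurableT_comp (measurable_seq_of v) (@measurable_fst _ _ T R)).
have -> : \int[P]_t \int[beta]_s g (update n (seq_of v t) s) =
          \int[P \x beta]_z g (update n (seq_of v z.1) z.2).
  rewrite fubini_tonelli1//.
  exact: measurableT_comp mg mU.
apply: (ge0_integral_eq_law (measurable_seq_of v) mU) => //.
apply: eq_law_boxes => //; first exact: measurable_seq_of.
  by rewrite [ltLHS]probability_setT ltry.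
move=> N B mB; rewrite /preimage /= [LHS]vb//.
pose B' i := if i == n then setT else B i.
have mB' i : measurable (B' i) by rewrite /B'; case: ifP.
have -> : [set z : T * R | box N B (update n (seq_of v z.1) z.2)] =
    [set t | forall i, (i < N)%N -> B' i (v i t)] `*`
    (if (n < N)%N then B n else setT).
  apply/seteqP; split => [[t s]/= zB|[t s]/= [tB sB] i iN].
    split=> [i iN|].
      by rewrite /B'; have := zB i iN; rewrite /update; case: eqP.
    by case: ifPn => // nN; have := zB n nN; rewrite /update eqxx.
  have := tB i iN; rewrite /update /B'; case: eqP => // ->{i} in iN *.
  by rewrite iN in sB.
rewrite product_measure1E//; last 2 first.
- have -> : [set t | forall i, (i < N)%N -> B' i (v i t)] =
     seq_of v @^-1` box N B' by [].
  have := measurable_seq_of v measurableT (measurable_box N mB').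
  by rewrite setTI.
- by case: ifP.
rewrite [X in X * _]vb//.
have [nN|nN] := ltnP n N.
  rewrite (bigD1 (Ordinal nN))//= [in RHS](bigD1 (Ordinal nN))//=.
  rewrite {1}/B' eqxx probability_setT mul1e muleC; congr (_ * _).
  by apply: eq_bigr => i; rewrite -val_eqE /= /B' => /negbTE ->.
rewrite /= probability_setT mule1; apply: eq_bigr => i _.
by rewrite /B'; case: eqP => // iE; move: (ltn_ord i); rewrite iE ltnNge nN.
Qed.

End independence.


(** * Stick breaking *)

Section stick_map.
Context {R : realType}.
Implicit Types x : nat -> R.

(** By [rest_stick], this product is the mass left after the first [n] sticks. *)
Definition rest x n : R := \prod_(i < n) (1 - x i).

Definition stick x : nat -> R := fun j => x j * rest x j.

Lemma restS x n : rest x n.+1 = rest x n * (1 - x n).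
Proof. by rewrite /rest big_ord_recr. Qed.

Lemma rest_stick x n : 1 - \sum_(i < n) stick x i = rest x n.
Proof.
elim: n => [|n IH]; first by rewrite big_ord0 subr0 /rest big_ord0.
by rewrite big_ord_recr/= opprD addrA IH restS /stick; ring.
Qed.

Lemma measurable_rest n : measurable_fun setT (rest^~ n : seqR R -> R).
Proof.
apply: measurable_prod => i _.
by apply: measurable_funB => //; exact: measurable_coord.
Qed.

Lemma measurable_stickj n :
  measurable_fun setT ((fun x => stick x n) : seqR R -> R).
Proof.
apply: measurable_funM; first exact: measurable_coord.
exact: measurable_rest.
Qed.

Lemma measurable_stick : measurable_fun setT (stick : seqR R -> seqR R).
Proof. by apply: measurable_seqP => i; exact: measurable_stickj. Qed.

Lemma rest_gt0 x n : (forall i, 0 < x i < 1) -> 0 < rest x n.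
Proof.
by move=> x01; apply: prodr_gt0 => i _; rewrite subr_gt0; case/andP: (x01 i).
Qed.

Lemma stick_gt0 x n : (forall i, 0 < x i < 1) -> 0 < stick x n.
Proof.
by move=> x01; rewrite mulr_gt0 ?rest_gt0//; case/andP: (x01 n).
Qed.

End stick_map.

Section iid_sticks.
Local Open Scope ereal_scope.
Context {R : realType} d (T : measurableType d) (P : probability T R).
Variables (v : nat -> {RV P >-> R}) (beta : probability R R).
Hypothesis v_iid : iid v beta.
Hypothesis beta01 : beta `]0%R, 1%R[%classic = 1.
Hypothesis beta_atomless : forall s, beta [set s] = 0.

Lemma iid_marginal i B : measurable B -> P (v i @^-1` B) = beta B.
Proof.
move=> mB; pose C j := if j == i then B else setT.
have mC j : measurable (C j) by rewrite /C; case: ifP.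
have := v_iid i.+1 mC; rewrite big_ord_recr/= /C eqxx big1 ?mul1e.
  move=> <-; congr (P _); apply/seteqP; split => t /=.
    by move=> Bt j _; case: eqP => // ->.
  by move=> /(_ i (ltnSn i)); rewrite eqxx.
move=> j _; case: eqP => [ji|_]; last by rewrite probability_setT.
by move: (ltn_ord j); rewrite ji ltnn.
Qed.

Lemma ae_open_unit : {ae P, forall t, forall i, (0 < v i t < 1)%R}.
Proof.
apply: ae_foralln => i; exists (v i @^-1` (~` `]0%R, 1%R[%classic)); split.
- rewrite -[X in measurable X]setTI.
  by apply: measurable_funPT => //; exact: measurableC.
- have mB : measurable (~` `]0%R, 1%R[%classic : set R) by exact: measurableC.
  apply: (eq_trans (iid_marginal i mB)).
  by rewrite probability_setC// [X in 1 - X]beta01 subee.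
- by move=> t /=; rewrite in_itv.
Qed.

Let mn1 : measurable_fun [set: R] (fun s : R => `|1 - s|%R).
Proof. by apply: measurableT_comp => //; exact: measurable_funB. Qed.

(** The absolute value keeps the integrand nonnegative on the whole line; it is
    the expectation of 1 - s, as [beta] lives on the unit interval. *)
Definition mean_rest : R := fine (\int[beta]_s (`|1 - s|%R)%:E).

Let beta_ae : {ae beta, forall s, (0 < s < 1)%R}.
Proof.
exists (~` `]0%R, 1%R[%classic); split.
- exact: measurableC.
- by rewrite [LHS]probability_setC// [X in 1 - X]beta01 subee.
- by move=> s /=; rewrite in_itv.
Qed.

(** The mean of s and that of 1 - s add up to 1, and the former is not 0 as
    [beta] gives no mass to 0. *)
Lemma mean_rest_itv : (0 <= mean_rest < 1)%R /\
  \int[beta]_s (`|1 - s|%R)%:E = mean_rest%:E.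
Proof.
have i0 : 0 <= \int[beta]_s (`|1 - s|%R)%:E.
  by apply: integral_ge0 => s _; rewrite lee_fin.
have s0 : 0 <= \int[beta]_s (`|s|%R)%:E.
  by apply: integral_ge0 => s _; rewrite lee_fin.
have ms : measurable_fun [set: R] (fun s : R => (`|s|%R)%:E).
  by apply/measurable_EFinP; exact: normr_measurable.
have sum1 : \int[beta]_s (`|1 - s|%R)%:E + \int[beta]_s (`|s|%R)%:E = 1.
  rewrite -ge0_integralD//; last exact/measurable_EFinP.
  transitivity (\int[beta]_s (cst 1%:E s)).
    apply: ge0_ae_eq_integral => //.
    - by apply: emeasurable_funD => //; exact/measurable_EFinP.
    - by move=> s _; rewrite adde_ge0 ?lee_fin.
    - apply: filterS beta_ae => s /andP[s_gt0 s1] _.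
      rewrite -EFinD !ger0_norm ?(ltW s_gt0) ?subr_ge0 ?(ltW s1)//.
      by rewrite subrK.
  by rewrite integral_cst// mul1e; exact: probability_setT.
have sneq0 : \int[beta]_s (`|s|%R)%:E != 0.
  apply/eqP => bs0.
  have h : ae_eq beta setT (fun s : R => s%:E) (cst 0).
    have mE := @EFin_measurable R setT.
    exact: (ae_eq_integral_abs beta measurableT mE).1.
  have [N [mN N0 sN]] : {ae beta, forall s : R, False}.
    by apply: filterS2 h beta_ae => s /(_ Logic.I) [->]; rewrite ltxx.
  have : beta setT <= beta N.
    by apply: le_measure; rewrite ?inE// => s _; apply: sN => /=; tauto.
  by rewrite N0 [X in X <= _]probability_setT lee_fin ler10.
have fin : \int[beta]_s (`|1 - s|%R)%:E \is a fin_num.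
  rewrite ge0_fin_numE//; apply: le_lt_trans (ltry 1).
  by rewrite -sum1 leeDl.
split; last by rewrite fineK.
rewrite fine_ge0//= -lte_fin fineK// -sum1 lteDl//.
by rewrite lt_def s0 sneq0.
Qed.

Lemma integral_tail_prod n k :
  \int[P]_t (\prod_(i < k) `|1 - v (n + i)%N t|)%:E = (mean_rest ^+ k)%:E.
Proof.
have [/andP[c0 c1] cE] := mean_rest_itv.
elim: k => [|k IH].
  under eq_integral do rewrite big_ord0.
  by rewrite integral_cst// mul1e expr0; exact: probability_setT.
pose p k (x : seqR R) := (\prod_(i < k) `|1 - x (n + i)%N|)%R.
have mp j : measurable_fun setT (fun x => (p j x)%:E).
  apply/measurable_EFinP/measurable_prod => i _.
  by apply: measurableT_comp mn1 _; exact: measurable_coord.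
have p0 j x : 0 <= (p j x)%:E by rewrite lee_fin prodr_ge0.
rewrite [LHS](ge0_integral_upd (n + k)%N v_iid (mp k.+1))//.
transitivity (\int[P]_t (mean_rest%:E * (p k (seq_of v t))%:E)).
  apply: eq_integral => t _.
  transitivity (\int[beta]_s ((p k (seq_of v t))%:E * `|1 - s|%:E)).
    apply: eq_integral => s _; rewrite /p big_ord_recr/= /update eqxx EFinM.
    congr (_%:E * _); apply: eq_bigr => i _.
    by rewrite eqn_add2l (ltn_eqF (ltn_ord i)).
  rewrite ge0_integralZl//; last exact/measurable_EFinP.
  by rewrite cE muleC.
rewrite ge0_integralZl//.
- by rewrite [X in _ * X]IH -EFinM -exprS.
- exact: (measurableT_comp (mp k) (measurable_seq_of v)).
Qed.

Lemma mean_rest_cvg0 : ((mean_rest ^+ k)%:E @[k --> \oo] --> 0).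
Proof.
have [/andP[c0 c1] _] := mean_rest_itv.
by apply: cvg_EFin; [exact: nearW|apply: cvg_expr; rewrite ger0_norm].
Qed.

(** The mean of [rest] after n sticks is c^n with c < 1.  By Markov's inequality
    the infimum of the nonincreasing sequence [rest] is almost surely 0. *)
Lemma ae_rest_cvg0 : {ae P, forall t, rest (seq_of v t) n @[n --> \oo] --> (0 : R)%R}.
Proof.
have mr n : measurable_fun setT (fun t => `|rest (seq_of v t) n|%R).
  apply: measurableT_comp => //.
  exact: (measurableT_comp (measurable_rest n) (measurable_seq_of v)).
have Er n : \int[P]_t (`|rest (seq_of v t) n|%R)%:E = (mean_rest ^+ n)%:E.
  rewrite -(integral_tail_prod 0); apply: eq_integral => t _.
  by rewrite /rest normr_prod.
have small k : {ae P, forall t, exists n, (`|rest (seq_of v t) n| < k.+1%:R^-1)%R}.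
  exists (\bigcap_n [set t | (k.+1%:R^-1)%:E <= (`|rest (seq_of v t) n|%R)%:E]).
  have mS n : measurable [set t | (k.+1%:R^-1)%:E <= (`|rest (seq_of v t) n|%R)%:E].
    rewrite -[X in measurable X]setTI; apply: emeasurable_fun_c_infty => //.
    exact/measurable_EFinP.
  split; first exact: bigcapT_measurable.
    apply/eqP; rewrite eq_le measure_ge0 andbT.
    have k0 : (0 < k.+1%:R^-1 :> R)%R by rewrite invr_gt0.
    rewrite -(pmule_rle0 _ (_ : 0 < (k.+1%:R^-1)%:E))//.
    rewrite -(cvg_lim _ mean_rest_cvg0)//.
    apply: lime_ge; first by apply/cvg_ex; exists 0; exact: mean_rest_cvg0.
    apply: nearW => n; rewrite -Er.
    have := le_integral_abse P measurableT ((measurable_EFinP _ _).2 (mr n)) k0.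
    under eq_integral do rewrite /= normr_id.
    apply: le_trans; apply: lee_wpmul2l; first by rewrite lee_fin ltW.
    apply: le_measure; rewrite ?inE//.
    - exact: bigcapT_measurable.
    - rewrite setTI; under eq_set do rewrite /= normr_id; exact: mS.
    - by move=> t /(_ n Logic.I) /= h; split => //=; rewrite normr_id.
  by move=> t /= /forallNP h n _ /=; rewrite lee_fin leNgt; apply/negP/h.
apply: filterS2 (ae_foralln small) ae_open_unit => t tsmall t01.
apply/cvgrPdist_lt => e e0; near \oo => k.
have [n nk] := tsmall k.
have r0 j : (0 < rest (seq_of v t) j)%R by exact: rest_gt0.
have rest_le m : (n <= m)%N -> (rest (seq_of v t) m <= rest (seq_of v t) n)%R.
  elim: m => [|m IH]; first by rewrite leqn0 => /eqP ->.
  rewrite leq_eqVlt => /predU1P[->//|]; rewrite ltnS => /IH; apply: le_trans.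
  rewrite restS ler_piMr ?(ltW (r0 _))//.
  by rewrite lerBlDr lerDl; case/andP: (t01 m) => /ltW.
near=> m; rewrite sub0r normrN.
apply: (@lt_trans _ _ k.+1%:R^-1%R); last first.
  by near: k; exact: near_infty_natSinv_lt (PosNum e0).
apply: le_lt_trans nk; rewrite !gtr0_norm//; apply: rest_le.
by near: m; exists n.
Unshelve. all: by end_near. Qed.

(** Given the other coordinates, the sticks i < j can only be equal for one value
    of the coordinate j, and [beta] has no atom. *)
Lemma ae_stick_inj : {ae P, forall t, injective (stick (seq_of v t))}.
Proof.
have ij i j : (i < j)%N ->
    {ae P, forall t, (forall i, 0 < v i t < 1)%R ->
       stick (seq_of v t) i <> stick (seq_of v t) j}.
  move=> ij.
  pose A : set (seqR R) := [set x | stick x i = stick x j /\ rest x j != 0%R].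
  have mA : measurable A.
    have -> : A = [set x | stick x i == stick x j] `&` [set x | ~~ (rest x j == 0%R)].
      by apply/seteqP; split => x [/eqP ? ?]; split.
    apply: measurableI; rewrite -[X in measurable X]setTI.
      by apply: measurable_fun_eqr => //; exact: measurable_stickj.
    apply: measurable_neg => //.
    by apply: measurable_fun_eqr => //; exact: measurable_rest.
  have mvA := measurable_preimage (measurable_seq_of v) mA.
  exists (seq_of v @^-1` A); split => //.
  - transitivity (\int[P]_t (\1_A (seq_of v t))%:E).
      by rewrite -[LHS]/(P (seq_of v @^-1` A)) -[in LHS](setIT (_ @^-1` A)) -integral_indic.
    rewrite (ge0_integral_upd (g := fun x => (\1_A x)%:E) j v_iid) //; last first.
      by apply/measurable_EFinP; exact: measurable_indic.
    apply: integral0_eq => t _.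
    set a := (stick (seq_of v t) i / rest (seq_of v t) j)%R.
    have mU : measurable_fun setT (update j (seq_of v t) : R -> seqR R).
      apply: measurable_seqP => k; rewrite /update; case: eqP => _.
        exact: measurable_id.
      exact: measurable_cst.
    have mUA := measurable_preimage mU mA.
    transitivity (\int[beta]_s (\1_(update j (seq_of v t) @^-1` A) s)%:E); first by [].
    rewrite integral_indic// setIT.
    apply: (subset_measure0 (B := [set a])) => //.
    have eqlt k s : (k <= j)%N -> rest (update j (seq_of v t) s) k = rest (seq_of v t) k.
      move=> kj; apply: eq_bigr => l _; rewrite /update ltn_eqF//.
      exact: leq_trans kj.
    move=> s /= []; rewrite /stick !eqlt ?(ltnW ij)// /update eqxx ltn_eqF//.
    by move=> sE r0; rewrite /a /stick sE mulfK.
    exact: beta_atomless.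
  - move=> t /= /not_implyP[t01 /contrapT]; split => //.
    by rewrite gt_eqF// rest_gt0.
have inj : {ae P, forall t, forall i j, (i < j)%N ->
    (forall i, 0 < v i t < 1)%R -> stick (seq_of v t) i <> stick (seq_of v t) j}.
  apply: ae_foralln => i; apply: ae_foralln => j.
  have [lij|ji] := ltnP i j; last first.
    by apply: aeW.
  by apply: filterS (ij i j lij) => t h _.
apply: filterS2 inj ae_open_unit => t tinj t01 i j.
case: (ltngtP i j) => // [/tinj|/tinj] /(_ t01) + eij; first by rewrite eij.
by rewrite eij.
Qed.

End iid_sticks.


(** * Exchanging two adjacent sticks *)

Section measurable_inverse.
Context {R : realType}.

Lemma measurable_inv : measurable_fun [set: R] (fun x : R => x^-1).
Proof.
have -> : (fun x : R => x^-1) =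
    (fun x => if 0 <= x then x `^ (-1) else - ((- x) `^ (-1))).
  apply/funext => x; case: leP => x0; first by rewrite powR_inv1.
  by rewrite powR_inv1 ?oppr_ge0 ?ltW// invrN opprK.
apply: measurable_fun_ifT => //; first exact: measurable_fun_ler.
apply: measurable_funN.
have mo : measurable_fun [set: R] (fun x : R => - x) by exact: oppr_measurable.
have h := measurableT_comp (@measurable_powR R (-1)) mo.
exact: h.
Qed.

Lemma measurable_fun_div d (T : measurableType d) (f g : T -> R) :
  measurable_fun setT f -> measurable_fun setT g ->
  measurable_fun setT (fun t => f t / g t).
Proof.
move=> mf mg; apply: measurable_funM => //.
exact: measurableT_comp measurable_inv mg.
Qed.

End measurable_inverse.

Section scaling.
Local Open Scope ereal_scope.
Context {R : realType}.
Local Notation mu := (@lebesgue_measure R).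

(** Uniqueness of the Lebesgue measure: multiplying by c the image of this measure
    under the dilation of ratio c gives back the length of intervals. *)
Lemma ge0_integral_lebesgue_scale (c : R) (g : R -> \bar R) :
  (0 < c)%R -> measurable_fun setT g -> (forall x, 0 <= g x) ->
  c%:E * \int[mu]_x g (c * x)%R = \int[mu]_x g x.
Proof.
move=> c0 mg g0.
have mc : measurable_fun [set: measurableTypeR R]
  ( *%R c : measurableTypeR R -> measurableTypeR R) by exact: mulrl_measurable.
pose cc := NngNum (ltW c0).
have [m mE] : exists m : {measure set (measurableTypeR R) -> \bar R},
    m = mscale cc (pushforward mu ( *%R c : measurableTypeR R -> measurableTypeR R))
    :> (set (measurableTypeR R) -> \bar R).
  by exists (mscale cc (measure_function_pushforward__canonical__measure_function_Measure mu mc)).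
have muE A : measurable A -> mu A = m A.
  move=> mA; apply: lebesgue_measure_unique => // _ [[a b] _ <-].
  rewrite mE /mscale /= /pushforward.
  have -> : *%R c @^-1` `]a, b] = `](a / c)%R, (b / c)%R]%classic.
    apply/seteqP; split => x; rewrite /= !in_itv/= ltr_pdivrMr// ler_pdivlMr//;
    by rewrite mulrC.
  rewrite !lebesgue_measure_itv/= !lte_fin ltr_pM2r ?invr_gt0//.
  case: ifP => _; last by rewrite mule0.
  rewrite -!EFinB -EFinM; congr (_%:E).
  by field; rewrite gt_eqF.
transitivity (\int[m]_x g x); last first.
  by apply: eq_measure_integral => A mA _; apply/esym; exact: muE.
by rewrite mE ge0_integral_mscale// ge0_integral_pushforward.
Qed.

Lemma ge0_integral_lebesgue_density (m : {measure set R -> \bar R}) (f : R -> R)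
    (h : R -> \bar R) :
  measurable_fun setT f -> (forall x, 0 <= f x)%R ->
  (forall A, measurable A -> m A = \int[mu]_(x in A) (f x)%:E) ->
  measurable_fun setT h -> (forall x, 0 <= h x) ->
  \int[m]_x h x = \int[mu]_x (h x * (f x)%:E).
Proof.
move=> mf f0 mE mh h0.
(* [m] and [mu] carry two presentations of the Borel sigma-algebra; the identity
   transports [m] to the second one *)
have mi : measurable_fun [set: R] (idfun : R -> measurableTypeR R).
  by move=> _ A mA; rewrite setTI.
have := ge0_integral_density
  (m := measure_function_pushforward__canonical__measure_function_Measure m mi)
  (mu := mu) mf f0 mE mh h0.
move=> <-; apply/esym.
exact: (ge0_integral_pushforward mi m measurableT mh (fun x _ => h0 x)).
Qed.

Lemma density_open_unit_mass (m : probability R R) (f : R -> R) :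
  (forall s, ~~ (0 < s < 1)%R -> f s = 0%R) ->
  (forall A, measurable A -> m A = \int[mu]_(x in A) (f x)%:E) ->
  m `]0%R, 1%R[%classic = 1.
Proof.
move=> f0 mE.
have mC : measurable (~` `]0%R, 1%R[%classic : set R) by exact: measurableC.
have : m (~` `]0%R, 1%R[%classic) = 0.
  rewrite mE// integral0_eq// => s /=; rewrite in_itv/= => /negP/f0 ->.
  by [].
by rewrite probability_setC// => /eqP; rewrite sube_eq// ?adde_def// add0e => /eqP <-.
Qed.

Lemma density_atomless (m : probability R R) (f : R -> R) s :
  (forall A, measurable A -> m A = \int[mu]_(x in A) (f x)%:E) ->
  m [set s] = 0.
Proof. by move=> mE; rewrite mE// integral_set1. Qed.

End scaling.

Section beta_swap.
Local Open Scope ereal_scope.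
Context {R : realType}.
Variables (beta : probability R R) (theta Z : R).
Hypothesis Z0 : (0 <= Z)%R.
Local Notation mu := (@lebesgue_measure R).

(** The density of Be(1, theta).  The constant [Z] is kept abstract: its value
    1 / theta is only recovered once it is known that the total mass is 1. *)
Definition be1_density (s : R) : R :=
  if (0 < s < 1)%R then ((1 - s) `^ (theta - 1) / Z)%R else 0%R.

Hypothesis betaE : forall A, measurable A ->
  beta A = \int[mu]_(s in A) (be1_density s)%:E.

Let mpow : measurable_fun [set: R] (fun s : R => (1 - s) `^ (theta - 1) / Z)%R.
Proof.
apply: measurable_funM => //.
have m1 : measurable_fun [set: R] (fun s : R => 1 - s)%R.
  exact: measurable_funB.
exact: (measurableT_comp (@measurable_powR R (theta - 1)) m1).
Qed.

Lemma measurable_be1_density : measurable_fun [set: R] be1_density.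
Proof.
apply: measurable_fun_ifT => //.
by apply: measurable_and; exact: measurable_fun_ltr.
Qed.

Lemma be1_density_ge0 s : (0 <= be1_density s)%R.
Proof. by rewrite /be1_density; case: ifP => // _; rewrite divr_ge0// powR_ge0. Qed.

(* The joint density of the first two sticks times 1 - a, where a is the length
   of the first one: the change of variables y = (1 - a) b in [joint] brings
   the factor 1 / (1 - a) that this weight cancels. *)
Let q (z : R * R) : R :=
  if (0 < z.1)%R && (0 < z.2)%R && (z.1 + z.2 < 1)%R then
    ((1 - (z.1 + z.2)) `^ (theta - 1) / Z / Z)%R else 0%R.

Let mq : measurable_fun setT q.
Proof.
have m1 := @measurable_fst _ _ R R; have m2 := @measurable_snd _ _ R R.
have mD : measurable_fun setT (fun z : R * R => z.1 + z.2)%R.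
  exact: measurable_funD.
apply: measurable_fun_ifT => //.
  apply: measurable_and; last exact: measurable_fun_ltr.
  by apply: measurable_and; exact: measurable_fun_ltr.
apply: measurable_funM => //.
exact: (measurableT_comp mpow mD).
Qed.

Let q_ge0 z : (0 <= q z)%R.
Proof. by rewrite /q; case: ifP => // _; rewrite !divr_ge0// powR_ge0. Qed.

Let qC a y : q (a, y) = q (y, a).
Proof. by rewrite /q/= [(0 < a)%R && _]andbC [(y + a)%R]addrC. Qed.

Let q_dens a y : (0 < a < 1)%R -> (be1_density a * be1_density (y / (1 - a)))%R = q (a, y).
Proof.
move=> /andP[a0 a1]; rewrite /q/= /be1_density a0 a1/=.
have c0 : (0 < 1 - a)%R by rewrite subr_gt0.
rewrite ltr_pdivlMr// mul0r ltr_pdivrMr// mul1r ltrBrDl.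
case: ifPn => [/andP[y0 ay]|_]; last by rewrite mulr0.
rewrite mulrACA -invfM -powRM ?(ltW c0)//; last first.
  by rewrite subr_ge0 ler_pdivrMr// mul1r lerBrDl ltW.
have -> : ((1 - a) * (1 - y / (1 - a)) = 1 - (a + y))%R.
  by field; rewrite gt_eqF.
by rewrite invfM mulrA.
Qed.

Let joint (H : R * R -> \bar R) : measurable_fun setT H -> (forall z, 0 <= H z) ->
  \int[beta]_a \int[beta]_b ((`|1 - a|%R)%:E * H (a, ((1 - a) * b)%R)) =
  \int[mu]_a \int[mu]_y (H (a, y) * (q (a, y))%:E).
Proof.
move=> mH H0.
have mHa a : measurable_fun setT (fun y => H (a, y)).
  exact: (measurableT_comp mH (pair1_measurable a)).
have ml : measurable_fun setT (fun z : R * R => (z.1, ((1 - z.1) * z.2)%R)).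
  apply: measurable_fun_pair => //; apply: measurable_funM => //.
  exact: measurable_funB.
have mF : measurable_fun setT
    (fun z : R * R => (`|1 - z.1|%R)%:E * H (z.1, ((1 - z.1) * z.2)%R)).
  apply: emeasurable_funM; last exact: (measurableT_comp mH ml).
  by apply/measurable_EFinP; apply: measurableT_comp => //; exact: measurable_funB.
have F0 (z : R * R) : 0 <= (`|1 - z.1|%R)%:E * H (z.1, ((1 - z.1) * z.2)%R).
  by rewrite mule_ge0.
rewrite (ge0_integral_lebesgue_density measurable_be1_density be1_density_ge0 betaE); last 2 first.
- have mF0 := @measurable_fun_fubini_tonelli_F _ _ _ _ _ beta _ mF F0.
  exact: mF0.
- by move=> a; apply: integral_ge0 => b _; rewrite mule_ge0.
apply: eq_integral => a _.
have [a01|a01] := boolP (0 < a < 1)%R; last first.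
  rewrite {1}/be1_density (negbTE a01) mule0; apply/esym/integral0_eq => y _.
  rewrite /q/=; case: ifPn => [/andP[/andP[a0 y0] ay]|]; last by rewrite mule0.
  move: a01; rewrite a0/= -leNgt => a1.
  have := lt_le_trans ay a1; rewrite gtrDl => y1.
  by have := lt_trans y0 y1; rewrite ltxx.
have c0 : (0 < 1 - a)%R by case/andP: a01 => _ ?; rewrite subr_gt0.
rewrite (ge0_integral_lebesgue_density measurable_be1_density be1_density_ge0 betaE); last 2 first.
- exact: (measurable_fun_pair2 a mF).
- by move=> b; rewrite mule_ge0.
pose g y := H (a, y) * (be1_density (y / (1 - a)))%:E.
have mdiv : measurable_fun setT (fun y : R => y / (1 - a))%R.
  exact: mulrr_measurable.
have md : measurable_fun setT (fun y : R => (be1_density (y / (1 - a)))%:E).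
  by apply/measurable_EFinP; exact: (measurableT_comp measurable_be1_density mdiv).
have mg : measurable_fun setT g by exact: emeasurable_funM.
have g0 y : 0 <= g y by rewrite mule_ge0 ?lee_fin ?be1_density_ge0.
transitivity ((be1_density a)%:E * \int[mu]_y g y).
  rewrite muleC -(ge0_integral_lebesgue_scale c0 mg g0); congr (_ * _).
  rewrite -ge0_integralZl//; last 2 first.
  - by apply: (measurableT_comp mg); exact: mulrl_measurable.
  - by rewrite lee_fin ltW.
  apply: eq_integral => b _; rewrite /g muleA gtr0_norm//.
  by rewrite mulrAC mulfV ?mul1r ?gt_eqF.
rewrite -ge0_integralZl ?lee_fin ?be1_density_ge0//.
apply: eq_integral => y _; rewrite /g muleCA -EFinM q_dens//.
Qed.

(** Both sides are integrals of [H] against the density [q], up to the order of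
    the two integrations, and [q] is symmetric. *)
Lemma beta_swap (H : R * R -> \bar R) :
  measurable_fun setT H -> (forall z, 0 <= H z) ->
  \int[beta]_a \int[beta]_b ((`|1 - a|%R)%:E * H (((1 - a) * b)%R, a)) =
  \int[beta]_a \int[beta]_b ((`|1 - a|%R)%:E * H (a, ((1 - a) * b)%R)).
Proof.
move=> mH H0; rewrite joint//.
have mH' : measurable_fun setT (fun z => H (z.2, z.1)).
  exact: (measurableT_comp mH (@measurable_swap _ _ R R)).
pose K z := H (z.2, z.1) * (q z)%:E.
have mK : measurable_fun setT K.
  by apply: emeasurable_funM => //; exact/measurable_EFinP.
have K0 z : 0 <= K z by rewrite mule_ge0 ?lee_fin.
rewrite (joint mH')//; have := @fubini_tonelli _ _ _ _ _ mu mu K mK K0.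
rewrite /K /= => ->.
by apply: eq_integral => y _; apply: eq_integral => a _; rewrite qC.
Qed.

End beta_swap.

Section adjacent_swap.
Local Open Scope ereal_scope.
Context {R : realType} d (T : measurableType d) (P : probability T R).
Variables (v : nat -> {RV P >-> R}) (beta : probability R R) (theta Z : R).
Hypothesis v_iid : iid v beta.
Hypothesis Z0 : (0 <= Z)%R.
Hypothesis betaE : forall A, measurable A ->
  beta A = \int[@lebesgue_measure R]_(s in A) (be1_density theta Z s)%:E.

Definition swap_at (m i : nat) : nat :=
  if i == m then m.+1 else if i == m.+1 then m else i.

(** The sticks whose members m and m + 1 have lengths [z.1] and [z.2] relatively
    to the mass left before them, the other sticks being cut according to [x].
    The remaining members see [z] only through z.1 + z.2, which is why exchanging
    the components of [z] exchanges two sticks and moves nothing else. *)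
Definition two_sticks (m : nat) (x : nat -> R) (z : R * R) : nat -> R := fun j =>
  if (j < m)%N then stick x j
  else if j == m then (rest x m * z.1)%R
  else if j == m.+1 then (rest x m * z.2)%R
  else (x j * (rest x m * (1 - z.1 - z.2) * \prod_(m.+2 <= i < j) (1 - x i)))%R.

Lemma two_sticks_swap m x a y :
  two_sticks m x (y, a) = two_sticks m x (a, y) \o swap_at m.
Proof.
apply/funext => j; rewrite /two_sticks/= /swap_at.
have [->|jm] := eqVneq j m; first by rewrite ltnn ltnNge leqnSn/= eqxx gtn_eqF.
have [->|jm1] := eqVneq j m.+1; first by rewrite ltnNge leqnSn/= ltnn eqxx.
rewrite (negbTE jm) (negbTE jm1); case: ifP => // _.
by congr (_ * (_ * _ * _))%R; rewrite addrAC.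
Qed.

Lemma rest_upd_ge n (x : nat -> R) s k : (k <= n)%N -> rest (update n x s) k = rest x k.
Proof.
move=> kn; apply: eq_bigr => i _; rewrite /update ltn_eqF//.
exact: leq_trans kn.
Qed.

Lemma rest_upd2 m (x : nat -> R) a b :
  rest (update m.+1 (update m x a) b) m.+1 = (rest x m * (1 - a))%R.
Proof.
by rewrite restS rest_upd_ge// rest_upd_ge// /update ltn_eqF// eqxx.
Qed.

Lemma stick_upd2 m (x : nat -> R) a b :
  stick (update m.+1 (update m x a) b) = two_sticks m x (a, ((1 - a) * b)%R).
Proof.
have r1 k : (k <= m)%N -> rest (update m.+1 (update m x a) b) k = rest x k.
  by move=> km; rewrite !rest_upd_ge// (leq_trans km).
have rm1 := rest_upd2 m x a b.
have rm2 : rest (update m.+1 (update m x a) b) m.+2 = (rest x m * (1 - a) * (1 - b))%R.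
  by rewrite restS rm1 /update eqxx.
apply/funext => j; rewrite /two_sticks/= {1}/stick.
have [jm|mj] := ltnP j m.
  by rewrite r1 ?(ltnW jm)// /update !ltn_eqF// (ltn_trans jm).
have [->|jm] := eqVneq j m.
  by rewrite r1// /update ltn_eqF// eqxx mulrC.
have [->|jm1] := eqVneq j m.+1; first by rewrite rm1 /update eqxx; ring.
have mj2 : (m.+2 <= j)%N by move: mj jm jm1; lia.
rewrite {1}/update (negbTE jm1) {1}/update (negbTE jm); congr (_ * _)%R.
rewrite /rest -(big_mkord predT (fun i => 1 - update m.+1 (update m x a) b i))%R.
rewrite (big_cat_nat (n := m.+2))//= [X in (X * _)%R = _]big_mkord.
rewrite -[X in (X * _)%R]/(rest _ m.+2) rm2.
rewrite (_ : 1 - a - (1 - a) * b = (1 - a) * (1 - b))%R; last by ring.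
rewrite -!mulrA; congr (_ * (_ * (_ * _)))%R.
apply: eq_big_nat => i /andP[mi _].
by rewrite /update !gtn_eqF// ltnW.
Qed.

Lemma measurable_two_sticks m x :
  measurable_fun setT (two_sticks m x : R * R -> seqR R).
Proof.
apply: measurable_seqP => j; rewrite /two_sticks.
case: (j < m)%N; first exact: measurable_cst.
case: (j == m); first by apply: measurable_funM.
case: (j == m.+1); first by apply: measurable_funM.
apply: measurable_funM => //; apply: measurable_funM => //.
apply: measurable_funM => //; apply: measurable_funB => //.
exact: measurable_funB.
Qed.

(** Refreshing the coordinates m and m + 1 reduces this to [beta_swap]. *)
Lemma adjacent_swap m (K : seqR R -> \bar R) :
  measurable_fun setT K -> (forall x, 0 <= K x) ->
  \int[P]_t ((`|rest (seq_of v t) m.+1|%R)%:E * K (stick (seq_of v t))) =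
  \int[P]_t ((`|rest (seq_of v t) m.+1|%R)%:E *
             K (stick (seq_of v t) \o swap_at m)).
Proof.
have E (L : seqR R -> \bar R) : measurable_fun setT L -> (forall x, 0 <= L x) ->
    \int[P]_t ((`|rest (seq_of v t) m.+1|%R)%:E * L (stick (seq_of v t))) =
    \int[P]_t \int[beta]_a \int[beta]_b ((`|1 - a|%R)%:E *
      ((`|rest (seq_of v t) m|%R)%:E *
       L (two_sticks m (seq_of v t) (a, ((1 - a) * b)%R)))).
  move=> mL L0.
  pose g (x : seqR R) := (`|rest x m.+1|%R)%:E * L (stick x).
  have mg : measurable_fun setT g.
    apply: emeasurable_funM; last exact: (measurableT_comp mL measurable_stick).
    apply/measurable_EFinP; apply: measurableT_comp => //.
    exact: measurable_rest.
  have g0 x : 0 <= g x by rewrite mule_ge0.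
  have mgu := measurableT_comp mg (@measurable_upd R m.+1).
  pose g2 (x : seqR R) := \int[beta]_b g (update m.+1 x b).
  have mg2 : measurable_fun setT g2 :=
    @measurable_fun_fubini_tonelli_F _ _ _ _ _ beta _ mgu (fun z => g0 _).
  have g20 x : 0 <= g2 x by apply: integral_ge0.
  have h1 := ge0_integral_upd m.+1 v_iid mg g0.
  have h2 := ge0_integral_upd m v_iid mg2 g20.
  apply: (eq_trans h1); apply: (eq_trans h2).
  apply: eq_integral => t _; apply: eq_integral => a _; apply: eq_integral => b _.
  by rewrite /g stick_upd2 rest_upd2 normrM mulrC EFinM muleA.
move=> mK K0.
have msw : measurable_fun setT (fun x : seqR R => (x \o swap_at m) : seqR R).
  by apply: measurable_seqP => i; exact: measurable_coord.
have mKs : measurable_fun setT (fun x : seqR R => K (x \o swap_at m)).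
  exact: (measurableT_comp mK msw).
apply: (eq_trans (E K mK K0)); apply/esym.
apply: (eq_trans (E _ mKs (fun x => K0 _))).
apply: eq_integral => t _.
pose H z := (`|rest (seq_of v t) m|%R)%:E * K (two_sticks m (seq_of v t) z).
have mH : measurable_fun setT H.
  apply: emeasurable_funM => //.
  exact: (measurableT_comp mK (measurable_two_sticks m (seq_of v t))).
have H0 z : 0 <= H z by rewrite mule_ge0.
apply: eq_trans (beta_swap Z0 betaE mH H0).
apply: eq_integral => a _; apply: eq_integral => b _.
by rewrite /H -two_sticks_swap.
Qed.

End adjacent_swap.


(** * Size-biased picks *)

Section insertion.
Context {R : realType}.

(** For n <= l, composing a sequence with this map moves its term l to the place n
    and shifts by one place those in between. *)
Definition insert_at (n l i : nat) : nat :=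
  if (i < n)%N then i
  else if i == n then l else if (i <= l)%N then i.-1 else i.

Lemma insert_at_id n : insert_at n n = id.
Proof.
apply/funext => i; rewrite /insert_at.
by have [//|ni|->] := ltngtP i n; rewrite ?leqNgt ?ni// gtn_eqF.
Qed.

Lemma insert_at_lt n l i : (i < n)%N -> insert_at n l i = i.
Proof. by rewrite /insert_at => ->. Qed.

Lemma insert_at_eq n l : insert_at n l n = l.
Proof. by rewrite /insert_at ltnn eqxx. Qed.

(** Moving the next term to place n amounts to exchanging it with its predecessor,
    then moving the term that has come to place m. *)
Lemma insert_at_swap n m : (n <= m)%N ->
  insert_at n m.+1 = swap_at m \o insert_at n m.
Proof.
move=> nm; apply/funext => i; rewrite /insert_at/= /swap_at.
have [ilt|] := ltnP i n; first by rewrite !ltn_eqF//; lia.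
move=> ni; have [iE|inn] := eqVneq i n; first by rewrite eqxx.
have [im|mi] := leqP i m.
  rewrite (leq_trans im)// !ltn_eqF//; lia.
have [im|] := leqP i m.+1.
  have -> : i = m.+1 by lia.
  by rewrite (gtn_eqF (ltnSn m)) eqxx.
by move=> mi1; rewrite !gtn_eqF//; lia.
Qed.

Lemma insert_at_inj n l : (n <= l)%N -> injective (insert_at n l).
Proof. by move=> nl i j; rewrite /insert_at; do !case: ifP; lia. Qed.

Lemma insert_at_surj n l j : (n <= l)%N -> exists i, insert_at n l i = j.
Proof.
move=> nl; have [jn|nj] := ltnP j n; first by exists j; rewrite insert_at_lt.
have [jl|lj] := ltnP j l.
  exists j.+1; rewrite /insert_at; do !case: ifP; lia.
have [->|jl] := eqVneq j l; first by exists n; rewrite insert_at_eq.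
by exists j; rewrite /insert_at; do !case: ifP; lia.
Qed.

Lemma measurable_reindex (s : nat -> nat) :
  measurable_fun setT (fun x : seqR R => (x \o s) : seqR R).
Proof. by apply: measurable_seqP => i; exact: measurable_coord. Qed.

Lemma measurable_psum n :
  measurable_fun setT (fun z : seqR R => \sum_(i < n) z i).
Proof. by apply: measurable_sum => i; exact: measurable_coord. Qed.

End insertion.

Section size_biased_pick.
Local Open Scope ereal_scope.
Context {R : realType}.

(** Sequences on which the pick probabilities are meaningful; the total mass may
    be less than 1, as it is for a reordering that omits some terms. *)
Definition subweights : set (seqR R) :=
  [set z : seqR R | (forall j, 0 <= z j)%R /\ (forall N, \sum_(i < N) z i <= 1)%R].

Lemma measurable_subweights : measurable subweights.
Proof.
have -> : subweights = (\bigcap_j [set z : seqR R | (0 <= z j)%R]) `&`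
    (\bigcap_N [set z : seqR R | (\sum_(i < N) z i <= 1)%R]).
  apply/seteqP; split => z [z0 z1]; split => i.
  - by move=> _; exact: z0.
  - by move=> _; exact: z1.
  - exact: (z0 i Logic.I).
  - exact: (z1 i Logic.I).
apply: measurableI; apply: bigcapT_measurable => j;
  rewrite -[X in measurable X]setTI; apply: measurable_fun_ler => //.
- exact: measurable_coord.
- exact: measurable_psum.
Qed.

(** The conditional probability that the term [l] is picked at place [n] when the
    first [n] terms of [z] are the previous picks. *)
Definition pick_weight (n l : nat) (z : nat -> R) : R :=
  (z l / (1 - \sum_(i < n) z i) * \1_(~` [set z i | i in `I_n]) (z l))%R.

Lemma measurable_notin d (T : measurableType d) (a : T -> R) (b : nat -> T -> R) n :
  measurable_fun setT a -> (forall i, (i < n)%N -> measurable_fun setT (b i)) ->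
  measurable_fun setT (fun t => \1_(~` [set b i t | i in `I_n]) (a t) : R).
Proof.
move=> ma mb.
have -> : (fun t => \1_(~` [set b i t | i in `I_n]) (a t) : R) =
    \1_(~` (\bigcup_(i in `I_n) [set t | b i t == a t])).
  apply/funext => t; rewrite !indicE; congr (_%:R); congr nat_of_bool.
  apply/idP/idP => /set_mem h; apply/mem_set; apply: contra_not h.
    by move=> [i ni /eqP e]; exists i.
  by move=> [i ni e]; exists i => //=; apply/eqP.
apply: measurable_indic; apply: measurableC; apply: fin_bigcup_measurable => // i ni.
rewrite -[X in measurable X]setTI; apply: measurable_fun_eqr => //.
exact: mb.
Qed.

Lemma measurable_pick_weight n l :
  measurable_fun setT (pick_weight n l : seqR R -> R).
Proof.
apply: measurable_funM; last first.
  by apply: measurable_notin => [|i _]; exact: measurable_coord.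
apply: measurable_fun_div; first exact: measurable_coord.
by apply: measurable_funB => //; exact: measurable_psum.
Qed.

Lemma pick_weight_ge0 n l z : subweights z -> (0 <= pick_weight n l z)%R.
Proof. by move=> [z0 z1]; rewrite mulr_ge0// divr_ge0// subr_ge0. Qed.

(** Cut off outside of [subweights], so that it is nonnegative everywhere and the
    series in [pick] is defined for every sequence. *)
Definition safe_weight (n l : nat) (z : seqR R) : R :=
  (\1_subweights z * pick_weight n l z)%R.

Lemma measurable_safe_weight n l : measurable_fun setT (safe_weight n l).
Proof.
apply: measurable_funM; last exact: measurable_pick_weight.
exact: measurable_indic measurable_subweights.
Qed.

Lemma safe_weight_ge0 n l z : (0 <= safe_weight n l z)%R.
Proof.
rewrite /safe_weight indicE; case: (boolP (z \in subweights)) => [/set_mem h|_].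
  by rewrite mul1r pick_weight_ge0.
by rewrite mul0r.
Qed.

Lemma safe_weightE n l z : subweights z -> safe_weight n l z = pick_weight n l z.
Proof. by move=> h; rewrite /safe_weight indicE mem_set// mul1r. Qed.

(** The expectation of [F] after one pick: the first [n] terms of [z] stay, and
    the term put at place [n] is drawn from the following ones by size. *)
Definition pick (n : nat) (F : seqR R -> \bar R) (z : seqR R) : \bar R :=
  \sum_(k <oo) ((safe_weight n (n + k) z)%:E * F (z \o insert_at n (n + k))).

Implicit Type F : seqR R -> \bar R.

Lemma pick_ge0 n F z : (forall x, 0 <= F x) -> 0 <= pick n F z.
Proof.
by move=> F0; apply: nneseries_ge0 => k _ _; rewrite mule_ge0// lee_fin safe_weight_ge0.
Qed.

Lemma measurable_pick_term n l F : measurable_fun setT F ->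
  measurable_fun setT (fun z : seqR R =>
    (safe_weight n l z)%:E * F (z \o insert_at n l)).
Proof.
move=> mF; apply: emeasurable_funM.
  by apply/measurable_EFinP; exact: measurable_safe_weight.
exact: (measurableT_comp mF (measurable_reindex _)).
Qed.

Lemma measurable_pick n F : measurable_fun setT F -> (forall x, 0 <= F x) ->
  measurable_fun setT (pick n F).
Proof.
move=> mF F0; apply: ge0_emeasurable_sum => [k z _ _|k _].
  by rewrite mule_ge0// lee_fin safe_weight_ge0.
exact: measurable_pick_term.
Qed.

(** The pick probabilities add up to at most 1, for the terms from n on have at
    most the mass left by the first n terms. *)
Lemma pick_le1 n F z : (forall x, 0 <= F x <= 1) -> pick n F z <= 1.
Proof.
move=> F01; apply: lime_le.
  apply: is_cvg_nneseries => k _ _; rewrite mule_ge0 ?lee_fin ?safe_weight_ge0//.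
  by case/andP: (F01 (z \o insert_at n (n + k))).
apply: nearW => N.
apply: (@le_trans _ _ (\sum_(0 <= k < N) (safe_weight n (n + k) z)%:E)).
  apply: lee_sum => k _; rewrite -[leRHS]mule1 lee_wpmul2l//.
    by rewrite lee_fin safe_weight_ge0.
  by case/andP: (F01 (z \o insert_at n (n + k))).
rewrite sumEFin lee_fin; have [zs|zs] := boolP (z \in subweights); last first.
  by rewrite big1// => k _; rewrite /safe_weight indicE (negbTE zs) mul0r.
have {}zs := set_mem zs; have [z0 z1] := zs.
apply: (@le_trans _ _ (\sum_(0 <= k < N) z (n + k)%N / (1 - \sum_(i < n) z i))%R).
  apply: ler_sum => k _; rewrite safe_weightE// /pick_weight ler_piMr//.
    by rewrite divr_ge0// subr_ge0.
rewrite -mulr_suml; set r := (1 - _)%R.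
have r0 : (0 <= r)%R by rewrite subr_ge0.
have [->|rn0] := eqVneq r 0%R; first by rewrite invr0 mulr0.
rewrite ler_pdivrMr ?lt_def ?rn0// mul1r /r lerBrDl.
have := z1 (n + N)%N; rewrite big_split_ord/= big_mkord.
by [].
Qed.

End size_biased_pick.

Section pick_invariance.
Local Open Scope ereal_scope.
Context {R : realType} d (T : measurableType d) (P : probability T R).
Variables (v : nat -> {RV P >-> R}) (beta : probability R R) (theta Z : R).
Hypothesis v_iid : iid v beta.
Hypothesis beta01 : beta `]0%R, 1%R[%classic = 1.
Hypothesis beta_atomless : forall s, beta [set s] = 0.
Hypothesis Z0 : (0 <= Z)%R.
Hypothesis betaE : forall A, measurable A ->
  beta A = \int[@lebesgue_measure R]_(s in A) (be1_density theta Z s)%:E.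

Local Notation X := (seq_of v).
Local Notation W t := (stick (seq_of v t)).

Lemma psum_stick_le1 (x : nat -> R) N : (forall i, 0 < x i < 1)%R ->
  (\sum_(i < N) stick x i <= 1)%R.
Proof.
by move=> x01; rewrite -subr_ge0 rest_stick ltW// rest_gt0.
Qed.

Lemma stick_subweights (x : nat -> R) : (forall i, 0 < x i < 1)%R ->
  subweights (stick x).
Proof.
by move=> x01; split=> [j|N]; [rewrite ltW// stick_gt0|exact: psum_stick_le1].
Qed.

Lemma measurable_sticks : measurable_fun setT (fun t => W t : seqR R).
Proof. exact: (measurableT_comp measurable_stick (measurable_seq_of v)). Qed.

Variables (n : nat) (F : seqR R -> \bar R).
Hypothesis mF : measurable_fun setT F.
Hypothesis F01 : forall x, 0 <= F x <= 1.

Let F0 x : 0 <= F x. Proof. by case/andP: (F01 x). Qed.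
Let F1 x : F x <= 1. Proof. by case/andP: (F01 x). Qed.

(* The probability that stick n + k is picked, and the part of the mass left after
   n sticks which is still left after n + k sticks.  Absolute values make them
   nonnegative without assumption. *)
Let aw (k : nat) (z : nat -> R) : R :=
  (`|z (n + k)%N| / `|1 - \sum_(i < n) z i|)%R.
Let bw (k : nat) (z : nat -> R) : R :=
  (`|1 - \sum_(i < n + k) z i| / `|1 - \sum_(i < n) z i|)%R.

Let mden : measurable_fun setT (fun z : seqR R => `|1 - \sum_(i < n) z i|%R).
Proof.
by apply: measurableT_comp => //; apply: measurable_funB => //; exact: measurable_psum.
Qed.

Let maw k : measurable_fun setT (aw k : seqR R -> R).
Proof.
apply: measurable_fun_div => //.
by apply: measurableT_comp => //; exact: measurable_coord.
Qed.

Let mbw k : measurable_fun setT (bw k : seqR R -> R).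
Proof.
apply: measurable_fun_div => //.
by apply: measurableT_comp => //; apply: measurable_funB => //; exact: measurable_psum.
Qed.

Let aw0 k z : (0 <= aw k z)%R. Proof. by rewrite divr_ge0. Qed.
Let bw0 k z : (0 <= bw k z)%R. Proof. by rewrite divr_ge0. Qed.

Let FW k t := F (W t \o insert_at n (n + k)).

Let mFW k : measurable_fun setT (FW k).
Proof. exact: (measurableT_comp (measurableT_comp mF (measurable_reindex _)) measurable_sticks). Qed.

Let mawW k : measurable_fun setT (fun t => (aw k (W t))%:E).
Proof. by apply/measurable_EFinP; exact: (measurableT_comp (maw k) measurable_sticks). Qed.

Let mbwW k : measurable_fun setT (fun t => (bw k (W t))%:E).
Proof. by apply/measurable_EFinP; exact: (measurableT_comp (mbw k) measurable_sticks). Qed.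

Let I k := \int[P]_t ((aw k (W t))%:E * FW k t).
Let J k := \int[P]_t ((bw k (W t))%:E * FW k t).

Let I0 k : 0 <= I k.
Proof. by apply: integral_ge0 => t _; rewrite mule_ge0 ?F0 ?lee_fin. Qed.

Let J0 k : 0 <= J k.
Proof. by apply: integral_ge0 => t _; rewrite mule_ge0 ?F0 ?lee_fin. Qed.

(* The weight of [bw k.+1] is the mass left after the sticks n, ..., n + k, so that
   [adjacent_swap] exchanges the sticks n + k and n + k + 1. *)
Let Jshift k : \int[P]_t ((bw k.+1 (W t))%:E * FW k t) = J k.+1.
Proof.
pose K (z : seqR R) := (`|1 - \sum_(i < n) z i|^-1)%:E * F (z \o insert_at n (n + k)).
have mK : measurable_fun setT K.
  apply: emeasurable_funM; last exact: (measurableT_comp mF (measurable_reindex _)).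
  by apply/measurable_EFinP; exact: (measurableT_comp measurable_inv mden).
have K0 z : 0 <= K z by rewrite mule_ge0 ?F0 ?lee_fin ?invr_ge0.
have := adjacent_swap v_iid Z0 betaE (n + k) mK K0.
under eq_integral => t _.
  rewrite /K muleA -EFinM -rest_stick -addnS.
  rewrite -[(_ * _)%R]/(bw k.+1 (W t)) -/(FW k t); over.
move=> ->; apply: eq_integral => t _.
rewrite /K muleA -EFinM -rest_stick -addnS /FW addnS insert_at_swap ?leq_addr//.
congr (_ %:E * _); rewrite /bw addnS; congr (_ / `|1 - _|)%R.
apply: eq_bigr => i _; congr (stick _ _); rewrite /swap_at.
by have := ltn_ord i => ?; rewrite !ltn_eqF//; lia.
Qed.

Let Jstep k : J k = I k + J k.+1.
Proof.
rewrite -Jshift -ge0_integralD//; last 4 first.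
- by move=> t _; rewrite mule_ge0 ?F0 ?lee_fin.
- exact: emeasurable_funM.
- by move=> t _; rewrite mule_ge0 ?F0 ?lee_fin.
- exact: emeasurable_funM.
apply: ge0_ae_eq_integral => //.
- exact: emeasurable_funM.
- by apply: emeasurable_funD; exact: emeasurable_funM.
- by move=> t _; rewrite mule_ge0 ?F0 ?lee_fin.
- by move=> t _; rewrite adde_ge0// mule_ge0 ?F0 ?lee_fin.
apply: filterS (ae_open_unit v_iid beta01) => t t01 _.
rewrite -ge0_muleDl ?lee_fin// -EFinD; congr (_%:E * _).
rewrite /aw /bw -mulrDl addnS big_ord_recr/= opprD addrA rest_stick.
have r1 : (stick (X t) (n + k) <= rest (X t) (n + k))%R.
  rewrite -subr_ge0 -rest_stick -addrA -opprD.
  have := rest_gt0 (n + k).+1 t01; rewrite -rest_stick big_ord_recr/=.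
  exact: ltW.
congr (_ / _)%R; rewrite !ger0_norm ?subr_ge0//; last 2 first.
- by rewrite ltW// stick_gt0.
- by rewrite ltW// rest_gt0.
by rewrite [RHS]addrC subrK.
Qed.

Let Jinit : J 0 = \int[P]_t F (W t).
Proof.
apply: ge0_ae_eq_integral => //.
- exact: emeasurable_funM.
- exact: (measurableT_comp mF measurable_sticks).
- by move=> t _; rewrite mule_ge0 ?F0 ?lee_fin.
apply: filterS (ae_open_unit v_iid beta01) => t t01 _.
rewrite /bw /FW addn0 insert_at_id rest_stick divff ?mul1e//.
by rewrite normr_eq0 gt_eqF// rest_gt0.
Qed.

(* The part [bw] of the mass is a product of k independent factors of mean c < 1. *)
Let Jle k : J k <= ((mean_rest beta) ^+ k)%:E.
Proof.
rewrite -(integral_tail_prod v_iid beta01 n).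
apply: ae_ge0_le_integral => //.
- by move=> t _; rewrite mule_ge0 ?F0 ?lee_fin.
- exact: emeasurable_funM.
- by move=> t _; rewrite lee_fin prodr_ge0.
- apply/measurable_EFinP; apply: measurable_prod => i _.
  by apply: measurableT_comp => //; exact: measurable_funB.
apply: filterS (ae_open_unit v_iid beta01) => t t01 _.
rewrite -[leRHS]mule1; apply: lee_pmul; rewrite ?lee_fin ?F0 ?F1//.
rewrite /bw !rest_stick {1}/rest big_split_ord/= -/(rest (X t) n) normrM.
have r0 : `|rest (X t) n|%R != 0%R by rewrite normr_eq0 gt_eqF// rest_gt0.
by rewrite mulrAC divff// mul1r normr_prod.
Qed.

Let series_I : \sum_(k <oo) I k = \int[P]_t F (W t).
Proof.
have psum N : \sum_(0 <= k < N) I k + J N = \int[P]_t F (W t).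
  elim: N => [|N IH]; first by rewrite big_geq// add0e Jinit.
  by rewrite big_nat_recr//= -addeA -Jstep.
apply/eqP; rewrite eq_le; apply/andP; split.
  apply: lime_le; first by apply: is_cvg_nneseries => k _ _; exact: I0.
  by apply: nearW => N; rewrite -(psum N) leeDl.
apply/lee_addgt0Pr => e e0.
have [N _ Ne] : \forall k \near \oo, (mean_rest beta ^+ k < e)%R.
  have [/andP[c0 c1] _] := mean_rest_itv beta01.
  have := @cvg_expr _ (mean_rest beta); rewrite ger0_norm// => /(_ c1).
  move=> /cvgrPdist_lt/(_ e e0); apply: filterS => k.
  by rewrite sub0r normrN ger0_norm// exprn_ge0.
rewrite -(psum N); apply: leeD.
  by apply: nneseries_lim_ge => k _ _; exact: I0.
by apply: le_trans (Jle N) _; rewrite lee_fin ltW// Ne/=.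
Qed.

(** The sum over the picked stick telescopes, by the steps [J k = I k + J k.+1]
    above, from [J 0] to the limit 0 of [J]. *)
Lemma pick_invariant :
  \int[P]_t pick n F (W t) = \int[P]_t F (W t).
Proof.
rewrite -series_I /pick integral_nneseries//; last 2 first.
- move=> k.
  exact: (measurableT_comp (measurable_pick_term n (n + k) mF) measurable_sticks).
- by move=> k t _; rewrite mule_ge0 ?F0 ?lee_fin ?safe_weight_ge0.
apply: eq_eseriesr => k _; apply: ge0_ae_eq_integral => //.
- exact: (measurableT_comp (measurable_pick_term n (n + k) mF) measurable_sticks).
- exact: emeasurable_funM.
- by move=> t _; rewrite mule_ge0 ?F0 ?lee_fin ?safe_weight_ge0.
- by move=> t _; rewrite mule_ge0 ?F0 ?lee_fin.
apply: filterS2 (ae_open_unit v_iid beta01)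
  (ae_stick_inj v_iid beta01 beta_atomless) => t t01 tinj _.
rewrite safe_weightE; last exact: stick_subweights.
congr (_%:E * _); rewrite /pick_weight /aw indicE mem_set ?mulr1.
  rewrite !gtr0_norm//; first by rewrite rest_stick rest_gt0.
  exact: stick_gt0.
by move=> [i /= ni /tinj]; lia.
Qed.

End pick_invariance.


(** * The law of a size-biased permutation *)

Section conditional_probability_integral.
Local Open Scope ereal_scope.
Context {R : realType} d (T : measurableType d) (P : probability T R).
Variables (G : set (set T)) (E : set T) (y : T -> R).
Hypothesis Gm : <<s G >> `<=` measurable.
Hypothesis mE : measurable E.
Hypothesis y0 : {ae P, forall t, (0 <= y t)%R}.
Hypothesis Ey : is_cond_prob P <<s G >> E (fun t => (y t)%:E).

Local Notation TG := (g_sigma_algebraType G).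

Lemma measurable_fun_coarser d' (S : measurableType d') (f : T -> S) :
  measurable_fun setT (f : TG -> S) -> measurable_fun setT f.
Proof. by move=> mf _ B mB; apply: Gm; exact: mf. Qed.

(** A conditional probability given a sigma-algebra is the density, on that
    sigma-algebra, of the measure restricted to the event.  The maximum with 0
    changes nothing almost surely; it makes the density nonnegative everywhere. *)
Lemma cond_prob_integral (X : T -> \bar R) :
  measurable_fun setT (X : TG -> \bar R) -> (forall t, 0 <= X t) ->
  \int[P]_t (X t * (\1_E t)%:E) = \int[P]_t (X t * (Num.max (y t) 0)%:E).
Proof.
move=> mX X0; have [yG yE] := Ey.
have mi : measurable_fun [set: T] (id : T -> TG).
  by move=> _ B mB; rewrite setTI; exact: Gm.
have myG : measurable_fun setT (y : TG -> R).
  by apply/measurable_EFinP => _ B mB; rewrite setTI; exact: yG.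
pose yp t := Num.max (y t) 0%R.
have mypG : measurable_fun setT (yp : TG -> R) by exact: measurable_maxr.
have my := measurable_fun_coarser myG; have myp := measurable_fun_coarser mypG.
have yp0 t : (0 <= yp t)%R by rewrite le_max lexx orbT.
pose PG := measure_function_pushforward__canonical__measure_function_Measure P mi.
pose PE := mrestr P mE.
pose mG := measure_function_pushforward__canonical__measure_function_Measure PE mi.
have mGE (A : set TG) : measurable A -> mG A = \int[PG]_(x in A) (yp x)%:E.
  move=> mA; transitivity (\int[P]_(t in A) (y t)%:E).
    by rewrite yE//= setIC.
  rewrite [RHS](ge0_integral_pushforward mi P mA)//; last 2 first.
  - by apply/measurable_EFinP; exact: measurable_funTS.
  - by move=> x _; rewrite lee_fin.
  apply: ae_eq_integral => //; first exact: Gm.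
  - by apply/measurable_EFinP; exact: measurable_funTS.
  - by apply/measurable_EFinP; exact: measurable_funTS.
  by apply: filterS y0 => t ty0 _; rewrite /= /yp (max_idPl ty0).
have := ge0_integral_density (m := mG) (mu := PG) mypG yp0 mGE mX X0.
rewrite (ge0_integral_pushforward mi PE measurableT mX (fun t _ => X0 t)).
rewrite (@ge0_integral_pushforward _ _ _ _ _ _ mi P setT) //; last 2 first.
- by apply: emeasurable_funM => //; exact/measurable_EFinP.
- by move=> t _; rewrite mule_ge0// lee_fin.
rewrite preimage_setT => <- /=.
have mX' := measurable_fun_coarser mX.
have mIE : measurable_fun setT (\1_E : T -> R) by exact: measurable_indic.
rewrite -(ge0_integral_density (m := PE) mIE)// => A mA.
by rewrite integral_indic//= setIC.
Qed.

End conditional_probability_integral.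

Lemma nneseries_single {R : realType} (u : nat -> \bar R) (l : nat) :
  (forall k, k != l -> u k = 0%E) -> (\sum_(k <oo) u k = u l)%E.
Proof.
move=> u0; apply/cvg_lim => //; apply: cvg_near_cst; exists l.+1 => //= n ln.
rewrite (bigD1_seq l)//= ?mem_index_iota ?iota_uniq//.
by rewrite big1 ?adde0// => k kl; exact: u0.
Qed.

(** Finitely many distinct terms all occur in some initial segment. *)
Lemma subweights_reindex {R : realType} (z : nat -> R) (s : nat -> nat) :
  injective s -> subweights z -> subweights (z \o s).
Proof.
move=> sI [z0 z1]; split=> [j|N]; first exact: z0.
pose r := [seq s i | i <- iota 0 N].
have [M rM] : exists M, forall j, j \in r -> (j < M)%N.
  by exists (\max_(i <- r) i).+1 => j jr; rewrite ltnS; exact: leq_bigmax_seq.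
apply: le_trans (z1 M).
have -> : \sum_(i < N) (z \o s) i = \sum_(j <- r) z j.
  by rewrite big_map -(big_mkord predT (fun i => z (s i))) /index_iota subn0.
rewrite -(big_mkord predT z) /index_iota subn0.
have ru : uniq r by rewrite map_inj_uniq ?iota_uniq.
rewrite [leRHS](bigID (mem r))/= -[X in _ <= X + _]big_filter.
rewrite [X in _ <= X + _](perm_big r); last first.
  apply: uniq_perm => //; first by rewrite filter_uniq// iota_uniq.
  move=> j; rewrite mem_filter mem_iota/= add0n andb_idr//.
  exact: rM.
by rewrite lerDl sumr_ge0.
Qed.

Section uniqueness.
Local Open Scope ereal_scope.
Context {R : realType} d (T : measurableType d) (P : probability T R).
Variables W Wt : nat -> {RV P >-> R}.
Hypothesis W_pick : forall n (F : seqR R -> \bar R), measurable_fun setT F ->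
  (forall x, 0 <= F x <= 1) ->
  \int[P]_t pick n F (seq_of W t) = \int[P]_t F (seq_of W t).
Hypothesis W_weights : {ae P, forall t,
  subweights (seq_of W t) /\ injective (seq_of W t)}.
Hypothesis Wt_listing : {ae P, forall t, exists s : nat -> nat,
  injective s /\ forall n, Wt n t = W (s n) t}.
Hypothesis Wt_cond : forall n j,
  is_cond_prob P <<s coord_events setT W `|` coord_events `I_n Wt >>
    [set t | Wt n t = W j t]
    (fun t => (W j t / (1 - \sum_(i < n) Wt i t)
               * \1_(~` [set Wt i t | i in `I_n]) (W j t))%:E).

Local Notation gens n := (coord_events setT W `|` coord_events `I_n Wt).
Local Notation TG n := (g_sigma_algebraType (gens n)).

Let gens_measurable n : <<s gens n >> `<=` measurable.
Proof.
apply: smallest_sub; first exact: sigma_algebra_measurable.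
by move=> A [] [i _ [B mB <-]]; apply: measurableI => //; exact: measurable_preimage.
Qed.

Let mWG n i : measurable_fun setT (W i : TG n -> R).
Proof.
by move=> _ B mB; apply: sub_sigma_algebra; left; exists i => //; exists B.
Qed.

Let mWtG n i : (i < n)%N -> measurable_fun setT (Wt i : TG n -> R).
Proof.
by move=> ni _ B mB; apply: sub_sigma_algebra; right; exists i => //; exists B.
Qed.

(* The first n picks are those that the reordering [s] prescribes. *)
Let agree (s : nat -> nat) (n : nat) : set T :=
  [set t | forall i, (i < n)%N -> Wt i t = W (s i) t].

Let magreeG s n m : (n <= m)%N -> measurable (agree s n : set (TG m)).
Proof.
move=> nm; have -> : agree s n = \bigcap_(i in `I_n) [set t | Wt i t == W (s i) t].
  by apply/seteqP; split => t h i ni; apply/eqP; exact: h.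
apply: fin_bigcap_measurable => // i ni; rewrite -[X in measurable X]setTI.
apply: (@measurable_fun_eqr _ (TG m) R setT (Wt i) (W (s i))) => //.
by apply: mWtG; exact: leq_trans nm.
Qed.

Let magree s n : measurable (agree s n).
Proof. exact: gens_measurable (magreeG s (leqnn n)). Qed.

Let mI s n : measurable_fun setT (fun t => (\1_(agree s n) t)%:E : \bar R).
Proof. by apply/measurable_EFinP; exact: measurable_indic. Qed.

Let mE n j : measurable [set t | Wt n t = W j t].
Proof.
have -> : [set t | Wt n t = W j t] = [set t | Wt n t == W j t].
  by apply/seteqP; split => t /eqP.
by rewrite -[X in measurable X]setTI; apply: measurable_fun_eqr.
Qed.

Let reindex (s : nat -> nat) (t : T) : seqR R := seq_of W t \o s.

Let mreindexG s n : measurable_fun setT (reindex s : TG n -> seqR R).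
Proof. by apply: measurable_seqP => i; exact: mWG. Qed.

Let mreindex s : measurable_fun setT (reindex s).
Proof. by apply: measurable_seqP => i. Qed.

(* Given the first n picks, the next one is a term not yet picked, that is
   [s (n + l)] for exactly one l; moving it to place n in [s] records it. *)
Let split_pick s n (u : T -> \bar R) t :
  injective s -> (forall j, exists i, s i = j) ->
  injective (seq_of W t) ->
  (exists r : nat -> nat, injective r /\ forall n, Wt n t = W (r n) t) ->
  (\1_(agree s n) t)%:E * u t =
  \sum_(l <oo) ((\1_(agree (s \o insert_at n (n + l)) n.+1) t)%:E * u t).
Proof.
move=> sI sS WI [r [rI Wtr]].
have agreeS l : agree (s \o insert_at n (n + l)) n.+1 t <->
    agree s n t /\ Wt n t = W (s (n + l)%N) t.
  split => [h|[h1 h2] i].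
    split => [i ni|]; last by rewrite h// /= insert_at_eq.
    by rewrite h ?(ltn_trans ni)//= insert_at_lt.
  rewrite ltnS leq_eqVlt => /predU1P[->|ni]; first by rewrite /= insert_at_eq.
  by rewrite /= insert_at_lt// h1.
have [st|st] := boolP (t \in agree s n); last first.
  rewrite indicE (negbTE st) mul0e eseries0// => l _ _.
  rewrite indicE memNset ?mul0e// => /agreeS[+ _].
  by move: st; rewrite notin_setE.
have {}st := set_mem st.
have rs i : (i < n)%N -> r i = s i.
  by move=> ni; apply: WI; rewrite /seq_of -Wtr st.
have [l sl] := sS (r n).
have nl : (n <= l)%N.
  rewrite leqNgt; apply/negP => ln; have := rs l ln.
  by rewrite sl => /rI; move: ln => /[swap] ->; rewrite ltnn.
rewrite (nneseries_single (l := l - n)); last first.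
  move=> k kl; rewrite indicE memNset ?mul0e// => /agreeS[_].
  rewrite Wtr => /WI; rewrite -sl => /sI lE; move: kl; rewrite lE.
  by rewrite addKn eqxx.
rewrite !indicE !mem_set//; apply/agreeS; split => //.
by rewrite subnKC// sl Wtr.
Qed.

Let sum_le1 t n : subweights (seq_of W t) ->
  (exists r : nat -> nat, injective r /\ forall n, Wt n t = W (r n) t) ->
  (\sum_(i < n) Wt i t <= 1)%R.
Proof.
move=> tW [r [rI Wtr]]; have [_ /(_ n)] := subweights_reindex rI tW.
by congr (_ <= _)%R; apply: eq_bigr => i _; rewrite Wtr.
Qed.

(* The defining property of a size-biased permutation, integrated against a
   function of the weights and of the first n picks.  On [agree s n] the mass of
   the picks is that of the first n terms of the reordered sequence. *)
Let one_pick s n (H : seqR R -> \bar R) l :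
  injective s -> measurable_fun setT H -> (forall x, 0 <= H x) ->
  \int[P]_t ((\1_(agree (s \o insert_at n (n + l)) n.+1) t)%:E *
             H (reindex (s \o insert_at n (n + l)) t)) =
  \int[P]_t ((\1_(agree s n) t)%:E * ((safe_weight n (n + l) (reindex s t))%:E *
             H (reindex s t \o insert_at n (n + l)))).
Proof.
move=> sI mH H0; pose j := s (n + l)%N.
pose X t := (\1_(agree s n) t)%:E * H (reindex (s \o insert_at n (n + l)) t).
have mXG : measurable_fun setT (X : TG n -> \bar R).
  have mHG := measurableT_comp mH (@mreindexG (s \o insert_at n (n + l)) n).
  apply: emeasurable_funM; last exact: mHG.
  by apply/measurable_EFinP; exact: measurable_indic (magreeG s (leqnn n)).
have X0 t : 0 <= X t by rewrite mule_ge0 ?lee_fin.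
pose y t := (W j t / (1 - \sum_(i < n) Wt i t)
             * \1_(~` [set Wt i t | i in `I_n]) (W j t))%R.
have y0 : {ae P, forall t, (0 <= y t)%R}.
  apply: filterS2 W_weights Wt_listing => t [tW _] tr.
  rewrite mulr_ge0// divr_ge0 ?subr_ge0 ?sum_le1//.
  by case: tW => /(_ j).
have my : measurable_fun setT y.
  have myG : measurable_fun setT ((fun t => (y t)%:E) : TG n -> \bar R).
    by move=> _ B mB; rewrite setTI; exact: (Wt_cond n j).1.
  by apply/measurable_EFinP; exact: measurable_fun_coarser myG.
have mX := measurable_fun_coarser (@gens_measurable n) mXG.
have := cond_prob_integral (@gens_measurable n) (mE n j) y0 (Wt_cond n j) mXG X0.
move=> XE; transitivity (\int[P]_t (X t * (\1_[set t | Wt n t = W j t] t)%:E)).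
  have -> : agree (s \o insert_at n (n + l)) n.+1 =
      agree s n `&` [set t | Wt n t = W j t].
    apply/seteqP; split => [u h|u [h1 h2] i].
      split => [i ni|]; last by rewrite /= h//= insert_at_eq.
      by rewrite h ?(ltn_trans ni)//= insert_at_lt.
    rewrite ltnS leq_eqVlt => /predU1P[->|ni]; first by rewrite /= insert_at_eq.
    by rewrite /= insert_at_lt// h1.
  by apply: eq_integral => t _; rewrite indicI/= EFinM /X muleAC.
rewrite XE; apply: ge0_ae_eq_integral => //.
- apply: emeasurable_funM => //; apply/measurable_EFinP.
  exact: measurable_maxr.
- apply: emeasurable_funM => //.
  exact: (measurableT_comp (measurable_pick_term n (n + l) mH) (mreindex s)).
- by move=> t _; rewrite mule_ge0// lee_fin le_max lexx orbT.
- by move=> t _; rewrite !mule_ge0 ?lee_fin ?safe_weight_ge0.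
apply: filterS3 W_weights Wt_listing y0 => t [tW _] tr ty0 _.
rewrite (max_idPl ty0) /X -muleA; have [ts|ts] := boolP (t \in agree s n); last first.
  by rewrite indicE (negbTE ts) !mul0e.
have {}ts := set_mem ts; congr (_ * _); rewrite muleC; congr (_%:E * _).
rewrite safe_weightE; last exact: subweights_reindex.
rewrite /y /pick_weight.
have -> : (\sum_(i < n) Wt i t = \sum_(i < n) reindex s t i)%R.
  by apply: eq_bigr => i _; rewrite ts.
congr (_ * \1_(~` _) _)%R.
by apply/seteqP; split => _ [i /= ni <-]; exists i => //; rewrite ts.
Qed.

(* Iterated picks at the places N - k, ..., N - 1, the first place being the
   outermost operation. *)
Let picks N (F : seqR R -> \bar R) :=
  fix H k := if k is k'.+1 then pick (N - k)%N (H k') else F.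

Let picksP N F k : measurable_fun setT F -> (forall x, 0 <= F x <= 1) ->
  measurable_fun setT (picks N F k) /\ forall x, 0 <= picks N F k x <= 1.
Proof.
move=> mF F01; elim: k => [//|k [mH H01]].
have H0 x : 0 <= picks N F k x by case/andP: (H01 x).
split; first exact: measurable_pick.
by move=> x; rewrite pick_ge0//= pick_le1.
Qed.

(* Induction on the number k of picks that are averaged out, the last ones first.
   The statement must range over all reorderings [s] of the indices, because a
   pick turns [s] into its composition with an insertion. *)
Let picks_agree N (F : seqR R -> \bar R) k s :
  measurable_fun setT F -> (forall x, 0 <= F x <= 1) ->
  (forall x y : seqR R, (forall i, (i < N)%N -> x i = y i) -> F x = F y) ->
  (k <= N)%N -> injective s -> (forall j, exists i, s i = j) ->
  \int[P]_t ((\1_(agree s (N - k)) t)%:E * F (seq_of Wt t)) =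
  \int[P]_t ((\1_(agree s (N - k)) t)%:E * picks N F k (reindex s t)).
Proof.
move=> mF F01 FN; elim: k s => [|k IH] s kN sI sS.
  apply: eq_integral => t _; rewrite subn0.
  have [ts|ts] := boolP (t \in agree s N); last first.
    by rewrite indicE (negbTE ts) !mul0e.
  by congr (_ * _); apply: FN => i iN; exact: (set_mem ts).
have [mH H01] := picksP N k mF F01.
have H0 x : 0 <= picks N F k x by case/andP: (H01 x).
have F0 x : 0 <= F x by case/andP: (F01 x).
set n := (N - k.+1)%N; have nE : (N - k)%N = n.+1 by rewrite /n; lia.
have mFW : measurable_fun setT (fun t => F (seq_of Wt t)).
  exact: (measurableT_comp mF (measurable_seq_of Wt)).
transitivity (\int[P]_t \sum_(l <oo)
    ((\1_(agree (s \o insert_at n (n + l)) n.+1) t)%:E * F (seq_of Wt t))).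
  apply: ge0_ae_eq_integral => //.
  - exact: emeasurable_funM.
  - apply: ge0_emeasurable_sum => [l t _ _|l _]; last exact: emeasurable_funM.
    by rewrite mule_ge0// lee_fin.
  - by move=> t _; rewrite mule_ge0// lee_fin.
  - by move=> t _; apply: nneseries_ge0 => l _ _; rewrite mule_ge0// lee_fin.
  apply: filterS2 W_weights Wt_listing => t [_ WI] tr _.
  exact: (split_pick n (fun t => F (seq_of Wt t))).
rewrite integral_nneseries//; last 2 first.
- by move=> l; exact: emeasurable_funM.
- by move=> l t _; rewrite mule_ge0// lee_fin.
transitivity (\sum_(l <oo) \int[P]_t ((\1_(agree s n) t)%:E *
    ((safe_weight n (n + l) (reindex s t))%:E *
     picks N F k (reindex s t \o insert_at n (n + l))))).
  apply: eq_eseriesr => l _; rewrite -one_pick// -nE; apply: IH => //.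
  - exact: ltnW.
  - by apply: inj_comp => //; apply: insert_at_inj; exact: leq_addr.
  - move=> j; have [i <-] := sS j.
    by have [i' <-] := insert_at_surj i (leq_addr l n); exists i'.
have mterm l : measurable_fun setT (fun t => (\1_(agree s n) t)%:E *
    ((safe_weight n (n + l) (reindex s t))%:E *
     picks N F k (reindex s t \o insert_at n (n + l)))).
  apply: emeasurable_funM => //.
  exact: (measurableT_comp (measurable_pick_term n (n + l) mH) (mreindex s)).
rewrite -integral_nneseries//; last first.
  by move=> l t _; rewrite !mule_ge0 ?lee_fin ?safe_weight_ge0.
apply: eq_integral => t _; rewrite nneseriesZl// => l _.
by rewrite mule_ge0 ?lee_fin ?safe_weight_ge0.
Qed.

(** For N picks out of N, no agreement is required, and the iterated picks leave
    the law of the weights unchanged by [W_pick]. *)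
Lemma size_biased_law A : measurable A ->
  P (seq_of Wt @^-1` A) = P (seq_of W @^-1` A).
Proof.
apply: eq_law_boxes; [exact: measurable_seq_of|exact: measurable_seq_of| |].
  by rewrite [ltLHS]probability_setT ltry.
move=> N B mB; pose F (x : seqR R) := (\1_(box N B) x)%:E : \bar R.
have mbox := measurable_box N mB.
have mF : measurable_fun setT F by apply/measurable_EFinP; exact: measurable_indic.
have F01 x : 0 <= F x <= 1.
  by rewrite !lee_fin indicE; case: (_ \in _); rewrite /= ?ler01 ?lexx.
have FN x y : (forall i, (i < N)%N -> x i = y i) -> F x = F y.
  move=> xy; congr (_%:E); rewrite !indicE; congr (nat_of_bool _)%:R.
  apply/idP/idP => /set_mem h; apply/mem_set => i iN; first by rewrite -xy//; exact: h.
  by rewrite xy//; exact: h.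
have PE (V : nat -> {RV P >-> R}) :
    P (seq_of V @^-1` box N B) = \int[P]_t F (seq_of V t).
  have mV := measurable_preimage (measurable_seq_of V) mbox.
  transitivity (\int[P]_t (\1_(seq_of V @^-1` box N B) t)%:E); last by [].
  by rewrite integral_indic// setIT.
apply: (eq_trans (PE Wt)); apply/esym; apply: (eq_trans (PE W)); apply/esym.
have agree0 s : agree s 0 = setT by apply/seteqP; split.
have := @picks_agree N F N id mF F01 FN (leqnn N) (fun _ _ => id) (fun j => ex_intro _ j erefl).
rewrite subnn agree0.
under eq_integral do rewrite indicT mul1e.
under [in RHS]eq_integral do rewrite indicT mul1e.
move=> ->; have : forall k, \int[P]_t picks N F k (seq_of W t) = \int[P]_t F (seq_of W t).
  elim=> [//|k IH]; rewrite -IH; have [mH H01] := picksP N k mF F01.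
  exact: W_pick.
by move=> /(_ N).
Qed.

End uniqueness.


(** * The distribution function of Be(1, theta) *)

Section integral_of_power.
Context {R : realType}.
Local Notation mu := (@lebesgue_measure R).

Lemma is_derive_onem_powR (a x : R) : x < 1 ->
  is_derive x 1 (fun s : R => (1 - s) `^ a) (- (a * (1 - x) `^ (a - 1))).
Proof.
move=> x1; have x0 : 0 < 1 - x by rewrite subr_gt0.
have d1 : is_derive x 1 (fun s : R => 1 - s) (- 1).
  by rewrite -[- 1]add0r; apply: is_deriveB.
have d2 : is_derive (1 - x) 1 (fun y : R => y `^ a) (a * (1 - x) `^ (a - 1)).
  exact: is_derive1_powR.
have := is_derive1_comp (g := fun s : R => 1 - s) d2 d1.
by rewrite mulrN1.
Qed.

Lemma continuous_onem_powR (a x : R) : x < 1 ->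
  {for x, continuous (fun s : R => (1 - s) `^ a)}.
Proof.
move=> x1; apply: differentiable_continuous; apply/derivable1_diffP.
by have [] := is_derive_onem_powR a x1.
Qed.

Lemma integral_onem_powR (theta q : R) : 0 < theta -> 0 <= q < 1 ->
  (\int[mu]_(s in `]0%R, q]) ((1 - s) `^ (theta - 1))%R%:E =
   ((1 - (1 - q) `^ theta) / theta)%R%:E)%E.
Proof.
move=> t0 /andP[]; rewrite le_eqVlt => /predU1P[<- _|q0 q1].
  by rewrite set_itvoc0 integral_set0 subr0 powR1 subrr mul0r.
rewrite integral_itv_obnd_cbnd; last first.
  apply/measurable_EFinP.
  have m1 : measurable_fun [set: R] (fun s : R => 1 - s) by exact: measurable_funB.
  exact: measurable_funTS (measurableT_comp (@measurable_powR R (theta - 1)) m1).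
pose F (s : R) : R := - theta^-1 * (1 - s) `^ theta.
have dF (x : R) : x < 1 -> is_derive x 1 F ((1 - x) `^ (theta - 1)).
  move=> x1; have h := is_derive_onem_powR theta x1.
  have := is_deriveZ (- theta^-1) h.
  rewrite /F; rewrite -[(_ *: - _)%R]/(- theta^-1 * - (theta * (1 - x) `^ (theta - 1))).
  by rewrite mulrNN mulKf ?gt_eqF.
have cF (x : R) : x < 1 -> {for x, continuous F}.
  move=> x1; apply: differentiable_continuous; apply/derivable1_diffP.
  by have [] := dF _ x1.
rewrite (@continuous_FTC2 _ _ F 0 q)//.
- by rewrite /F -EFinB subr0 powR1; congr (_%:E); field; rewrite gt_eqF.
- apply: continuous_in_subspaceT => x; rewrite inE/= in_itv/= => /andP[_ xq].
  by apply: continuous_onem_powR; exact: le_lt_trans q1.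
- split.
  + move=> x; rewrite in_itv/= => /andP[_ xq].
    by have [] := dF _ (lt_trans xq q1).
  + by apply: cvg_at_right_filter; apply: cF.
  + by apply: cvg_at_left_filter; exact: cF.
- move=> x; rewrite in_itv/= => /andP[_ xq].
  by rewrite derive1E; have [_] := dF _ (lt_trans xq q1).
Qed.

End integral_of_power.

Section uniform_transform.
Local Open Scope ereal_scope.
Context {R : realType}.
Local Notation mu := (@lebesgue_measure R).
Variables (beta : probability R R) (theta Z : R).
Hypothesis theta0 : (0 < theta)%R.
Hypothesis Z0 : (0 <= Z)%R.
Hypothesis betaE : forall A, measurable A ->
  beta A = \int[mu]_(s in A) (be1_density theta Z s)%:E.

Lemma be1_unit_mass : beta `]0%R, 1%R[%classic = 1.
Proof.
apply: (density_open_unit_mass _ betaE) => s s01.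
by rewrite /be1_density (negbTE s01).
Qed.

Lemma be1_atomless s : beta [set s] = 0.
Proof. exact: density_atomless betaE. Qed.

Let Zinv : R := (theta * Z)^-1.

Let beta_itv q : (0 <= q < 1)%R ->
  beta `]0%R, q]%classic = (Zinv * (1 - (1 - q) `^ theta))%:E.
Proof.
move=> /andP[q0 q1]; rewrite betaE//.
transitivity (\int[mu]_(s in `]0%R, q]) ((Z^-1)%:E * ((1 - s) `^ (theta - 1))%:E)).
  apply: eq_integral => s; rewrite inE/= in_itv/= /be1_density => /andP[s0 sq].
  by rewrite s0 (le_lt_trans sq)//= mulrC EFinM.
rewrite ge0_integralZl_EFin//; last 3 first.
- by move=> s _; rewrite lee_fin powR_ge0.
- apply/measurable_EFinP.
  have m1 : measurable_fun [set: R] (fun s : R => 1 - s)%R by exact: measurable_funB.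
  exact: measurable_funTS (measurableT_comp (@measurable_powR R (theta - 1)) m1).
- by rewrite invr_ge0.
rewrite integral_onem_powR ?q0// -EFinM; congr (_%:E).
by rewrite /Zinv invfM; ring.
Qed.

(** The distribution function of Be(1, theta), named after its use: it maps a
    Be(1, theta) variable to a uniform one. *)
Definition unif (s : R) : R := (1 - (1 - s) `^ theta)%R.

Definition quantile (y : R) : R := (1 - (1 - y) `^ theta^-1)%R.

Lemma quantile_itv y : (0 <= y < 1)%R -> (0 <= quantile y < 1)%R.
Proof.
move=> /andP[y0 y1]; have oy : (0 < 1 - y)%R by rewrite subr_gt0.
rewrite /quantile subr_ge0 ltrBlDr ltrDl powR_gt0// andbT.
have := @ge0_ler_powR R theta^-1 (ltW _) (1 - y)%R 1%R.
rewrite powR1; apply; rewrite ?invr_gt0 ?nnegrE ?(ltW oy)//.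
by rewrite lerBlDr lerDl.
Qed.

Lemma quantileK y : (0 <= y < 1)%R -> unif (quantile y) = y.
Proof.
move=> /andP[y0 y1]; rewrite /unif /quantile subKr.
by rewrite -powRrM mulVf ?gt_eqF// powRr1 ?subr_ge0 ?ltW// subKr.
Qed.

Lemma unif_lt s y : (0 < s < 1)%R -> (0 <= y < 1)%R ->
  (unif s < y)%R = (s < quantile y)%R.
Proof.
move=> /andP[s0 s1] y01; have /andP[q0 q1] := quantile_itv y01.
rewrite -{1}(quantileK y01) /unif ltrD2l ltrN2.
have os : (0 <= 1 - s)%R by rewrite subr_ge0 ltW.
have oq : (0 <= 1 - quantile y)%R by rewrite subr_ge0 ltW.
apply/idP/idP => [|sq].
  apply: contraLR; rewrite -!leNgt => qs.
  by apply: ge0_ler_powR; rewrite ?nnegrE ?lerD2l ?lerN2// ltW.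
by apply: gt0_ltr_powR; rewrite ?nnegrE ?ltrD2l ?ltrN2.
Qed.

Lemma unif_itv s : (0 < s < 1)%R -> (0 <= unif s < 1)%R.
Proof.
move=> /andP[s0 s1]; have os : (0 < 1 - s)%R by rewrite subr_gt0.
rewrite /unif ltrBlDr ltrDl powR_gt0// andbT subr_ge0.
have := @ge0_ler_powR R theta (ltW theta0) (1 - s)%R 1%R.
rewrite powR1; apply; rewrite ?nnegrE ?(ltW os)//.
by rewrite lerBlDr lerDl ltW.
Qed.

Lemma measurable_unif : measurable_fun [set: R] unif.
Proof.
apply: measurable_funB => //.
have m1 : measurable_fun [set: R] (fun s : R => 1 - s)%R by exact: measurable_funB.
exact: (measurableT_comp (@measurable_powR R theta) m1).
Qed.

(* The intervals from 0 to [q n] exhaust the unit interval, whose mass is 1. *)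
Let Zinv1 : Zinv = 1%R.
Proof.
pose q n : R := quantile (1 - n.+1%:R^-1).
have y01 n : (0 <= 1 - (n.+1%:R^-1 : R) < 1)%R.
  by rewrite subr_ge0 invf_le1 ?ler1n ?ltr0n//= ltrBlDr ltrDl invr_gt0.
have bq n : beta `]0%R, q n]%classic = (Zinv * (1 - n.+1%:R^-1))%:E.
  rewrite beta_itv ?quantile_itv//; congr (_ * _)%:E.
  exact: quantileK.
have bU : \bigcup_n `]0%R, q n]%classic = `]0%R, 1%R[%classic.
  apply/seteqP; split => s.
    move=> [n _]; rewrite /= !in_itv/= => /andP[-> sq].
    by rewrite (le_lt_trans sq)//; case/andP: (quantile_itv (y01 n)).
  rewrite /= in_itv/= => s01; have := unif_itv s01 => /andP[u0 u1].
  have u0' : (0 < 1 - unif s)%R by rewrite subr_gt0.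
  have [n _ /(_ n (leqnn n)) nu] := near_infty_natSinv_lt (PosNum u0').
  exists n => //=; rewrite in_itv/=; case/andP: (s01) => -> _/=.
  rewrite ltW// -unif_lt ?y01//; move: nu => /=; rewrite ltrBrDl => nu.
  by rewrite ltrBrDl addrC.
have cv1 : (beta \o (fun n => `]0%R, q n]%classic)) n @[n --> \oo] --> 1.
  rewrite -be1_unit_mass -bU; apply: nondecreasing_cvg_mu => //.
  - by apply: bigcupT_measurable.
  - move=> n m nm; apply/subsetPset => s; rewrite /= !in_itv/= => /andP[-> sq].
    apply: (le_trans sq); rewrite /q /quantile lerD2l lerN2.
    apply: ge0_ler_powR; rewrite ?invr_ge0 ?(ltW theta0)// ?nnegrE ?subKr ?invr_ge0//.
    by rewrite lef_pV2 ?posrE// ler_nat.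
have cv2 : (beta \o (fun n => `]0%R, q n]%classic)) n @[n --> \oo] --> Zinv%:E.
  rewrite (_ : _ \o _ = (fun n => (Zinv * (1 - n.+1%:R^-1))%:E)); last first.
    by apply/funext => n; exact: bq.
  apply: cvg_EFin; first exact: nearW.
  rewrite -[X in _ --> X]mulr1; apply: cvgMr.
  rewrite -[X in _ --> X]subr0; apply: cvgB; first exact: cvg_cst.
  exact: cvg_harmonic.
have e1 := cvg_lim (@ereal_hausdorff R) cv1.
have e2 := cvg_lim (@ereal_hausdorff R) cv2.
by apply: EFin_inj; exact: (etrans (esym (e2 _)) (e1 _)).
Qed.

Lemma beta_unif_lt y : (0 <= y <= 1)%R ->
  beta [set s | (0 < s < 1)%R && (unif s < y)%R] = y%:E.
Proof.
move=> /andP[y0]; rewrite le_eqVlt => /predU1P[->|y1].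
  rewrite -be1_unit_mass; congr (beta _); apply/seteqP; split => s /=.
    by move=> /andP[+ _]; rewrite in_itv.
  by rewrite in_itv/= => s01; rewrite s01; case/andP: (unif_itv s01).
have y01 : (0 <= y < 1)%R by rewrite y0.
have q01 := quantile_itv y01.
transitivity (beta `]0%R, quantile y[%classic).
  congr (beta _); apply/seteqP; split => s /=; rewrite in_itv/=.
    by move=> /andP[s01]; rewrite unif_lt// => ->; case/andP: s01 => ->.
  move=> /andP[s0 sq]; have s01 : (0 < s < 1)%R.
    by rewrite s0 (lt_trans sq)//; case/andP: q01.
  by rewrite s01 unif_lt.
transitivity (beta `]0%R, quantile y]%classic).
  rewrite !betaE// integral_itv_bndo_bndc//; apply/measurable_EFinP.
  exact: measurable_funTS (measurable_be1_density _ _).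
by rewrite beta_itv// Zinv1 mul1r -[(1 - _)%R]/(unif (quantile y)) quantileK.
Qed.

Lemma measurable_unif_lt y :
  measurable [set s : R | (0 < s < 1)%R && (unif s < y)%R].
Proof.
rewrite -[X in measurable X]setTI; apply: measurable_and => //.
  by apply: measurable_and; exact: measurable_fun_ltr.
by apply: measurable_fun_ltr => //; exact: measurable_unif.
Qed.

(** The uniform law of [unif], on half-open intervals as produced by the choice
    of a stick by inversion. *)
Lemma beta_unif_itv a b : (0 <= a)%R -> (a <= b <= 1)%R ->
  beta [set s | (0 < s < 1)%R && (a <= unif s < b)%R] = (b - a)%:E.
Proof.
move=> a0 /andP[ab b1].
have -> : [set s | (0 < s < 1)%R && (a <= unif s < b)%R] =
   [set s | (0 < s < 1)%R && (unif s < b)%R] `\` [set s | (0 < s < 1)%R && (unif s < a)%R].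
  apply/seteqP; split => s /=.
    by move=> /and3P[-> au ->]; split => //; rewrite /= ltNge au.
  by move=> [/andP[-> ->]] /=; rewrite andbT leNgt => /negP.
rewrite measureD//; [|exact: measurable_unif_lt|exact: measurable_unif_lt|].
  rewrite setIidr; last first.
    by move=> s /= /andP[-> sa]/=; exact: lt_le_trans ab.
  by rewrite EFinB; congr (_ - _); apply: beta_unif_lt; rewrite ?a0 ?(le_trans a0) ?(le_trans ab).
by rewrite ltey_eq fin_num_measure//; exact: measurable_unif_lt.
Qed.

End uniform_transform.


(** * Beta densities *)

Section beta_density.
Context {R : realType}.
Local Notation mu := (@lebesgue_measure R).

Lemma be_fun_ge0 (a b : R) : 0 <= be_fun a b.
Proof.
rewrite /be_fun; apply: Rintegral_ge0 => s _.
by rewrite mulr_ge0// powR_ge0.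
Qed.

Lemma be_pdfE (a b s : R) : be_pdf a b s =
  if 0 < s < 1 then s `^ (a - 1) * (1 - s) `^ (b - 1) / be_fun a b else 0.
Proof.
rewrite /be_pdf patchE.
have -> : (s \in `]0, 1[%classic) = (0 < s < 1).
  by apply/idP/idP => [/set_mem|h]; [|apply/mem_set]; rewrite /= in_itv.
by case: ifP => //; rewrite mul0r.
Qed.

Lemma be_pdf_ge0 (a b s : R) : 0 <= be_pdf a b s.
Proof.
rewrite be_pdfE; case: ifP => // _.
by rewrite divr_ge0 ?be_fun_ge0// mulr_ge0// powR_ge0.
Qed.

Lemma measurable_be_kernel (a b : R) :
  measurable_fun [set: R] (fun s : R => s `^ (a - 1) * (1 - s) `^ (b - 1)).
Proof.
apply: measurable_funM; first exact: measurable_powR.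
have m1 : measurable_fun [set: R] (fun s : R => 1 - s) by exact: measurable_funB.
exact: (measurableT_comp (@measurable_powR R (b - 1)) m1).
Qed.

Lemma measurable_be_pdf (a b : R) : measurable_fun [set: R] (be_pdf a b).
Proof.
rewrite (_ : be_pdf a b = fun s => if 0 < s < 1 then
  s `^ (a - 1) * (1 - s) `^ (b - 1) / be_fun a b else 0); last first.
  by apply/funext => s; rewrite be_pdfE.
apply: measurable_fun_ifT => //.
  by apply: measurable_and; exact: measurable_fun_ltr.
by apply: measurable_funM => //; exact: measurable_be_kernel.
Qed.

Lemma be_pdf1E (theta : R) : be_pdf 1 theta = be1_density theta (be_fun 1 theta).
Proof.
apply/funext => s; rewrite be_pdfE /be1_density subrr powRr0 mul1r.
by case: ifP.
Qed.

End beta_density.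

(** * The chain with kappa = 0 *)

Section chain_of_order_zero.
Local Open Scope ereal_scope.
Context {R : realType} d (T : measurableType d) (P : probability T R).
Local Notation mu := (@lebesgue_measure R).

Lemma beta_kernel0 (alpha theta p : R) A : beta_kernel 0 alpha theta p A =
  \int[mu]_(s in A) (be_pdf alpha theta s)%:E.
Proof.
rewrite /beta_kernel; apply: eq_integral => s _; rewrite big_ord1/=.
by rewrite /binomial_pmf !addr0 subr0 !expr0 mulr1 mulr1n mulr1.
Qed.

(** By induction on the number of variables: the kernel is the constant Be(alpha,
    theta), and the past variables form an event of the past. *)
Lemma chain_iid (alpha theta : R) (v : nat -> {RV P >-> R}) :
  beta_chain 0 alpha theta v -> iid v (distribution P (v 0%N)).
Proof.
move=> [_ v0 vS] n B mB; elim: n => [|[_|n IH]].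
- rewrite big_ord0 (_ : [set t | _] = setT) ?probability_setT//.
  by apply/seteqP; split.
- rewrite big_ord1 /distribution/= /pushforward; congr (P _).
  apply/seteqP; split => t /=; first by move=> /(_ 0%N (ltn0Sn _)).
  by move=> Bt [|].
rewrite big_ord_recr/= -IH.
set F := [set t | forall i, (i < n.+1)%N -> B i (v i t)].
have GF : <<s coord_events `I_n.+1 v >> F.
  have -> : F = \bigcap_(i in `I_n.+1) (v i @^-1` B i) by [].
  apply: (@fin_bigcap_measurable _ (g_sigma_algebraType (coord_events `I_n.+1 v))) => //.
  move=> i ni; apply: sub_sigma_algebra; exists i => //; exists (B i) => //.
  by rewrite setTI.
have [_ /(_ F GF)] := vS n (B n.+1) (mB n.+1).
under eq_integral do rewrite beta_kernel0 -v0//.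
have mF : measurable F.
  have -> : F = \bigcap_(i in `I_n.+1) (v i @^-1` B i) by [].
  by apply: fin_bigcap_measurable => // i _; exact: measurable_preimage.
rewrite integral_cst// => PE.
transitivity (P ((v n.+1 @^-1` B n.+1) `&` F)); last by rewrite -PE muleC.
congr (P _); apply/seteqP; split => [t h|t [h1 h2] i].
  by split=> [|i ni]; apply: h => //; exact: ltnW.
by rewrite ltnS leq_eqVlt => /predU1P[->|/h2].
Qed.

End chain_of_order_zero.

Section iid_subsequence.
Local Open Scope ereal_scope.
Context {R : realType} d (T : measurableType d) (P : probability T R).

Lemma iid_double (v : nat -> {RV P >-> R}) beta :
  iid v beta -> iid (fun i => v i.*2) beta.
Proof.
move=> v_iid n B mB.
pose C k := if odd k then setT else B k./2.
have mC k : measurable (C k) by rewrite /C; case: ifP.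
have -> : [set t | forall i, (i < n)%N -> B i (v i.*2 t)] =
    [set t | forall i, (i < n.*2)%N -> C i (v i t)].
  apply/seteqP; split => t h i.
    move=> i2n; rewrite /C; case: ifPn => // io.
    have <- : i./2.*2 = i by rewrite -[RHS]odd_double_half (negbTE io).
    by rewrite doubleK; apply: h; rewrite ltn_half_double.
  by move=> ni; have := h i.*2; rewrite ltn_double ni /C odd_double doubleK; apply.
rewrite v_iid//; elim: n => [|n IH]; first by rewrite !big_ord0.
rewrite doubleS !big_ord_recr/= IH /C /= odd_double/= doubleK.
by rewrite probability_setT mule1.
Qed.

End iid_subsequence.


(** * Construction of a size-biased permutation *)

Section discrete_measurability.
Context d (S : measurableType d) (I : countType).

Lemma measurable_discrete_comp (f : S -> I) (Q : I -> set S) :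
  (forall i, measurable [set x | f x = i]) -> (forall i, measurable (Q i)) ->
  measurable [set x | Q (f x) x].
Proof.
move=> mf mQ.
have -> : [set x | Q (f x) x] =
    \bigcup_n (if unpickle n is Some i then [set x | f x = i] `&` Q i else set0).
  apply/seteqP; split => [x Qx|x [n _]].
    by exists (pickle (f x)) => //; rewrite pickleK.
  by case: unpickle => // i [/= <-].
by apply: bigcupT_measurable => n; case: unpickle => // i; exact: measurableI.
Qed.

End discrete_measurability.

Section choice_of_a_stick.
Context {R : realType}.
Implicit Types (w : nat -> R) (L : seq nat) (y : R).

Definition unpicked_mass w L n : R := \sum_(l < n | (l : nat) \notin L) w l.

Definition left_mass w L : R := 1 - \sum_(l <- L) w l.

(** Inversion: the point [y] of the unit interval, stretched to the mass that is
    not yet picked, falls into the piece of index [j].  Minimality in the second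
    clause makes [j] unique for arbitrary real weights, so that the choice is a
    measurable function of them. *)
Definition hits w L y j : Prop :=
  (unpicked_mass w L j <= y * left_mass w L < unpicked_mass w L j.+1) /\
  forall i, (i < j)%N -> ~ (unpicked_mass w L i <= y * left_mass w L < unpicked_mass w L i.+1).

Definition choose w L y : nat := xget 0%N [set j | hits w L y j].

Lemma hits_inj w L y i j : hits w L y i -> hits w L y j -> i = j.
Proof.
by move=> [hi i0] [hj j0]; case: (ltngtP i j) => // [/j0|/i0].
Qed.

Lemma chooseP w L y j :
  choose w L y = j <-> hits w L y j \/ (j = 0%N /\ forall k, ~ hits w L y k).
Proof.
rewrite /choose; case: xgetP => [i -> hi|h]; split.
- by move=> <-; left.
- by move=> [/(hits_inj hi)//|[-> /(_ _ hi)]].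
- by move=> <-; right; split=> // k; exact: h.
- by move=> [/h|[->]].
Qed.

Lemma unpicked_massS w L n : unpicked_mass w L n.+1 = unpicked_mass w L n + (if n \in L then 0 else w n).
Proof.
rewrite /unpicked_mass big_mkcond big_ord_recr/= -big_mkcond/=.
by case: (n \in L).
Qed.

Lemma unpicked_mass_le w L m n : (forall i, 0 <= w i) -> (m <= n)%N -> unpicked_mass w L m <= unpicked_mass w L n.
Proof.
move=> w0; elim: n => [|n IH]; first by rewrite leqn0 => /eqP ->.
rewrite leq_eqVlt => /predU1P[->//|]; rewrite ltnS => /IH h.
by rewrite (le_trans h)// unpicked_massS lerDl; case: ifP.
Qed.

Lemma hitsE w L y j : (forall i, 0 <= w i) ->
  hits w L y j <-> unpicked_mass w L j <= y * left_mass w L < unpicked_mass w L j.+1.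
Proof.
move=> w0; split=> [[]//|h]; split => // i ij /andP[_ h2].
case/andP: h => h1 _; have := lt_le_trans h2 (unpicked_mass_le L w0 ij).
by rewrite ltNge h1.
Qed.

Lemma unpicked_mass_sum w L n : uniq L -> {in L, forall l, (l < n)%N} ->
  unpicked_mass w L n = \sum_(i < n) w i - \sum_(l <- L) w l.
Proof.
move=> uL Ln; apply/eqP; rewrite eq_sym subr_eq eq_sym; apply/eqP.
rewrite [RHS](bigID (fun i : 'I_n => (i : nat) \in L))/= addrC; congr (_ + _).
rewrite -(big_mkord (mem L) w) -[RHS]big_filter; apply: perm_big.
apply: uniq_perm => //; first by rewrite filter_uniq// iota_uniq.
move=> l; rewrite mem_filter mem_index_iota/= andb_idr//.
exact: Ln.
Qed.

Let bound L := (\max_(l <- L) l).+1.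

Let boundP L : {in L, forall l, (l < bound L)%N}.
Proof. by move=> l lL; rewrite ltnS; exact: leq_bigmax_seq. Qed.

Section positive_weights.
Variable w : nat -> R.
Hypothesis w0 : forall i, 0 < w i.
Hypothesis wle1 : forall n, \sum_(i < n) w i <= 1.
Hypothesis wcvg : forall e, 0 < e -> exists n, 1 - \sum_(i < n) w i < e.

Let w_ge0 i : 0 <= w i. Proof. exact: ltW. Qed.

Lemma left_mass_gt0 L : uniq L -> 0 < left_mass w L.
Proof.
move=> uL; have h := unpicked_mass_sum w uL (@boundP L).
have hb := unpicked_mass_le L w_ge0 (leqnSn (bound L)).
have bL : bound L \notin L by apply/negP => /boundP; rewrite ltnn.
rewrite /left_mass subr_gt0.
have S1 := wle1 (bound L).+1; rewrite big_ord_recr/= in S1.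
have c0 : 0 <= unpicked_mass w L (bound L) by rewrite sumr_ge0.
rewrite h subr_ge0 in c0; apply: (le_lt_trans c0); apply: lt_le_trans S1.
by rewrite ltrDl.
Qed.

Lemma unpicked_mass_le_left L n : uniq L -> unpicked_mass w L n <= left_mass w L.
Proof.
move=> uL; have nb : (n <= maxn n (bound L))%N by exact: leq_maxl.
apply: le_trans (unpicked_mass_le L w_ge0 nb) _.
rewrite unpicked_mass_sum//; last by move=> l /boundP lb; rewrite leq_max lb orbT.
by rewrite lerD2r.
Qed.

(** As [y] < 1 and the total mass is 1, the pieces eventually exceed the
    stretched point; the first index where they do is hit. *)
Lemma choose_hits L y : uniq L -> 0 <= y < 1 -> hits w L y (choose w L y).
Proof.
move=> uL /andP[y0 y1]; have r0 := left_mass_gt0 uL.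
have [n hn] : exists n, y * left_mass w L < unpicked_mass w L n.
  have e0 : 0 < (1 - y) * left_mass w L by rewrite mulr_gt0// subr_gt0.
  have [n hn] := wcvg e0; exists (maxn n (bound L)).
  have hm : 1 - \sum_(i < maxn n (bound L)) w i < (1 - y) * left_mass w L.
    apply: le_lt_trans hn; rewrite lerD2l lerN2.
    rewrite -!(big_mkord predT w) [leRHS](big_cat_nat (n := n))//= ?leq_maxl//.
    by rewrite lerDl sumr_ge0.
  rewrite unpicked_mass_sum//; last by move=> l /boundP lb; rewrite leq_max lb orbT.
  move: hm; rewrite mulrBl mul1r /left_mass; set a := \sum_(i < _) _.
  by set b := \sum_(l <- L) _; lra.
have hex : exists n, y * left_mass w L < unpicked_mass w L n by exists n.
case: (ex_minnP hex) => -[|m] hm mmin.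
  by move: hm; rewrite /unpicked_mass big_ord0 ltNge mulr_ge0// ltW.
have hmm : hits w L y m.
  apply/hitsE => //; rewrite hm andbT leNgt; apply/negP => /mmin.
  by rewrite ltnn.
by have /chooseP -> : hits w L y m \/ (m = 0%N /\ forall k, ~ hits w L y k) by left.
Qed.

(** The piece of an index in [L] is empty. *)
Lemma choose_notin L y : uniq L -> 0 <= y < 1 -> choose w L y \notin L.
Proof.
move=> uL y01; have [/andP[h1 h2] _] := choose_hits uL y01.
apply/negP => cL; move: h2; rewrite unpicked_massS cL addr0 => h2.
by have := le_lt_trans h1 h2; rewrite ltxx.
Qed.

Lemma chooseE L y j : uniq L -> 0 <= y < 1 -> choose w L y = j <->
  unpicked_mass w L j / left_mass w L <= y < unpicked_mass w L j.+1 / left_mass w L.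
Proof.
move=> uL y01; have r0 := left_mass_gt0 uL.
rewrite ler_pdivrMr// ltr_pdivlMr// -hitsE//; split => [<-|h].
  exact: choose_hits.
exact: hits_inj (choose_hits uL y01) h.
Qed.

End positive_weights.
End choice_of_a_stick.

Section sequential_sampling.
Local Open Scope ereal_scope.
Context {R : realType} (theta : R).

(** The coordinates of even index break the stick; those of odd index are turned
    by [unif] into the uniform variables of the picks. *)
Definition even_sticks (x : seqR R) : seqR R := stick (fun i => x i.*2).

Definition noise n (x : seqR R) : R := unif theta (x n.*2.+1).

Fixpoint picked_indices n (x : seqR R) : seq nat :=
  if n is n'.+1 then
    rcons (picked_indices n' x)
      (choose (even_sticks x) (picked_indices n' x) (noise n' x))
  else [::].

Definition picked_index n x :=
  choose (even_sticks x) (picked_indices n x) (noise n x).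

Definition picked_stick n (x : seqR R) : R := even_sticks x (picked_index n x).

Lemma picked_indicesE n x :
  picked_indices n x = [seq picked_index i x | i <- iota 0 n].
Proof.
by elim: n => // n IH; rewrite -addn1 iotaD map_cat -IH addn1/= cats1.
Qed.

Lemma measurable_even_sticks : measurable_fun setT even_sticks.
Proof.
have mr : measurable_fun setT (fun x : seqR R => (fun i => x i.*2) : seqR R).
  by apply: measurable_seqP => i; exact: measurable_coord.
exact: (measurableT_comp measurable_stick mr).
Qed.

Lemma measurable_even_stick j : measurable_fun setT (fun x => even_sticks x j).
Proof. exact: (measurableT_comp (@measurable_coord R j) measurable_even_sticks). Qed.

Lemma measurable_noise n : measurable_fun setT (noise n).
Proof. exact: (measurableT_comp (measurable_unif theta) (@measurable_coord R _)). Qed.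

Let measurable_hits n L j :
  measurable [set x | hits (even_sticks x) L (noise n x) j].
Proof.
have mc k : measurable_fun setT (fun x => unpicked_mass (even_sticks x) L k).
  have -> : (fun x => unpicked_mass (even_sticks x) L k) = (fun x : seqR R =>
      \sum_(l < k) if (l : nat) \notin L then even_sticks x l else 0)%R.
    by apply/funext => x; rewrite /unpicked_mass big_mkcond.
  apply: measurable_sum => i; case: (_ \notin L); last exact: measurable_cst.
  exact: measurable_even_stick.
have ml : measurable_fun setT (fun x => noise n x * left_mass (even_sticks x) L)%R.
  apply: measurable_funM; first exact: measurable_noise.
  apply: measurable_funB => //; apply: measurable_sum => i.
  exact: measurable_even_stick.
have mb k : measurable [set x | (unpicked_mass (even_sticks x) L k <=
    noise n x * left_mass (even_sticks x) L < unpicked_mass (even_sticks x) L k.+1)%R].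
  rewrite -[X in measurable X]setTI; apply: measurable_and => //.
    exact: measurable_fun_ler.
  exact: measurable_fun_ltr.
rewrite (_ : [set x | _] = [set x | (unpicked_mass (even_sticks x) L j <=
    noise n x * left_mass (even_sticks x) L < unpicked_mass (even_sticks x) L j.+1)%R] `&`
  \bigcap_(k in `I_j) ~` [set x | (unpicked_mass (even_sticks x) L k <=
    noise n x * left_mass (even_sticks x) L < unpicked_mass (even_sticks x) L k.+1)%R]).
  apply: measurableI => //; apply: fin_bigcap_measurable => // k _.
  exact: measurableC.
by apply/seteqP; split => x [h1 h2]; split.
Qed.

Let measurable_choose n L j :
  measurable [set x | choose (even_sticks x) L (noise n x) = j].
Proof.
have -> : [set x | choose (even_sticks x) L (noise n x) = j] =
    [set x | hits (even_sticks x) L (noise n x) j] `|`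
    (if j == 0%N then ~` \bigcup_k [set x | hits (even_sticks x) L (noise n x) k]
     else set0).
  apply/seteqP; split => x /=.
    move/chooseP => [|[-> h]]; first by left.
    by right => /= -[k _]; exact: h.
  case: eqP => [->|_] [h|h] //; apply/chooseP; [by left| |by left].
  by right; split => // k hk; apply: h; exists k.
apply: measurableU => //; case: ifP => _ //; apply: measurableC.
exact: bigcupT_measurable.
Qed.

Let measurable_picked_indices n L : measurable [set x | picked_indices n x = L].
Proof.
elim: n L => [|n IH] L.
  have [->|L0] := eqVneq L [::]; first by rewrite (_ : [set _ | _] = setT)//; apply/seteqP.
  by rewrite (_ : [set _ | _] = set0)//; apply/seteqP; split => x //= /esym/eqP; rewrite (negbTE L0).
apply: (@measurable_discrete_comp _ (seqR R) (seq nat) (picked_indices n)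
  (fun L0 => [set x | rcons L0 (choose (even_sticks x) L0 (noise n x)) = L])) => // L0.
case/lastP: L => [|L j].
  by rewrite (_ : [set _ | _] = set0)//; apply/seteqP; split => x //=; case: L0.
have [<-|L0L] := eqVneq L0 L.
  rewrite (_ : [set _ | _] = [set x | choose (even_sticks x) L0 (noise n x) = j])//.
  by apply/seteqP; split => x /=; [move/rcons_inj => []|move=> ->].
rewrite (_ : [set _ | _] = set0)//; apply/seteqP; split => x //=.
by move/rcons_inj => [/eqP]; rewrite (negbTE L0L).
Qed.

Let measurable_picked_index n j : measurable [set x | picked_index n x = j].
Proof.
exact: (@measurable_discrete_comp _ (seqR R) (seq nat) (picked_indices n)
  (fun L => [set x | choose (even_sticks x) L (noise n x) = j])).
Qed.

Lemma measurable_picked_stick n : measurable_fun setT (picked_stick n).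
Proof.
move=> _ B mB; rewrite setTI.
apply: (@measurable_discrete_comp _ (seqR R) nat (picked_index n)
  (fun j => [set x | B (even_sticks x j)])) => // j.
exact: (measurable_preimage (measurable_even_stick j) mB).
Qed.

(** Changing the coordinate [n.*2.+1] affects neither the sticks nor the picks
    before [n]: this and the next three lemmas express that the noise of a pick is
    independent of its past. *)
Lemma even_sticks_upd n x s : even_sticks (update n.*2.+1 x s) = even_sticks x.
Proof.
rewrite /even_sticks; congr stick; apply/funext => i; rewrite /update.
by case: eqP => // e; move: (odd_double i); rewrite e/= odd_double.
Qed.

Lemma noise_upd n i x s : i != n -> noise i (update n.*2.+1 x s) = noise i x.
Proof.
move=> ni; rewrite /noise /update eqSS; case: eqP => // /double_inj e.
by rewrite e eqxx in ni.
Qed.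

Lemma picked_indices_upd n i x s : (i <= n)%N ->
  picked_indices i (update n.*2.+1 x s) = picked_indices i x.
Proof.
elim: i => // i IH ni /=; rewrite even_sticks_upd IH ?(ltnW ni)//.
by rewrite noise_upd// ltn_eqF.
Qed.

Lemma picked_stick_upd n i x s : (i < n)%N ->
  picked_stick i (update n.*2.+1 x s) = picked_stick i x.
Proof.
move=> ni; rewrite /picked_stick /picked_index even_sticks_upd.
by rewrite picked_indices_upd ?(ltnW ni)// noise_upd// ltn_eqF.
Qed.

(** Almost every sequence satisfies this, and for such a sequence the picks are
    given by the intervals in [chooseE] and never repeat. *)
Definition typical (x : seqR R) : Prop :=
  [/\ forall i, (0 < x i < 1)%R,
      forall e, (0 < e)%R -> exists n, (rest (fun i => x i.*2) n < e)%R
    & injective (even_sticks x)].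

Hypothesis theta0 : (0 < theta)%R.

Section typical.
Variable x : seqR R.
Hypothesis xT : typical x.

Let x01 i : (0 < x i < 1)%R. Proof. by case: xT. Qed.
Let noise01 n : (0 <= noise n x < 1)%R. Proof. exact: unif_itv. Qed.

Lemma even_sticks_gt0 i : (0 < even_sticks x i)%R.
Proof. by apply: stick_gt0 => k; exact: x01. Qed.

Lemma even_sticks_psum_le1 n : (\sum_(i < n) even_sticks x i <= 1)%R.
Proof. by apply: psum_stick_le1 => k; exact: x01. Qed.

Lemma even_sticks_cvg e : (0 < e)%R ->
  exists n, (1 - \sum_(i < n) even_sticks x i < e)%R.
Proof.
by case: xT => _ h _ /h [n hn]; exists n; rewrite rest_stick.
Qed.

Let pos := even_sticks_gt0.
Let le1 := even_sticks_psum_le1.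
Let lim := even_sticks_cvg.

Lemma picked_indices_uniq n : uniq (picked_indices n x).
Proof.
elim: n => // n IH; rewrite rcons_uniq IH andbT.
exact: (choose_notin pos le1 lim IH (noise01 n)).
Qed.

Lemma picked_index_inj : injective (picked_index ^~ x).
Proof.
move=> i j; wlog: i j / (i <= j)%N => [H|ij].
  by case: (leqP i j) => [/H//|/ltnW/H h /esym/h].
rewrite leq_eqVlt in ij; case/predU1P: ij => // ij e.
have := choose_notin pos le1 lim (picked_indices_uniq j) (noise01 j).
have ij' : picked_index i x \in picked_indices j x.
  by rewrite picked_indicesE; apply/mapP; exists i => //; rewrite mem_iota add0n.
by rewrite -/(picked_index j x) -e ij'.
Qed.

Lemma sum_picked n : (\sum_(l <- picked_indices n x) even_sticks x l =
  \sum_(i < n) picked_stick i x)%R.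
Proof.
rewrite picked_indicesE big_map -(big_mkord predT (fun i => picked_stick i x)).
by rewrite /index_iota subn0.
Qed.

(** By [chooseE], the noise leading to the stick [j] runs over an interval whose
    length is the step of [unpicked_mass] at [j] over the mass that is left: 0 for a stick
    already picked, and its weight over the mass left otherwise. *)
Lemma pick_probability (beta : probability R R) Z n j : (0 <= Z)%R ->
  (forall A, measurable A ->
     beta A = \int[@lebesgue_measure R]_(s in A) (be1_density theta Z s)%:E) ->
  beta [set s | picked_stick n (update n.*2.+1 x s) = even_sticks x j] =
  (even_sticks x j / (1 - \sum_(i < n) picked_stick i x) *
   \1_(~` [set picked_stick i x | i in `I_n]) (even_sticks x j))%:E.
Proof.
move=> Z0 betaE; set w := even_sticks x; set L := picked_indices n x.
have uL : uniq L := picked_indices_uniq n.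
have r0 : (0 < left_mass w L)%R by exact: (left_mass_gt0 pos le1 uL).
have xI : injective w by case: xT.
have mU : measurable_fun setT (update n.*2.+1 x : R -> seqR R).
  apply: measurable_seqP => i; rewrite /update; case: eqP => _.
    exact: measurable_id.
  exact: measurable_cst.
set D := [set s | _].
have mD : measurable D.
  have -> : D = [set s | picked_stick n (update n.*2.+1 x s) == w j].
    by apply/seteqP; split => s /eqP.
  rewrite -[X in measurable X]setTI; apply: measurable_fun_eqr => //.
  exact: (measurableT_comp (measurable_picked_stick n) mU).
have b01 := be1_unit_mass betaE.
have bD : beta D = beta (D `&` `]0%R, 1%R[%classic).
  have mC : measurable (~` `]0%R, 1%R[%classic : set R) by exact: measurableC.
  have bD0 : beta (D `\` `]0%R, 1%R[%classic) = 0.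
    apply: (@subset_measure0 _ _ _ beta _ (~` `]0%R, 1%R[%classic)) => //.
      exact: measurableD.
    by rewrite [LHS]probability_setC// [X in 1 - X]b01 subee.
  rewrite [LHS](measureDI beta mD (measurable_itv `]0%R, 1%R[)).
  by rewrite [X in X + _]bD0 add0e.
pose a := (unpicked_mass w L j / left_mass w L)%R; pose b := (unpicked_mass w L j.+1 / left_mass w L)%R.
have -> : beta D = (b - a)%:E.
  rewrite bD -(@beta_unif_itv _ _ _ _ theta0 Z0 betaE a b).
  - congr (beta _); apply/seteqP; split => s.
      move=> [sD]; rewrite /= in_itv/= => s01; rewrite s01/=.
      have u01 := unif_itv theta0 s01.
      have [h _] := chooseE pos le1 lim j uL u01; apply/h/xI; rewrite -[RHS]sD.
      rewrite /picked_stick /picked_index even_sticks_upd picked_indices_upd//.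
      by rewrite /noise /update eqxx.
    move=> /= /andP[s01 sab]; split; last by rewrite /= in_itv.
    rewrite /D/= /picked_stick /picked_index even_sticks_upd picked_indices_upd//.
    rewrite /noise /update eqxx; congr (w _).
    have [_ h] := chooseE pos le1 lim j uL (unif_itv theta0 s01).
    exact: h.
  - by rewrite divr_ge0 ?(ltW r0)// sumr_ge0// => i _; rewrite ltW// pos.
  - rewrite ler_pM2r ?invr_gt0// unpicked_mass_le//=; last by move=> i; rewrite ltW// pos.
    by rewrite ler_pdivrMr// mul1r unpicked_mass_le_left.
congr (_%:E); rewrite /b /a -mulrBl unpicked_massS addrAC subrr add0r.
rewrite -sum_picked -/(left_mass w L) indicE.
have -> : (w j \in ~` [set picked_stick i x | i in `I_n]) = (j \notin L).
  rewrite /L picked_indicesE; apply/idP/idP => [/set_mem/= h|jL].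
    apply: contra_notN h => /mapP[i]; rewrite mem_iota add0n => /andP[_ ni] ->.
    by exists i.
  apply/mem_set => -[i /= ni /xI ij]; move/negP: jL; apply.
  by apply/mapP; exists i => //; rewrite mem_iota add0n.
by case: (j \in L); rewrite ?mul0r ?mulr0 ?mulr1.
Qed.

End typical.
End sequential_sampling.

Section existence.
Local Open Scope ereal_scope.
Context {R : realType} d (T : measurableType d) (P : probability T R).
Variables (v : nat -> {RV P >-> R}) (beta : probability R R) (theta Z : R).
Hypothesis theta0 : (0 < theta)%R.
Hypothesis v_iid : iid v beta.
Hypothesis Z0 : (0 <= Z)%R.
Hypothesis betaE : forall A, measurable A ->
  beta A = \int[@lebesgue_measure R]_(s in A) (be1_density theta Z s)%:E.

Local Notation X := (seq_of v).

Let beta01 := be1_unit_mass betaE.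
Let beta_atomless := be1_atomless betaE.

Definition even_weights : nat -> {RV P >-> R} := stick_breaking (fun i => v i.*2).

Let measurable_pick_of n : measurable_fun setT (picked_stick theta n \o X).
Proof. exact: (measurableT_comp (measurable_picked_stick theta n) (measurable_seq_of v)). Qed.

Definition sampled_weights (n : nat) : {RV P >-> R} :=
  HB.pack (picked_stick theta n \o X)
    (isMeasurableFun.Build _ _ _ _ _ (measurable_pick_of n)).

Lemma ae_typical : {ae P, forall t, typical (X t)}.
Proof.
have v'_iid := iid_double v_iid.
have h := ae_rest_cvg0 v'_iid beta01.
have hi := ae_stick_inj v'_iid beta01 beta_atomless.
apply: filterS3 h hi (ae_open_unit v_iid beta01) => t tcvg tinj t01.
split => // e e0; move/cvgrPdist_lt : tcvg => /(_ e e0) [n _ /(_ n (leqnn n))].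
move=> /= h; exists n; move: h; rewrite sub0r normrN; apply: le_lt_trans.
exact: ler_norm.
Qed.

Local Notation gens n :=
  (coord_events setT even_weights `|` coord_events `I_n sampled_weights).
Local Notation TG n := (g_sigma_algebraType (gens n)).

(** The events of the past of a pick are insensitive to the noise used by that
    pick.  This class of events is a sigma-algebra, so the generators suffice. *)
Lemma past_events n F : <<s gens n >> F -> exists2 C : set (seqR R),
  measurable C /\ (forall x s, C (update n.*2.+1 x s) <-> C x) & F = X @^-1` C.
Proof.
move: F; apply: smallest_sub; first split.
- exists set0; last by rewrite preimage_set0.
  by split.
- move=> F [C [mC Cu] ->]; exists (~` C); last by rewrite setTD preimage_setC.
  by split=> [|x s]; [exact: measurableC|rewrite /= Cu].
- move=> F /(_ _)/cid2-/all_sig2[C CP CF].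
  exists (\bigcup_k C k); last first.
    by rewrite preimage_bigcup; apply: eq_bigcupr => k _; exact: CF.
  split; first by apply: bigcupT_measurable => k; case: (CP k).
  by move=> x s; split => -[k _ Ck]; exists k => //; case: (CP k) => _ h; apply/(h x s).
- move=> F [] [i /= ni [B mB <-]]; rewrite setTI.
    exists [set x | B (even_sticks x i)] => //; split.
      exact: (measurable_preimage (measurable_even_stick i) mB).
    by move=> x s /=; rewrite even_sticks_upd.
  exists [set x | B (picked_stick theta i x)] => //; split.
    exact: (measurable_preimage (measurable_picked_stick theta i) mB).
  by move=> x s /=; rewrite picked_stick_upd.
Qed.

Let weight n j (x : seqR R) : R :=
  (even_sticks x j / (1 - \sum_(i < n) picked_stick theta i x)
   * \1_(~` [set picked_stick theta i x | i in `I_n]) (even_sticks x j))%R.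

Let gens_measurable n : <<s gens n >> `<=` measurable.
Proof.
apply: smallest_sub; first exact: sigma_algebra_measurable.
by move=> A [] [i _ [B mB <-]]; apply: measurableI => //; exact: measurable_preimage.
Qed.

Let measurable_weightG n j :
  measurable_fun setT ((fun t => (weight n j (X t))%:E) : TG n -> \bar R).
Proof.
have mW i : measurable_fun setT ((fun t => even_sticks (X t) i) : TG n -> R).
  by move=> _ B mB; apply: sub_sigma_algebra; left; exists i => //; exists B.
have mWt i : (i < n)%N ->
    measurable_fun setT ((fun t => picked_stick theta i (X t)) : TG n -> R).
  by move=> ni _ B mB; apply: sub_sigma_algebra; right; exists i => //; exists B.
apply/measurable_EFinP; apply: measurable_funM; last first.
  apply: (@measurable_notin R _ (TG n)
    (fun t => even_sticks (X t) j) (fun i t => picked_stick theta i (X t)) n) => //.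
apply: measurable_fun_div => //; apply: measurable_funB => //.
by apply: measurable_sum => i; exact: mWt.
Qed.

(** Refreshing the noise of the pick leaves a past event unchanged, and the inner
    expectation is then [pick_probability]. *)
Lemma sampled_cond_prob n j : is_cond_prob P <<s gens n >>
  [set t | sampled_weights n t = even_weights j t]
  (fun t => (even_weights j t / (1 - \sum_(i < n) sampled_weights i t)
             * \1_(~` [set sampled_weights i t | i in `I_n]) (even_weights j t))%:E).
Proof.
split=> [B mB|F GF].
  by have := @measurable_weightG n j measurableT _ mB; rewrite setTI.
have [C [mC Cu] FE] := past_events GF.
have mF : measurable F := gens_measurable GF.
pose D := [set x : seqR R | picked_stick theta n x = even_sticks x j].
have mD : measurable D.
  have -> : D = [set x | picked_stick theta n x == even_sticks x j].
    by apply/seteqP; split => x /eqP.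
  rewrite -[X in measurable X]setTI; apply: measurable_fun_eqr => //.
    exact: measurable_picked_stick.
  exact: measurable_even_stick.
pose g (x : seqR R) := (\1_(D `&` C) x)%:E : \bar R.
have mDC : measurable (D `&` C) by exact: measurableI.
have mg : measurable_fun setT g.
  by apply/measurable_EFinP; exact: measurable_indic.
have g0 x : 0 <= g x by rewrite lee_fin.
have -> : P ([set t | sampled_weights n t = even_weights j t] `&` F) =
    \int[P]_t g (X t).
  have mDCX := measurable_preimage (measurable_seq_of v) mDC.
  transitivity (\int[P]_t (\1_(X @^-1` (D `&` C)) t)%:E); last by [].
  by rewrite integral_indic// setIT FE.
rewrite (ge0_integral_upd n.*2.+1 v_iid mg g0).
have mw : measurable_fun setT (fun t => (weight n j (X t))%:E).
  exact: (measurable_fun_coarser (@gens_measurable n) (@measurable_weightG n j)).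
rewrite integral_mkcond; apply: ae_eq_integral => //.
- by apply/(measurable_restrictT _ _).1 => //; exact: measurable_funTS.
- have mgu := measurableT_comp mg (@measurable_upd R n.*2.+1).
  have mg2 := @measurable_fun_fubini_tonelli_F _ _ _ _ _ beta _ mgu (fun z => g0 _).
  exact: (measurableT_comp mg2 (measurable_seq_of v)).
apply: filterS ae_typical => t tT _; rewrite patchE.
have mU : measurable_fun setT (update n.*2.+1 (X t) : R -> seqR R).
  apply: measurable_seqP => i; rewrite /update; case: eqP => _.
    exact: measurable_id.
  exact: measurable_cst.
have [tF|tF] := boolP (t \in F); last first.
  apply/esym/integral0_eq => s _; rewrite /g indicE memNset// => -[_ /Cu tC].
  by move: tF; rewrite FE notin_setE.
have tC : C (X t) by move: (set_mem tF); rewrite FE.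
rewrite -(pick_probability theta0 tT n j Z0 betaE).
have mDU := measurable_preimage mU mD.
transitivity (\int[beta]_s (\1_(update n.*2.+1 (X t) @^-1` D) s)%:E).
  rewrite integral_indic// setIT; congr (beta _).
  by apply/seteqP; split => s /=; rewrite /D/= even_sticks_upd.
apply: eq_integral => s _; rewrite /g !indicE; congr ((nat_of_bool _)%:R%:E).
apply/idP/idP => /set_mem h; apply/mem_set; last by case: h.
by split => //; apply/Cu.
Qed.

Lemma ae_sampled_listing : {ae P, forall t, exists s : nat -> nat,
  injective s /\ forall n, sampled_weights n t = even_weights (s n) t}.
Proof.
apply: filterS ae_typical => t tT; exists (picked_index theta ^~ (X t)).
by split=> //; exact: picked_index_inj.
Qed.

Lemma even_weights_pick n (F : seqR R -> \bar R) : measurable_fun setT F ->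
  (forall x, 0 <= F x <= 1) ->
  \int[P]_t pick n F (seq_of even_weights t) = \int[P]_t F (seq_of even_weights t).
Proof.
exact: (pick_invariant (iid_double v_iid) beta01 beta_atomless Z0 betaE).
Qed.

Lemma ae_even_weights : {ae P, forall t,
  subweights (seq_of even_weights t) /\ injective (seq_of even_weights t)}.
Proof.
apply: filterS ae_typical => t tT; split; last by case: tT.
by split=> [j|N]; [exact: ltW (even_sticks_gt0 tT j)|exact: (even_sticks_psum_le1 tT N)].
Qed.

(** The picked sticks have the law of the sticks by [size_biased_law], and the
    total mass of a sequence is a function of the sequence. *)
Lemma ae_sampled_mass : {ae P, forall t, forall k : nat,
  exists n, (1 - \sum_(i < n) sampled_weights i t < k.+1%:R^-1)%R}.
Proof.
pose A k : set (seqR R) :=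
  \bigcup_n [set x : seqR R | (1 - \sum_(i < n) x i < k.+1%:R^-1)%R].
have mA k : measurable (A k).
  apply: bigcupT_measurable => n; rewrite -[X in measurable X]setTI.
  apply: measurable_fun_ltr => //; apply: measurable_funB => //.
  exact: measurable_psum.
have PA k : P (seq_of sampled_weights @^-1` ~` A k) = 0.
  have mAC : measurable (~` A k) by exact: measurableC.
  rewrite (size_biased_law even_weights_pick ae_even_weights ae_sampled_listing
    sampled_cond_prob mAC).
  apply/negligibleP; first exact: (measurable_preimage (measurable_seq_of _) mAC).
  have : {ae P, forall t, A k (seq_of even_weights t)}.
    apply: filterS ae_typical => t tT.
    have k0 : (0 < k.+1%:R^-1 :> R)%R by rewrite invr_gt0.
    by have [n hn] := even_sticks_cvg tT k0; exists n.
  by [].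
apply: ae_foralln => k; exists (seq_of sampled_weights @^-1` ~` A k); split.
- apply: (measurable_preimage (measurable_seq_of _)).
  exact: measurableC.
- exact: PA.
- by move=> t /= h [n _ hn]; apply: h; exists n.
Qed.

(** A positive stick that is never picked would add its length to the total mass 1
    of the picked ones. *)
Lemma sampled_size_biased : size_biased_permutation even_weights sampled_weights.
Proof.
split; last exact: sampled_cond_prob.
apply: filterS3 ae_typical ae_even_weights ae_sampled_mass => t tT [tW _] tmass.
have sI := picked_index_inj theta0 tT.
exists (picked_index theta ^~ (X t)); split => // j Wj.
apply: contrapT => /forallNP js.
pose s' n := if n is n'.+1 then picked_index theta n' (X t) else j.
have s'I : injective s'.
  move=> [|m] [|n] //= e; first by case: (js n).
    by case: (js m).
  by rewrite (sI _ _ e).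
have [_ le1] := subweights_reindex s'I tW.
have Wj_le k : (even_weights j t <= k.+1%:R^-1)%R.
  have [n hn] := tmass k; apply: le_trans (ltW hn).
  have := le1 n.+1; rewrite big_ord_recl/= => h.
  by rewrite lerBrDr.
have [k _ /(_ k (leqnn k)) hk] := near_infty_natSinv_lt (PosNum Wj).
by have := le_lt_trans (Wj_le k) hk; rewrite ltxx.
Qed.

End existence.


(** * Size-biased order of the sticks *)

Section size_biased_order.
Local Open Scope ereal_scope.
Context {R : realType} d (T : measurableType d) (P : probability T R).
Variables (v : nat -> {RV P >-> R}) (beta : probability R R) (theta Z : R).
Hypothesis theta0 : (0 < theta)%R.
Hypothesis v_iid : iid v beta.
Hypothesis Z0 : (0 <= Z)%R.
Hypothesis betaE : forall A, measurable A ->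
  beta A = \int[@lebesgue_measure R]_(s in A) (be1_density theta Z s)%:E.

Let beta01 := be1_unit_mass betaE.
Let beta_atomless := be1_atomless betaE.
Let W := stick_breaking v.

Let random_weights_sticks : random_weights W.
Proof.
have h := ae_rest_cvg0 v_iid beta01.
have hi := ae_stick_inj v_iid beta01 beta_atomless.
apply: filterS3 h hi (ae_open_unit v_iid beta01) => t tcvg tinj t01.
split => //.
  by move=> j; rewrite ltW//; exact: (@stick_gt0 _ (seq_of v t)).
rewrite (_ : series _ = (fun n => 1 - rest (seq_of v t) n)%R); last first.
  apply/funext => n; rewrite seriesEord -rest_stick subKr.
  by apply: eq_bigr.
rewrite -[X in _ --> X]subr0; apply: cvgB => //; exact: cvg_cst.
Qed.

(* The sequences without repetition, as a countable intersection of measurable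
   events, so that the property passes to another space with the same law. *)
Let weights_event : set (seqR R) :=
  subweights `&` \bigcap_i \bigcap_j [set x | (x i == x j) ==> (i == j)].

Let measurable_weights_event : measurable weights_event.
Proof.
apply: measurableI; first exact: measurable_subweights.
apply: bigcapT_measurable => i; apply: bigcapT_measurable => j.
have [ij|ij] := eqVneq i j.
  rewrite (_ : [set _ | _] = setT)//; apply/seteqP; split => x //= _.
  by rewrite implybT.
rewrite (_ : [set _ | _] = [set x : seqR R | ~~ (x i == x j)]); last first.
  by apply/seteqP; split => x /=; rewrite implybF.
rewrite -[X in measurable X]setTI; apply: measurable_neg => //.
by apply: measurable_fun_eqr; exact: measurable_coord.
Qed.

Let weights_eventE x : weights_event x <-> subweights x /\ injective x.
Proof.
split=> [[xs h]|[xs xI]]; split=> //.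
  by move=> i j ij; apply/eqP; have := h i Logic.I j Logic.I; rewrite /= ij eqxx.
by move=> i _ j _ /=; apply/implyP => /eqP/xI ->.
Qed.

Lemma sticks_size_biased_ordered : size_biased_ordered W.
Proof.
have ae_W : {ae P, forall t, weights_event (seq_of W t)}.
  have hi := ae_stick_inj v_iid beta01 beta_atomless.
  apply: filterS2 hi (ae_open_unit v_iid beta01) => t tinj t01.
  by apply/weights_eventE; split; [exact: (@stick_subweights _ (seq_of v t))|exact: tinj].
split => //.
- exists d, T, P, (even_weights v), (sampled_weights v theta).
  split; last exact: (sampled_size_biased theta0 v_iid Z0 betaE).
  move=> A mA.
  have mv := measurable_seq_of v.
  have mv' := measurable_seq_of (fun i => v i.*2).
  have lawE := eq_law_boxes mv' mv (P1 := P) (P2 := P).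
  have mSA : measurable (stick @^-1` A : set (seqR R)).
    exact: (measurable_preimage measurable_stick mA).
  apply: (lawE _ _ _ mSA); first by rewrite [ltLHS]probability_setT ltry.
  by move=> n B mB; apply: (eq_trans (iid_double v_iid n mB)); rewrite -v_iid.
move=> d' T' P' W' Wt W'law [re cond] A mA.
have W'lawE B : measurable B -> P' (seq_of W' @^-1` B) = P (seq_of W @^-1` B).
  by move=> mB; exact: (W'law B mB).
rewrite -[LHS]/(P (seq_of W @^-1` A)) -[RHS]/(P' (seq_of Wt @^-1` A)).
rewrite -W'lawE//; apply/esym; apply: size_biased_law => //.
- move=> n F mF F01; have F0 x : 0 <= F x by case/andP: (F01 x).
  have mWseq := measurable_seq_of W; have mW'seq := measurable_seq_of W'.
  have e1 := ge0_integral_eq_law mW'seq mWseq W'lawE mF F0.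
  have mp := measurable_pick n mF F0.
  have e2 := ge0_integral_eq_law mW'seq mWseq W'lawE mp (fun x => pick_ge0 n x F0).
  rewrite [LHS]e2 [RHS]e1.
  exact: (pick_invariant v_iid beta01 beta_atomless Z0 betaE).
- have mC : measurable (~` weights_event) by exact: measurableC.
  exists (seq_of W' @^-1` ~` weights_event); split.
  + exact: (measurable_preimage (measurable_seq_of W') mC).
  + rewrite [LHS]W'lawE//; apply/negligibleP; last exact: ae_W.
    exact: (measurable_preimage (measurable_seq_of W) mC).
  + by move=> t /= h /weights_eventE.
- by apply: filterS re => t [s [sI ts _]]; exists s.
Qed.

End size_biased_order.

Lemma chain_size_biased_ordered {R : realType} d (T : measurableType d)
    (P : probability T R) (theta : R) (v : nat -> {RV P >-> R}) :
  0 < theta -> beta_chain 0 1 theta v -> size_biased_ordered (stick_breaking v).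
Proof.
move=> theta0 vc; have [_ v0 _] := vc.
apply: (sticks_size_biased_ordered theta0 (chain_iid vc) (be_fun_ge0 1 theta)).
by move=> A mA; apply: (eq_trans (v0 A mA)); rewrite be_pdf1E.
Qed.


(** * Moments of the binomial distribution *)

Section binomial_moments.
Context {R : realType} (p : R).

Let mean k (f : nat -> R) : R := \sum_(x < k.+1) binomial_pmf k p x * f x.

(* First-step decomposition: a binomial variable with k + 1 trials is one with k
   trials, increased by 1 with probability p. *)
Let pascal k f : mean k.+1 f = p * mean k (fun x => f x.+1) + (1 - p) * mean k f.
Proof.
have pmfS x : (x <= k)%N -> binomial_pmf k.+1 p x.+1 =
    p * binomial_pmf k p x + (1 - p) * binomial_pmf k p x.+1.
  move=> xk; rewrite /binomial_pmf /unstable.onem binS mulrnDr addrC subSS exprS.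
  congr (_ + _); first by rewrite !mulrnAr mulrA.
  move: xk; rewrite leq_eqVlt => /predU1P[->|xk].
    by rewrite bin_small// !mulr0n mulr0.
  by rewrite !mulrnAr -(subnSK xk) !exprS; congr (_ *+ _); ring.
have pmf0 : binomial_pmf k.+1 p 0 = (1 - p) * binomial_pmf k p 0.
  by rewrite /binomial_pmf !bin0 !expr0 !mul1r !subn0 !mulr1n exprS.
rewrite /mean big_ord_recl/= pmf0.
rewrite (eq_bigr (fun i : 'I_k.+1 => p * binomial_pmf k p i * f i.+1 +
    (1 - p) * binomial_pmf k p i.+1 * f i.+1)); last first.
  move=> i _; rewrite /bump/= add1n pmfS; last by rewrite -ltnS.
  by rewrite mulrDl.
rewrite big_split/= addrCA; congr (_ + _).
  by rewrite mulr_sumr; apply: eq_bigr => i _; rewrite mulrA.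
rewrite mulr_sumr [RHS]big_ord_recl/= mulrA; congr (_ + _).
rewrite big_ord_recr/= [X in _ + X * _](_ : _ = 0); last first.
  by rewrite /binomial_pmf bin_small// mulr0n mulr0.
by rewrite mul0r addr0; apply: eq_bigr => i _; rewrite /bump/= add1n mulrA.
Qed.

Lemma sum_binomial_pmf k : \sum_(x < k.+1) binomial_pmf k p x = 1.
Proof.
have -> : \sum_(x < k.+1) binomial_pmf k p x = mean k (fun=> 1).
  by apply: eq_bigr => i _; rewrite mulr1.
elim: k => [|k IH].
  by rewrite /mean big_ord1 /binomial_pmf !expr0 bin0 mulr1 mulr1n mulr1.
by rewrite pascal !IH !mulr1 subrKC.
Qed.

Lemma binomial_variance k :
  \sum_(x < k.+1) binomial_pmf k p x * (x%:R - k%:R * p) ^+ 2 = k%:R * p * (1 - p).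
Proof.
(* the induction needs the second moment around every point [t], since a success
   shifts the centre *)
suff H t : mean k (fun x => (x%:R - t) ^+ 2) =
    k%:R * p * (1 - p) + (k%:R * p - t) ^+ 2.
  by rewrite [LHS]H subrr expr0n addr0.
elim: k t => [|k IH] t.
  by rewrite /mean big_ord1/= /binomial_pmf bin0 mulr1n subn0 !expr0; ring.
rewrite pascal IH; have -> : mean k (fun x => (x.+1%:R - t) ^+ 2) =
    mean k (fun x => (x%:R - (t - 1)) ^+ 2).
  by apply: eq_bigr => x _; rewrite -natr1; congr (_ * _ ^+ 2); ring.
by rewrite IH -natr1; ring.
Qed.

End binomial_moments.


(** * The beta-binomial mixture *)

Section beta_binomial.
Local Open Scope ereal_scope.
Context {R : realType}.
Local Notation mu := (@lebesgue_measure R).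
Variables (alpha theta : R) (beta : probability R R) (kappa : nat).
Hypothesis betaE : forall A, measurable A ->
  beta A = \int[mu]_(s in A) (be_pdf alpha theta s)%:E.

Definition posterior_density (x : nat) (s : R) : R :=
  be_pdf (alpha + x%:R) (theta + kappa%:R - x%:R) s.

Definition monomial (x : nat) (s : R) : R :=
  if (0 <= s <= 1)%R then (s ^+ x * (1 - s) ^+ (kappa - x))%R else 0%R.

(** Cut off outside of the unit interval, where the mass function may be
    negative. *)
Definition binomial_mass (x : nat) (s : R) : R :=
  if (0 <= s <= 1)%R then binomial_pmf kappa s x else 0%R.

Lemma binomial_massE x s : binomial_mass x s = (monomial x s *+ 'C(kappa, x))%R.
Proof. by rewrite /binomial_mass /monomial; case: ifP => //; rewrite mul0rn. Qed.

Lemma monomial_ge0 x s : (0 <= monomial x s)%R.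
Proof.
rewrite /monomial; case: ifP => // /andP[s0 s1].
by rewrite mulr_ge0// exprn_ge0// subr_ge0.
Qed.

Lemma monomial_le1 x s : (monomial x s <= 1)%R.
Proof.
rewrite /monomial; case: ifP => // /andP[s0 s1].
by rewrite mulr_ile1 ?exprn_ge0 ?exprn_ile1 ?subr_ge0// lerBlDr lerDl.
Qed.

Lemma binomial_mass_ge0 x s : (0 <= binomial_mass x s)%R.
Proof. by rewrite binomial_massE mulrn_wge0// monomial_ge0. Qed.

Lemma measurable_monomial x : measurable_fun [set: R] (monomial x).
Proof.
apply: measurable_fun_ifT => //.
  by apply: measurable_and; exact: measurable_fun_ler.
apply: measurable_funM; first exact: exprn_measurable.
by apply: measurable_funX; exact: measurable_funB.
Qed.

Lemma measurable_binomial_mass x : measurable_fun [set: R] (binomial_mass x).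
Proof.
apply: measurable_fun_ifT => //.
  by apply: measurable_and; exact: measurable_fun_ler.
exact: measurable_binomial_pmf.
Qed.

Let mpdf := measurable_be_pdf alpha theta.

Let mpdfE : measurable_fun [set: R] (fun s : R => (be_pdf alpha theta s)%:E).
Proof. exact/measurable_EFinP. Qed.

Lemma beta_integral (h : R -> \bar R) : measurable_fun setT h -> (forall s, 0 <= h s) ->
  \int[beta]_s h s = \int[mu]_s (h s * (be_pdf alpha theta s)%:E).
Proof. exact: ge0_integral_lebesgue_density mpdf (be_pdf_ge0 _ _) betaE. Qed.

(** Division by 0 gives 0, so a vanishing normalization would make the density, and
    the total mass, vanish. *)
Lemma be_fun_gt0 : (0 < be_fun alpha theta)%R.
Proof.
rewrite lt_neqAle be_fun_ge0 andbT; apply/eqP => be0.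
have := betaE measurableT; rewrite [X in X = _]probability_setT integral0_eq.
  by move=> /eqP; rewrite onee_eq0.
by move=> s _; rewrite be_pdfE -be0 invr0 mulr0; case: ifP.
Qed.

Lemma beta_unit_itv : beta `]0%R, 1%R[%classic = 1.
Proof.
apply: (density_open_unit_mass _ betaE) => s s01.
by rewrite be_pdfE (negbTE s01).
Qed.

Lemma beta_no_atom s : beta [set s] = 0.
Proof. exact: density_atomless betaE. Qed.

Definition mean_monomial x : R := fine (\int[beta]_s (monomial x s)%:E).

Let mmono x : measurable_fun [set: R] (fun s => (monomial x s)%:E).
Proof. by apply/measurable_EFinP; exact: measurable_monomial. Qed.

Lemma mean_monomialE x : \int[beta]_s (monomial x s)%:E = (mean_monomial x)%:E.
Proof.
rewrite fineK// ge0_fin_numE; last by apply: integral_ge0 => s _; rewrite lee_fin monomial_ge0.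
apply: (@le_lt_trans _ _ (\int[beta]_s (cst 1 s))); last first.
  by rewrite integral_cst// mul1e [ltLHS]probability_setT ltry.
apply: ge0_le_integral => //; last by move=> s _; rewrite lee_fin monomial_le1.
by move=> s _; rewrite lee_fin monomial_ge0.
Qed.

Lemma mean_monomial_gt0 x : (0 < mean_monomial x)%R.
Proof.
rewrite lt_neqAle -lee_fin -mean_monomialE integral_ge0 ?andbT; last first.
  by move=> s _; rewrite lee_fin monomial_ge0.
apply/eqP => m0; have : \int[beta]_s `|(monomial x s)%:E| = 0.
  by under eq_integral do rewrite gee0_abs ?lee_fin ?monomial_ge0//; rewrite mean_monomialE -m0.
move=> /(ae_eq_integral_abs beta measurableT (mmono x)).1 [N [mN N0 sN]].
have : beta `]0%R, 1%R[%classic <= beta N.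
  apply: le_measure; rewrite ?inE// => s /=; rewrite in_itv/= => s01; apply: sN => /=.
  move=> /(_ Logic.I) [] /eqP; rewrite /monomial; case/andP: s01 => s0 s1.
  by rewrite !ltW//= mulf_eq0 !expf_eq0 !gt_eqF ?subr_gt0// !andbF.
by rewrite [X in _ <= X]N0 [X in X <= _]beta_unit_itv lee_fin ler10.
Qed.

Let pow_shift x s : (x <= kappa)%N -> (0 < s < 1)%R ->
  (s `^ (alpha + x%:R - 1) * (1 - s) `^ (theta + kappa%:R - x%:R - 1) =
   monomial x s * (s `^ (alpha - 1) * (1 - s) `^ (theta - 1)))%R.
Proof.
move=> xk /andP[s0 s1]; have os : (0 < 1 - s)%R by rewrite subr_gt0.
rewrite /monomial !ltW//=.
rewrite (_ : alpha + x%:R - 1 = alpha - 1 + x%:R)%R; last by rewrite addrAC.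
rewrite (_ : theta + kappa%:R - x%:R - 1 = theta - 1 + (kappa - x)%:R)%R; last first.
  by rewrite natrB//; ring.
rewrite (@powRD _ s); last by rewrite (gt_eqF s0) implybT.
rewrite (@powRD _ (1 - s)); last by rewrite (gt_eqF os) implybT.
rewrite !powR_mulrn ?(ltW s0) ?(ltW os)//; ring.
Qed.

(** Multiplying the kernel of Be(alpha, theta) by s^x (1 - s)^(kappa - x) shifts its
    parameters. *)
Lemma be_fun_shift x : (x <= kappa)%N ->
  be_fun (alpha + x%:R) (theta + kappa%:R - x%:R) =
  (be_fun alpha theta * mean_monomial x)%R.
Proof.
move=> xk; rewrite {1}/be_fun /Rintegral.
suff -> : \int[mu]_(s in `]0%R, 1%R[) ((s `^ (alpha + x%:R - 1) *
      (1 - s) `^ (theta + kappa%:R - x%:R - 1))%R)%:E =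
    (be_fun alpha theta * mean_monomial x)%:E by [].
have b0 := be_fun_gt0.
rewrite EFinM -mean_monomialE beta_integral//; last first.
  by move=> s; rewrite lee_fin monomial_ge0.
rewrite -ge0_integralZl_EFin//; last 3 first.
- by move=> s _; rewrite -EFinM lee_fin mulr_ge0 ?monomial_ge0 ?be_pdf_ge0.
- apply: emeasurable_funM; first exact: mmono.
  exact: mpdfE.
- exact: ltW.
rewrite [LHS]integral_mkcond; apply: eq_integral => s _.
rewrite patchE be_pdfE -!EFinM.
have -> : (s \in `]0%R, 1%R[%classic) = (0 < s < 1)%R.
  by apply/idP/idP => [/set_mem|h]; [|apply/mem_set]; rewrite /= in_itv.
case: ifPn => s01; last by rewrite !mulr0.
by rewrite pow_shift//; congr (_%:E); field; rewrite gt_eqF.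
Qed.

(** The probability of [x] for the beta-binomial law, by [integral_binomial_mass]. *)
Definition count_mass x : R := (mean_monomial x *+ 'C(kappa, x))%R.

Lemma integral_binomial_mass x : \int[beta]_s (binomial_mass x s)%:E = (count_mass x)%:E.
Proof.
under eq_integral do rewrite binomial_massE -mulr_natl EFinM.
rewrite ge0_integralZl_EFin//.
- by rewrite mean_monomialE -EFinM mulr_natl.
- by move=> s _; rewrite lee_fin monomial_ge0.
Qed.

(** Bayes' formula: both sides are the joint density of (X, S), where S has law
    Be(alpha, theta) and X has law Bin(kappa, S) given S. *)
Lemma joint_density x s : (x <= kappa)%N ->
  (posterior_density x s * count_mass x = binomial_mass x s * be_pdf alpha theta s)%R.
Proof.
move=> xk; rewrite /posterior_density /count_mass !be_pdfE binomial_massE be_fun_shift//.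
case: ifPn => s01; last by rewrite mul0r mulr0.
rewrite pow_shift//; have b0 := be_fun_gt0; have m0 := mean_monomial_gt0 x.
rewrite [LHS]mulrnAr [RHS]mulrnAl; congr (_ *+ _)%R.
move: (be_fun _ _) (mean_monomial x) b0 m0 => z m z0 m0.
move: (monomial x s) (_ * _ `^ _)%R => f u.
by field; rewrite !gt_eqF.
Qed.

Let mdx x : measurable_fun setT (fun s => (posterior_density x s)%:E).
Proof. by apply/measurable_EFinP; exact: measurable_be_pdf. Qed.

Let dx0 x s : 0 <= (posterior_density x s)%:E.
Proof. by rewrite lee_fin be_pdf_ge0. Qed.

Definition posterior x (A : set R) : \bar R := \int[mu]_(s in A) (posterior_density x s)%:E.

Lemma posterior_ge0 x A : 0 <= posterior x A.
Proof. by apply: integral_ge0 => s _; exact: dx0. Qed.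

Lemma posterior_count_mass x A : (x <= kappa)%N -> measurable A ->
  posterior x A * (count_mass x)%:E = \int[beta]_(s in A) (binomial_mass x s)%:E.
Proof.
move=> xk mA; rewrite /posterior muleC -ge0_integralZl_EFin//; last 2 first.
- exact: (measurable_funTS (mdx x)).
- by rewrite mulrn_wge0// ltW// mean_monomial_gt0.
rewrite [RHS]integral_mkcond beta_integral; last 2 first.
- apply/(measurable_restrictT _ _).1 => //; apply: measurable_funTS.
  by apply/measurable_EFinP; exact: measurable_binomial_mass.
- by move=> s; rewrite patchE; case: ifP => // _; rewrite lee_fin binomial_mass_ge0.
rewrite integral_mkcond; apply: eq_integral => s _; rewrite !patchE.
case: ifPn => _; last by rewrite mul0e.
by rewrite -!EFinM mulrC joint_density.
Qed.

Lemma posterior_le1 x A : (x <= kappa)%N -> measurable A -> posterior x A <= 1.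
Proof.
move=> xk mA; apply: (@le_trans _ _ (posterior x setT)).
  by apply: ge0_subset_integral => //; exact: (mdx x).
rewrite /posterior /posterior_density.
have b0 : (0 < be_fun (alpha + x%:R) (theta + kappa%:R - x%:R))%R.
  by rewrite be_fun_shift// mulr_gt0 ?be_fun_gt0 ?mean_monomial_gt0.
have w0 : (0 < count_mass x)%R.
  by rewrite /count_mass pmulrn_rgt0 ?mean_monomial_gt0// bin_gt0.
have := posterior_count_mass xk measurableT; rewrite integral_binomial_mass => h.
rewrite -(@lee_pmul2r _ (count_mass x)%:E)// mul1e.
by move: h; rewrite /posterior /posterior_density => ->.
Qed.

Lemma sum_binomial_mass s : (0 <= s <= 1)%R -> (\sum_(x < kappa.+1) binomial_mass x s = 1)%R.
Proof.
move=> s01; rewrite -(sum_binomial_pmf s kappa); apply: eq_bigr => x _.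
by rewrite /binomial_mass s01.
Qed.

Lemma beta_kernelE p A : measurable A -> (0 <= p <= 1)%R ->
  beta_kernel kappa alpha theta p A =
  \sum_(x < kappa.+1) posterior x A * (binomial_mass x p)%:E.
Proof.
move=> mA p01; rewrite /beta_kernel /posterior.
transitivity (\int[mu]_(s in A)
    \sum_(x < kappa.+1) ((binomial_mass x p)%:E * (posterior_density x s)%:E)).
  apply: eq_integral => s _; rewrite -sumEFin; apply: eq_bigr => x _.
  by rewrite -EFinM mulrC /binomial_mass p01.
rewrite ge0_integral_sum//; last 2 first.
- move=> x; apply: measurable_funTS; apply: emeasurable_funM; last exact: (mdx x).
  exact: measurable_cst.
- by move=> x s _; rewrite mule_ge0// lee_fin binomial_mass_ge0.
apply: eq_bigr => x _; rewrite ge0_integralZl_EFin//.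
- by rewrite muleC.
- exact: (measurable_funTS (mdx x)).
- exact: binomial_mass_ge0.
Qed.

End beta_binomial.


(** * Jumps of a stationary Beta chain *)

Section stationary_chain.
Local Open Scope ereal_scope.
Context {R : realType} d (T : measurableType d) (P : probability T R).
Variables (kappa : nat) (alpha theta : R) (v : nat -> {RV P >-> R}).
Hypothesis v_chain : beta_chain kappa alpha theta v.

Local Notation mu := (@lebesgue_measure R).

Let beta : probability R R := distribution P (v 0%N).

Let betaE A : measurable A -> beta A = \int[mu]_(s in A) (be_pdf alpha theta s)%:E.
Proof. by case: v_chain => _ + _; apply. Qed.

Let v01 i t : (0 <= v i t <= 1)%R.
Proof. by case: v_chain. Qed.

Let mbin x : measurable_fun [set: R] (fun s : R => (binomial_mass kappa x s)%:E).
Proof. by apply/measurable_EFinP; exact: (@measurable_binomial_mass R kappa x). Qed.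

Let binomial_mass_ge0_ereal x (s : R) : 0 <= (binomial_mass kappa x s)%:E.
Proof. by rewrite lee_fin binomial_mass_ge0. Qed.

Local Notation posterior := (posterior alpha theta kappa).

Lemma chain_step n A B : measurable A -> measurable B ->
  P ((v n.+1 @^-1` A) `&` (v n @^-1` B)) =
  \sum_(x < kappa.+1) posterior x A *
    \int[distribution P (v n)]_(p in B) (binomial_mass kappa x p)%:E.
Proof.
move=> mA mB; have [_ _ vS] := v_chain.
have GF : <<s coord_events `I_n.+1 v >> (v n @^-1` B).
  by apply: sub_sigma_algebra; exists n => //=; exists B => //; rewrite setTI.
have [_ /(_ _ GF) <-] := vS n A mA.
have mF : measurable (v n @^-1` B) by exact: measurable_preimage.
have mbv x : measurable_fun [set: T] (fun t => (binomial_mass kappa x (v n t))%:E).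
  exact: (measurableT_comp (mbin x) (@measurable_funPT _ _ _ _ (v n))).
transitivity (\int[P]_(t in v n @^-1` B)
    \sum_(x < kappa.+1) (posterior x A * (binomial_mass kappa x (v n t))%:E)).
  by apply: eq_integral => t _; exact: beta_kernelE.
rewrite ge0_integral_sum//; last 2 first.
- move=> x; apply: measurable_funTS; apply: emeasurable_funM; last exact: mbv.
  exact: measurable_cst.
- by move=> x t _; rewrite mule_ge0 ?posterior_ge0.
apply: eq_bigr => x _; rewrite ge0_integralZl ?posterior_ge0//; last first.
  exact: (measurable_funTS (mbv x)).
congr (_ * _); apply/esym.
exact: (@ge0_integral_pushforward _ _ _ _ _ (v n) _ P B (fun p => (binomial_mass kappa x p)%:E)
  mB (measurable_funTS (mbin x)) (fun p _ => binomial_mass_ge0_ereal x p)).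
Qed.

(** By [posterior_count_mass], the mixture of the posteriors with the beta-binomial
    weights is Be(alpha, theta) again. *)
Lemma stationary n A : measurable A -> P (v n @^-1` A) = beta A.
Proof.
elim: n A => [//|n IH] A mA.
have := chain_step n mA measurableT.
rewrite preimage_setT setIT => ->.
transitivity (\sum_(x < kappa.+1) \int[beta]_(s in A) (binomial_mass kappa x s)%:E).
  apply: eq_bigr => x _; rewrite -(posterior_count_mass betaE)//; last by rewrite -ltnS.
  rewrite -(integral_binomial_mass beta); congr (_ * _).
  by apply: eq_measure_integral => B mB _; exact: IH.
rewrite -ge0_integral_sum//; last by move=> x; exact: measurable_funTS.
transitivity (\int[beta]_(s in A) (cst 1 s)); last by rewrite integral_cst// mul1e.
apply: ae_eq_integral => //.
- by apply: emeasurable_sum => x; exact: measurable_funTS.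
- exists (~` `]0%R, 1%R[%classic); split.
  + exact: measurableC.
  + by rewrite [LHS]probability_setC// [X in 1 - X](beta_unit_itv betaE) subee.
  + move=> s /= /not_implyP[_ h]; rewrite in_itv/= => /andP[s0 s1]; apply: h.
    by rewrite sumEFin sum_binomial_mass ?ltW//= ltW.
Qed.

Lemma chain_joint n A B : measurable A -> measurable B ->
  P ((v n.+1 @^-1` A) `&` (v n @^-1` B)) =
  \sum_(x < kappa.+1) posterior x A * \int[beta]_(p in B) (binomial_mass kappa x p)%:E.
Proof.
move=> mA mB; rewrite chain_step//; apply: eq_bigr => x _; congr (_ * _).
by apply: eq_measure_integral => C mC _; exact: stationary.
Qed.

(** Let c be the middle of [a, b] and X the binomial count between the two states.
    If X <= kappa c, then X deviates from kappa v_(n+1) by at least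
    kappa (b - a) / 2; otherwise it deviates as much from kappa v_n.  Both pairs
    (X, v_n) and (X, v_(n+1)) have the same law, so the two cases add up to a
    single second moment of X - kappa S over all values of X. *)
Lemma chain_jump n a b : (a < b)%R -> (0 < kappa)%N ->
  P ((v n.+1 @^-1` `[b, +oo[) `&` (v n @^-1` `]-oo, a])) <=
  (4 / (kappa%:R * (b - a) ^+ 2))%:E.
Proof.
move=> ab k0; have k0' : (0 < kappa%:R :> R)%R by rewrite ltr0n.
pose dl := ((b - a) / 2)%R; pose c := ((a + b) / 2)%R.
have dl0 : (0 < dl)%R by rewrite divr_gt0// subr_gt0.
have kd0 : (0 < kappa%:R * dl)%R by rewrite mulr_gt0.
(* the deviation in units of its threshold, squared, as in Chebyshev's inequality *)
pose dev x (p : R) : R := (((x%:R - kappa%:R * p) / (kappa%:R * dl)) ^+ 2)%R.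
have dev_ge1 x p : (kappa%:R * dl <= `|x%:R - kappa%:R * p|)%R -> (1 <= dev x p)%R.
  move=> h; rewrite /dev -real_normK ?num_real// exprn_ege1//.
  by rewrite normrM normfV (gtr0_norm kd0) ler_pdivlMr// mul1r.
have mdev x : measurable_fun [set: R] (dev x).
  apply: measurable_funX; apply: measurable_funM => //.
  by apply: measurable_funB => //; exact: mulrl_measurable.
have mbd x : measurable_fun [set: R] (fun p : R => (binomial_mass kappa x p * dev x p)%:E).
  by apply/measurable_EFinP; apply: measurable_funM => //; exact: measurable_binomial_mass.
have bd0 x p : 0 <= (binomial_mass kappa x p * dev x p)%:E.
  by rewrite lee_fin mulr_ge0 ?binomial_mass_ge0// sqr_ge0.
have bound x (C : set R) : measurable C ->
    (forall p, C p -> (kappa%:R * dl <= `|x%:R - kappa%:R * p|)%R) ->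
    \int[beta]_(p in C) (binomial_mass kappa x p)%:E <=
    \int[beta]_p (binomial_mass kappa x p * dev x p)%:E.
  move=> mC Cdl; apply: (@le_trans _ _ (\int[beta]_(p in C) (binomial_mass kappa x p * dev x p)%:E)).
    apply: ge0_le_integral => //; [exact: measurable_funTS|exact: measurable_funTS|].
    by move=> p Cp; rewrite lee_fin ler_peMr ?binomial_mass_ge0// dev_ge1// Cdl.
  exact: ge0_subset_integral.
rewrite chain_joint//.
apply: (@le_trans _ _ (\sum_(x < kappa.+1) \int[beta]_p (binomial_mass kappa x p * dev x p)%:E)).
  apply: lee_sum => x _; have xk : (x <= kappa)%N by rewrite -ltnS.
  have [xc|cx] := leP (x%:R : R)%R (kappa%:R * c)%R.
    apply: (@le_trans _ _ (\int[beta]_(p in `[b, +oo[) (binomial_mass kappa x p)%:E)).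
      rewrite -(posterior_count_mass betaE xk (A := `[b, +oo[%classic))//.
      rewrite -(integral_binomial_mass beta) lee_wpmul2l ?posterior_ge0//.
      exact: ge0_subset_integral.
    apply: bound => // p; rewrite /= in_itv/= andbT => bp.
    rewrite distrC; apply: le_trans (ler_norm _).
    have := ler_wpM2l (ltW k0') bp; move: xc; rewrite /dl /c; nra.
  apply: (@le_trans _ _ (\int[beta]_(p in `]-oo, a]) (binomial_mass kappa x p)%:E)).
    rewrite -[leRHS]mul1e; rewrite lee_wpmul2r ?integral_ge0//.
    exact: (posterior_le1 betaE).
  apply: bound => // p; rewrite /= in_itv/= => pa.
  apply: le_trans (ler_norm _).
  have := ler_wpM2l (ltW k0') pa; move: cx; rewrite /dl /c; nra.
rewrite -ge0_integral_sum//.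
apply: (@le_trans _ _ (\int[beta]_p (cst (4 / (kappa%:R * (b - a) ^+ 2))%:E p))); last first.
  rewrite integral_cst// [X in _ * X]probability_setT mule1 //.
apply: ge0_le_integral => //.
- by move=> p _; apply: sume_ge0.
- exact: emeasurable_sum.
move=> p _; rewrite sumEFin lee_fin.
have [p01|p01] := boolP (0 <= p <= 1)%R; last first.
  rewrite big1 ?divr_ge0 ?mulr_ge0 ?sqr_ge0 ?subr_ge0 ?(ltW ab) ?(ltW k0')// => x _.
  by rewrite /binomial_mass (negbTE p01) mul0r.
rewrite (eq_bigr (fun x : 'I_kappa.+1 => (binomial_pmf kappa p x *
    (x%:R - kappa%:R * p) ^+ 2) / (kappa%:R * dl) ^+ 2)%R); last first.
  by move=> x _; rewrite /binomial_mass p01 /dev expr_div_n mulrA.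
rewrite -mulr_suml binomial_variance.
have ba0 : (0 < b - a)%R by rewrite subr_gt0.
have -> : (4 / (kappa%:R * (b - a) ^+ 2) = kappa%:R / (kappa%:R * dl) ^+ 2)%R.
  by rewrite /dl; field; rewrite !gt_eqF.
rewrite ler_pM2r ?invr_gt0 ?exprn_gt0// -mulrA ler_piMr ?(ltW k0')//.
by case/andP: p01 => p0 p1; nra.
Qed.

(** The grid of mesh 1 / m catches every upward jump of size at least 2 / m: some
    consecutive grid points separate the two states.  The sticks can only be
    compared when no earlier variable is 1, which has probability 1. *)
Lemma chain_fail n (eta : R) m : (0 < eta)%R -> (0 < m)%N ->
  (2 / m%:R <= eta ^+ 2)%R -> (0 < kappa)%N ->
  P (~` [set t | (stick_breaking v n.+1 t < stick_breaking v n t)%R]) <=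
  beta `]-oo, eta]%classic + (m.+1%:R * (4 * m%:R ^+ 2 / kappa%:R))%:E.
Proof.
move=> eta0 m0 meta k0.
have m0' : (0 < m%:R :> R)%R by rewrite ltr0n.
(* [Q k] is a jump across the cell between the grid points k and k + 1 *)
pose Q (k : nat) := (v n.+1 @^-1` `[(k.+1%:R / m%:R)%R, +oo[) `&`
                    (v n @^-1` `]-oo, (k%:R / m%:R)%R]).
pose N := \big[setU/set0]_(i < n.+1) (v i @^-1` [set 1%R]).
have mQ k : measurable (Q k) by apply: measurableI; exact: measurable_preimage.
have mN : measurable N by apply: bigsetU_measurable => i _; exact: measurable_preimage.
have PN : P N = 0.
  apply/eqP; rewrite eq_le measure_ge0 andbT.
  apply: le_trans (Boole_inequality P (A := fun i => v i @^-1` [set 1%R]) _) _.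
    by move=> i _; exact: measurable_preimage.
  by rewrite big1// => i _; rewrite [LHS]stationary// (beta_no_atom betaE).
have mE : measurable (v n @^-1` `]-oo, eta]) by exact: measurable_preimage.
pose U := \big[setU/set0]_(k < m.+1) Q k.
have mU : measurable U by apply: bigsetU_measurable.
have sub : ~` [set t | (stick_breaking v n.+1 t < stick_breaking v n t)%R] `<=`
    N `|` ((v n @^-1` `]-oo, eta]) `|` U).
  move=> t /= fail; have [tN|tN] := pselect (N t); first by left.
  right; have [ve|ve] := leP (v n t) eta; first by left; rewrite /= in_itv.
  right; have lt1 i : (i <= n)%N -> (v i t < 1)%R.
    move=> ni; rewrite lt_neqAle; case/andP: (v01 i t) => _ ->; rewrite andbT.
    apply/eqP => vi; apply: tN; rewrite /N -(bigcup_mkord n.+1 (fun i => v i @^-1` [set 1%R])).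
    by exists i.
  have r0 : (0 < \prod_(i < n) (1 - v i t))%R.
    by apply: prodr_gt0 => i _; rewrite subr_gt0 lt1// ltnW.
  have vv : (v n t <= v n.+1 t * (1 - v n t))%R.
    move/negP: fail; rewrite -leNgt /stick_breaking/= /stick_fun big_ord_recr/=.
    by rewrite [X in (_ <= _ * X)%R -> _]mulrC mulrA ler_pM2r.
  have /andP[v0 _] := v01 n t; have /andP[v0' v1'] := v01 n.+1 t.
  have vn1 := lt1 n (leqnn n).
  have step : (v n t + 2 / m%:R <= v n.+1 t)%R.
    apply: (@le_trans _ _ (v n t + eta ^+ 2)%R); first by rewrite lerD2l.
    have : (v n t <= v n.+1 t)%R by nra.
    by nra.
  (* the cell to be crossed is the one after the cell of [v n t] *)
  pose k := Num.truncn (v n t * m%:R).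
  have kv : (k%:R <= v n t * m%:R < k.+1%:R)%R by rewrite truncn_itv// mulr_ge0// ltW.
  have km : (k < m)%N.
    rewrite -(ltr_nat R); case/andP: kv => kv _; apply: le_lt_trans kv _.
    by rewrite gtr_pMl.
  rewrite /U -(bigcup_mkord m.+1 Q); exists k.+1 => //; case/andP: kv => k1 k2.
  split; rewrite /= in_itv/= ?andbT.
    rewrite ler_pdivrMr//; have := ler_wpM2r (ltW m0') step.
    rewrite mulrDl divfK ?gt_eqF// => h; apply: le_trans h.
    by rewrite -[k.+2%:R]natr1 -[k.+1%:R]natr1 -addrA lerD.
  by rewrite ler_pdivlMr// ltW.
have mfail : measurable (~` [set t | (stick_breaking v n.+1 t < stick_breaking v n t)%R]).
  apply: measurableC; rewrite -[X in measurable X]setTI.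
  exact: measurable_fun_ltr.
apply: (@le_trans _ _ (P (N `|` ((v n @^-1` `]-oo, eta]) `|` U)))).
  apply: le_measure => //; rewrite inE//; apply: measurableU => //.
  exact: measurableU.
apply: (@le_trans _ _ (P N + P ((v n @^-1` `]-oo, eta]) `|` U))).
  by apply: measureU2 => //; exact: measurableU.
rewrite [X in X + _]PN add0e.
apply: (@le_trans _ _ (P (v n @^-1` `]-oo, eta]) + P U)); first exact: measureU2.
rewrite [X in X + _]stationary//; apply: leeD => //.
apply: (@le_trans _ _ (\sum_(k < m.+1) P (Q k))).
  by apply: (Boole_inequality P (A := Q)).
apply: (@le_trans _ _ (\sum_(k < m.+1) (4 * m%:R ^+ 2 / kappa%:R)%:E)).
  apply: lee_sum => k _.
  have kk : (k%:R / m%:R < k.+1%:R / m%:R :> R)%R.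
    by rewrite ltr_pM2r ?invr_gt0// ltr_nat.
  apply: le_trans (chain_jump n kk k0) _; rewrite lee_fin le_eqVlt; apply/orP; left.
  apply/eqP; rewrite -natr1; field.
  by rewrite addrK oner_eq0 !gt_eqF// ltr0n.
by rewrite sumEFin sumr_const card_ord -[X in X%:E <= _]mulr_natl.
Qed.

End stationary_chain.


(** * The limit of large kappa *)

Section limit.
Local Open Scope ereal_scope.
Context {R : realType}.
Variables (alpha theta : R) (d : nat -> measure_display).
Variables (T : forall kappa, measurableType (d kappa)).
Variables (P : forall kappa, probability (T kappa) R).
Variable v : forall kappa, nat -> {RV (P kappa) >-> R}.
Hypothesis v_chain : forall kappa, beta_chain kappa alpha theta (v kappa).

Let beta : probability R R := distribution (P 0%N) (v 0%N 0%N).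

Lemma first_stick_law kappa A : measurable A ->
  distribution (P kappa) (v kappa 0%N) A = beta A.
Proof.
move=> mA; case: (v_chain kappa) => _ h _; case: (v_chain 0%N) => _ h0 _.
by apply: (eq_trans (h _ mA)); apply/esym; exact: h0.
Qed.

(** The intervals ]-oo, 1 / (k + 1)] decrease to ]-oo, 0], where Be(alpha, theta)
    has no mass. *)
Lemma first_stick_small (e : R) : (0 < e)%R ->
  exists2 eta : R, (0 < eta)%R & beta `]-oo, eta]%classic < e%:E.
Proof.
move=> e0.
pose A (k : nat) : set R := `]-oo, (k.+1%:R^-1)%R]%classic.
have mA k : measurable (A k) by exact: measurable_itv.
have capE : \bigcap_k A k = `]-oo, 0%R]%classic.
  apply/seteqP; split => s /=; rewrite in_itv/=.
    move=> h; rewrite leNgt; apply/negP => s0.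
    have [k] := ltr_add_invr s0; rewrite add0r => ks; have := h k Logic.I.
    by rewrite /A /= in_itv/= leNgt ks.
  by move=> s0 k _; rewrite /A /= in_itv/= (le_trans s0).
have beta0 : beta `]-oo, 0%R]%classic = 0.
  case: (v_chain 0%N) => _ h _.
  apply: (eq_trans (h _ (measurable_itv _))); apply: integral0_eq => s /=.
  by rewrite in_itv/= be_pdfE ltNge => ->.
have : beta \o A @ \oo --> beta (\bigcap_k A k).
  apply: nonincreasing_cvg_mu => //.
  - by rewrite (le_lt_trans (probability_le1 _ _))// ltry.
  - by rewrite capE; exact: measurable_itv.
  - move=> i j ij; apply/subsetPset => s; rewrite /A /= !in_itv/= => h.
    by apply: (le_trans h); rewrite lef_pV2 ?posrE// ler_nat.
rewrite capE [X in _ --> X -> _]beta0 => /fine_cvgP[_ /cvgrPdist_lt /(_ _ e0)] [k _ /(_ k (leqnn k))].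
rewrite /= sub0r normrN => h; exists k.+1%:R^-1%R; first by rewrite invr_gt0.
rewrite -[X in X < _]fineK ?fin_num_measure// lte_fin.
exact: le_lt_trans (ler_norm _) h.
Qed.

Lemma stick_breaking_decreases j :
  P kappa [set t | (stick_breaking (v kappa) j.+1 t < stick_breaking (v kappa) j t)%R]
    @[kappa --> \oo] --> 1.
Proof.
pose S kappa := [set t | (stick_breaking (v kappa) j.+1 t <
                          stick_breaking (v kappa) j t)%R].
have mS kappa : measurable (S kappa).
  by rewrite -[X in measurable X]setTI; exact: measurable_fun_ltr.
apply/fine_cvgP; split; first by near=> kappa; exact: fin_num_measure.
apply/cvgrPdist_lt => e e0.
have e20 : (0 < e / 2)%R by rewrite divr_gt0.
have [eta eta0 small] := first_stick_small e20.
pose m := (Num.truncn (2 / eta ^+ 2)).+1.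
have eta20 : (0 < eta ^+ 2)%R by rewrite exprn_gt0.
have meta : (2 / m%:R <= eta ^+ 2)%R.
  rewrite ler_pdivrMr ?ltr0n// mulrC -ler_pdivrMr//.
  by rewrite ltW// truncnS_gt.
(* for this [eta] and the grid of size [m] it determines, the bound of [chain_fail]
   is a small constant plus C / kappa *)
pose C : R := (m.+1%:R * (4 * m%:R ^+ 2))%R.
near=> kappa.
have k0 : (0 < kappa)%N by near: kappa; exists 1%N.
have kC : (C / kappa%:R < e / 2)%R.
  rewrite ltr_pdivrMr ?ltr0n// mulrC -ltr_pdivrMr//.
  near: kappa; exact: nbhs_infty_gtr.
have := chain_fail (v_chain kappa) j eta0 (isT : (0 < m)%N) meta k0.
rewrite [X in X + _]first_stick_law//.
rewrite [X in X <= _]probability_setC//.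
rewrite mulrA -/C => fail.
rewrite /= ger0_norm; last first.
  by rewrite subr_ge0 -lee_fin fineK ?fin_num_measure//; exact: probability_le1.
rewrite -lte_fin EFinB fineK ?fin_num_measure//.
apply: (le_lt_trans fail); rewrite [e]splitr EFinD.
by apply: lteD => //; rewrite lte_fin.
Unshelve. all: end_near.
Qed.

End limit.

Theorem corollary3p3 (R : realType) (d : nat -> measure_display)
    (T : forall kappa : nat, measurableType (d kappa))
    (P : forall kappa : nat, probability (T kappa) R)
    (alpha theta : R) (alpha_gt0 : 0 < alpha) (theta_gt0 : 0 < theta)
    (v : forall kappa : nat, nat -> {RV (P kappa) >-> R})
    (v_chain : forall kappa : nat, beta_chain kappa alpha theta (v kappa)) :
  (alpha = 1 -> size_biased_ordered (stick_breaking (v 0%N))) /\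
  (forall j : nat,
     P kappa [set t | stick_breaking (v kappa) j.+1 t
                      < stick_breaking (v kappa) j t]
       @[kappa --> \oo] --> 1%E).
Proof.
split=> [alpha1|j]; last exact: stick_breaking_decreases v_chain j.
apply: (chain_size_biased_ordered theta_gt0); rewrite -alpha1.
exact: v_chain.
Qed.
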